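(* Let $k>d\ge2$ be integers and let $\epsilon>0$. For Lebesgue almost all linear maps $L:\mathbb{R}^d\to\mathbb{R}^{k-d}$ the following holds for the corresponding cubical cut and project sets. Let $F_\pi$ be an admissible internal space with projection $\pi$, let $s\in\mathbb{R}^k$ be regular and $Y=Y_s$. Then there exists $\kappa>0$, depending only on $\pi$, such that for every equivalence class $\mathcal P$ of patches of $Y$ of type I or type II, every $y\in Y$, and every bounded set $A\subseteq E$ containing the origin, \[ |\xi'_{\mathcal P}(y,A)-\xi_{\mathcal P}|\le C\,\frac{|N_\kappa(\partial A)|}{|A\cap N_\kappa(A^{\mathrm c})^{\mathrm c}|}. \] In particular, for $A\subseteq E$ convex, bounded and containing a neighbourhood of the origin of $E$, \[ |\xi'_{\mathcal P}(y,RA)-\xi_{\mathcal P}|\le C R^{-1} \] for all sufficiently large $R$. In each of the two formulas the constant $C$ depends on $E$, $\epsilon$, $\pi$ and, for type I patches, $\mathcal P$.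
   Context: Cut and project setting. Let $0<d<k$ be integers. A linear map $L:\mathbb{R}^d\to\mathbb{R}^{k-d}$ is identified with its matrix $(\alpha_{ij})\in\mathbb{R}^{d(k-d)}$, $L(x)_i=\sum_{j=1}^d\alpha_{ij}x_j$, and ''almost all $L$'' refers to Lebesgue measure on $\mathbb{R}^{d(k-d)}$. The physical space is $E=\{(x,L(x)) : x\in\mathbb{R}^d\}\subset\mathbb{R}^k$. Standing assumption: $E$ is totally irrational, i.e. $E+\mathbb{Z}^k$ is dense in $\mathbb{R}^k$. An admissible internal space is a linear subspace $F_\pi\subset\mathbb{R}^k$ complementary to $E$ such that the projection $\pi:\mathbb{R}^k\to E$ along $F_\pi$ is injective on $\mathbb{Z}^k$; $\pi^*$ denotes the projection onto $F_\pi$ along $E$. The reference space is $F_\rho=\{0\}^d\times\mathbb{R}^{k-d}$, and $\rho:\mathbb{R}^k\to E$ is the projection onto $E$ along $F_\rho$. The cubical window is $\mathcal{W}_\pi=\pi^*(\{0\}^d\times[0,1]^{k-d})$ and the slice is $\mathcal{S}=\mathcal{W}_\pi+E$. For $s\in\mathbb{R}^k$ the cubical cut and project set is $Y_s=\pi(\mathcal{S}\cap(\mathbb{Z}^k+s))$. The point $s$ (and $Y_s$) is regular if $\partial\mathcal{S}\cap(\mathbb{Z}^k+s)=\emptyset$. For $y\in Y=Y_s$, $\tilde y$ denotes the unique element of $\mathbb{Z}^k+s$ with $\pi(\tilde y)=y$. Patches of type I and II. Let $\Omega\subseteq E$ be a bounded convex set containing a neighbourhood of the origin of $E$, and $r>0$.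 For $y\in Y$, \[ P_{\mathrm I}(y,r\Omega)=\{y'\in Y : y'-y\in r\Omega\},\qquad P_{\mathrm{II}}(y,r\Omega)=\{y'\in Y : \tilde y'-\tilde y\in\rho^{-1}(r\Omega)\}. \] For each type $*\in\{\mathrm I,\mathrm{II}\}$, two patches $P_*(y_1,r\Omega)$ and $P_*(y_2,r\Omega)$ are equivalent if $P_*(y_1,r\Omega)-y_1=P_*(y_2,r\Omega)-y_2$, and $\mathcal{P}_*(y,r\Omega)$ denotes the equivalence class of $P_*(y,r\Omega)$. An equivalence class $\mathcal P$ is understood to come with its type $*$, $r$ and $\Omega$. Frequencies. With $C(R)=\mathbb{Z}^k\cap([-R,R]^d\times\mathbb{R}^{k-d})$, the frequency of $\mathcal P$ is \[ \xi_{\mathcal P}=\lim_{R\to\infty}\frac{\#\{y'\in Y : \mathcal{P}_*(y',r\Omega)=\mathcal{P},\ \tilde y'-\tilde y\in C(R)\}}{\#\{y'\in Y : \tilde y'-\tilde y\in C(R)\}} \] (this limit exists and does not depend on $s$ or $y\in Y$). For a bounded search region $A\subseteq E$ containing the origin, \[ \xi'_{\mathcal P}(y,A)=\frac{\#\{y'\in Y : \mathcal{P}_*(y',r\Omega)=\mathcal P,\ y'\in A+y\}}{\#(Y\cap(A+y))}. \] Notation. For $X\subseteq E$, $N_\kappa(X)$ is the set of points of $E$ within distance $\kappa$ of $X$; $X^{\mathrm c}$ is the closure of the complement of $X$ in $E$; $\partial A$ is the boundary of $A$ in $E$; $|X|$ is the ($d$-dimensional) Lebesgue measure of $X$ in $E$.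 The region $A\cap N_\kappa(A^{\mathrm c})^{\mathrm c}$ may be read as the set of points of $A$ sufficiently far from $\partial A$.
   Formalization: In the second formula the constant C may also depend on the convex set A; with C independent of A the claim fails, since replacing A by small multiples of A would force an error o(1/R), which is false for boxes A and suitable admissible internal spaces. *)

(* Defs.v *)
From HB Require Import structures.
From mathcomp Require Import all_boot all_order all_algebra finmap.
From mathcomp Require Import all_classical all_reals all_analysis.

Set Implicit Arguments.
Unset Strict Implicit.
Unset Printing Implicit Defensive.

Import Order.TTheory GRing.Theory Num.Theory.
Import numFieldNormedType.Exports.

Local Open Scope classical_set_scope.
Local Open Scope ring_scope.

Section Lebesgue.
Context {R : realType} {p q : nat}.

Definition box (a b : 'M[R]_(p, q)) : set 'M[R]_(p, q) :=
  [set x | forall i j, a i j <= x i j <= b i j].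

Definition box_volume (a b : 'M[R]_(p, q)) : R :=
  \prod_i \prod_j Num.max 0 (b i j - a i j).

(* Lebesgue outer measure on R^(p * q); it is Lebesgue measure on the Lebesgue
   measurable sets, and the null sets are the sets of outer measure 0. *)
Definition lebesgue_mx (X : set 'M[R]_(p, q)) : \bar R :=
  ereal_inf [set l | exists a b : nat -> 'M[R]_(p, q),
    X `<=` \bigcup_n box (a n) (b n) /\
    l = (\sum_(0 <= n <oo) (box_volume (a n) (b n))%:E)%E].

Definition almost_all (P : 'M[R]_(p, q) -> Prop) : Prop :=
  lebesgue_mx [set x | ~ P x] = 0%E.

End Lebesgue.

(* R^k is 'cV[R]_(d + m) with k = d + m; usubmx and dsubmx are the projections
   to R^d and R^(k - d). *)
Section CutAndProject.
Context {R : realType} {d m : nat}.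
Local Notation V := 'cV[R]_(d + m).
Implicit Types (L : 'M[R]_(m, d)) (F : {vspace V}) (s y : V) (X A : set V).

Definition physE L : {vspace V} :=
  limg (linfun (fun x : 'cV[R]_d => col_mx x (L *m x))).

Lemma mem_physE L (v : V) :
  v \in physE L <-> exists x : 'cV[R]_d, v = col_mx x (L *m x).
Proof.
have fE : linear (fun x : 'cV[R]_d => col_mx x (L *m x)).
  by move=> a x y; rewrite mulmxDr -scalemxAr scale_col_mx add_col_mx.
pose fL := GRing.isLinear.Build _ _ _ _ _ fE.
pose f : {linear 'cV[R]_d -> V} := HB.pack (fun x => col_mx x (L *m x)) fL.
rewrite /physE; split.
  by case/memv_imgP => x _ ->; exists x; rewrite (lfunE f).
by case=> x ->; rewrite -[col_mx _ _]/(f x) -lfunE memv_img ?memvf.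
Qed.

Definition Eset L : set V := [set v | v \in physE L].

Definition Fref : {vspace V} :=
  limg (linfun (fun z : 'cV[R]_m => col_mx (0 : 'cV[R]_d) z)).

Lemma mem_Fref (v : V) :
  v \in Fref <-> exists z : 'cV[R]_m, v = col_mx (0 : 'cV[R]_d) z.
Proof.
have fE : linear (fun z : 'cV[R]_m => col_mx (0 : 'cV[R]_d) z).
  by move=> a x y; rewrite scale_col_mx add_col_mx scaler0 addr0.
pose fL := GRing.isLinear.Build _ _ _ _ _ fE.
pose f : {linear 'cV[R]_m -> V} := HB.pack (fun z => col_mx 0 z) fL.
rewrite /Fref; split.
  by case/memv_imgP => x _ ->; exists x; rewrite (lfunE f).
by case=> x ->; rewrite -[col_mx _ _]/(f x) -lfunE memv_img ?memvf.
Qed.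

Definition Zlattice : set V := [set v | forall i, v i 0 \is a Num.int].

Definition Zcoset s : set V := [set z + s | z in Zlattice].

Definition totally_irrational L : Prop :=
  dense [set v + z | v in Eset L & z in Zlattice].

(* pi, pi^* and rho; daddv_pi U W is the projection onto U along W when U and W
   are complementary. *)
Definition projE L F : 'End(V) := daddv_pi (physE L) F.
Definition projF L F : 'End(V) := daddv_pi F (physE L).
Definition rho L : 'End(V) := daddv_pi (physE L) Fref.

Definition admissible L F : Prop :=
  [/\ (physE L + F = fullv)%VS, (physE L :&: F = 0)%VS
    & set_inj Zlattice (projE L F)].

Definition cube : set V :=
  [set v | usubmx v = 0 /\ forall i, 0 <= dsubmx v i 0 <= 1].

Definition window L F : set V := [set projF L F v | v in cube].

Definition slice L F : set V := [set w + v | w in window L F & v in Eset L].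

Definition cps L F s : set V :=
  [set projE L F v | v in slice L F `&` Zcoset s].

Definition regular L F s : Prop :=
  (closure (slice L F) `\` (slice L F)°) `&` Zcoset s = set0.

(* The point written y with a tilde. *)
Definition lift_pt L F s y : V := get [set v | Zcoset s v /\ projE L F v = y].

Inductive patch_type := TypeI | TypeII.

Definition patch L F s (t : patch_type) (r : R) (Omega : set V) y : set V :=
  let rOmega := [set r *: w | w in Omega] in
  match t with
  | TypeI => [set y' | cps L F s y' /\ rOmega (y' - y)]
  | TypeII => [set y' | cps L F s y' /\
                 rOmega (rho L (lift_pt L F s y' - lift_pt L F s y))]
  end.

Definition patch_shape L F s t r Omega y : set V :=
  [set y' - y | y' in patch L F s t r Omega y].

(* Two patches are equivalent iff they have the same shape, so an equivalence
   class is given by its type, r, Omega and the common shape of its patches.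
   The same class can thus be considered in several sets Y_s. *)
Record patch_class := PatchClass {
  pc_type : patch_type;
  pc_radius : R;
  pc_region : set V;
  pc_shape : set V
}.
Implicit Type P : patch_class.

Definition in_class L F s P y : Prop :=
  patch_shape L F s (pc_type P) (pc_radius P) (pc_region P) y = pc_shape P.

Definition convex_bounded_nbhs0 L X : Prop :=
  [/\ X `<=` Eset L, convex_set X, bounded_set X & within (Eset L) (nbhs (0 : V)) X].

Definition is_patch_class L F s P : Prop :=
  [/\ convex_bounded_nbhs0 L (pc_region P), 0 < pc_radius P
    & exists2 y, cps L F s y & in_class L F s P y].

(* Junk value 0 on infinite sets; it is only applied to finite ones here. *)
Definition card_of X : R := (#|` fset_set X|)%:R.

Definition Cbox (t : R) : set V :=
  Zlattice `&` [set v | forall i, - t <= usubmx v i 0 <= t].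

Definition freq_ratio L F s P y (t : R) : R :=
  card_of [set y' | [/\ cps L F s y', in_class L F s P y'
                    & Cbox t (lift_pt L F s y' - lift_pt L F s y)]] /
  card_of [set y' | cps L F s y' /\ Cbox t (lift_pt L F s y' - lift_pt L F s y)].

(* The frequency, computed from the reference point y of Y_s. *)
Definition freq L F s P y : R :=
  lim (freq_ratio L F s P y t @[t --> +oo]).

Definition emp_freq L F s P y A : R :=
  let Ay := [set a + y | a in A] in
  card_of [set y' | [/\ cps L F s y', in_class L F s P y' & Ay y']] /
  card_of (cps L F s `&` Ay).

(* Lebesgue measure on E, in the coordinates given by the graph
   parametrisation x |-> (x, L x). The Euclidean d-dimensional volume is a
   constant multiple of it, and only quotients of volumes are used. *)
Definition volE L X : \bar R :=
  lebesgue_mx [set x : 'cV[R]_d | X (col_mx x (L *m x))].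

Definition edist (v w : V) : R := Num.sqrt (\sum_i (v i 0 - w i 0) ^+ 2).

Definition thicken L (kappa : R) X : set V :=
  [set v | Eset L v /\ exists2 x, X x & edist v x <= kappa].

(* E is closed, so closures in E of subsets of E are closures in R^k. *)
Definition cocl L X : set V := closure (Eset L `\` X).

Definition bdE L A : set V := closure A `&` closure (Eset L `\` A).

Definition core L (kappa : R) A : set V :=
  A `&` cocl L (thicken L kappa (cocl L A)).

(* C takes the same value on all classes of type II. *)
Definition uniform_on_typeII (C : patch_class -> R) : Prop :=
  forall P P', pc_type P = TypeII -> pc_type P' = TypeII -> C P = C P'.

End CutAndProject.

Arguments patch_class R d m : clear implicits.

(* Main.v *)
(* Points of Y_s are indexed by n in Z^d, and whether the n-th one has a given
   patch depends only on the position of x_n = {u - L n} in the torus, where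
   u = s2 - L s1: the class is a box for type II patches and a finite Boolean
   combination of boxes for type I.  For almost every L, the indicator F of a box
   minus its volume satisfies |sum_N F(x_n)| <= K per(N) for all finite N in Z^d,
   where per(N) is the number of edges leaving N and K depends only on L.  Indeed,
   averaging F over steps of length 2^8j in every direction leaves a function of
   size O(2^-9j): a Fejer majorant of the box reduces this to exponential sums, and
   the frequencies which resonate in all of the d >= 2 directions are on average
   too few to matter (Markov and Borel-Cantelli).  Telescoping over j, the change
   of the sum at each step is at most the sup norm times the step length times
   per(N), and these bounds are summable.  For N the set of indices of Y in A + y,
   per(N) is O(|N_kappa(bd A)|) and #N is at least a multiple of the volume of the
   core, as small cubes around the indices are disjoint and larger ones cover the
   core.  For dilates of a convex set, per(N) is bounded by counting the homothetic
   images of the boundary points. *)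
Require Import Defs.
From HB Require Import structures.
From mathcomp Require Import all_boot all_order all_algebra finmap.
From mathcomp Require Import all_classical all_reals all_analysis.
From mathcomp Require Import measurable_realfun complex.
From mathcomp Require Import zify ring lra.

Set Implicit Arguments.
Unset Strict Implicit.
Unset Printing Implicit Defensive.

Import Order.TTheory GRing.Theory Num.Theory.
Import numFieldNormedType.Exports.

Local Open Scope classical_set_scope.
Local Open Scope ring_scope.
Local Open Scope complex_scope.

(** * Averaging and the perimeter of a finite set *)

(** The exponents balance against each other. Put M = 2^8j (step length), tau = 2^-7j (resonance
    threshold) and delta = 2^-9j (precision). Telescoping needs M delta = 2^-j to be summable, and
    damping by averages needs M tau = 2^j to be large; hence delta < 1/M < tau. A Fejer majorant of
    precision delta needs degree delta^-3 = 2^27j. A frequency that is nonresonant in one direction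
    is damped by 1/(M tau) in each round of averaging; ten rounds yield 2^-10j, and the spare 2^-j
    pays for the total weight of the frequencies, which is bounded by a power of j. A fixed nonzero
    frequency resonates in all directions for a proportion O(tau^d) of the maps in a cube: for d = 2
    this is 2^-14j, small against delta, while a single direction would only give 2^-7j > delta.
    This is the obstacle that d >= 2 removes. As nothing is assumed on the shape of N, exponential
    sums over N itself are out of reach; the sum over N is only ever compared with its own shifts,
    at the price of one edge boundary per unit step. *)

Section Averages.
Context {K : numFieldType} {T : zmodType}.
Implicit Types (F G : T -> K) (v : T) (s : seq (nat * T)).

Definition avg (M : nat) v F : T -> K :=
  fun n => M%:R^-1 * \sum_(k < M) F (n + v *+ k).

Definition avgs s F : T -> K := foldr (fun p f => avg p.1 p.2 f) F s.

Lemma avgC M v M' v' F : avg M v (avg M' v' F) = avg M' v' (avg M v F).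
Proof.
apply/funext => n; rewrite /avg !mulr_sumr.
under eq_bigr do rewrite mulrCA !mulr_sumr.
rewrite exchange_big; apply: eq_bigr => i _; rewrite mulrCA !mulr_sumr.
by apply: eq_bigr => k _; rewrite addrAC mulrCA.
Qed.

Lemma avgs_avg s M v F : avgs s (avg M v F) = avg M v (avgs s F).
Proof. by elim: s => //= p s ->; rewrite avgC. Qed.

Lemma avgsC s s' F : avgs s (avgs s' F) = avgs s' (avgs s F).
Proof. by elim: s' => //= p s' <-; rewrite avgs_avg. Qed.

Lemma avgs_cat s s' F : avgs (s ++ s') F = avgs s (avgs s' F).
Proof. by rewrite /avgs foldr_cat. Qed.

Lemma avg_norm_le M v F (c : K) :
  0 <= c -> (forall n, `|F n| <= c) -> forall n, `|avg M v F n| <= c.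
Proof.
move=> c0 Fc n; rewrite /avg normrM normfV.
case: M => [|M]; first by rewrite big_ord0 normr0 mulr0.
rewrite (@ger0_norm _ M.+1%:R) // mulrC ler_pdivrMr ?ltr0n //.
rewrite (le_trans (ler_norm_sum _ _ _))// (le_trans (ler_sum _ (fun i _ => Fc _)))//.
by rewrite sumr_const card_ord mulr_natr.
Qed.

Lemma avgs_norm_le s F (c : K) :
  0 <= c -> (forall n, `|F n| <= c) -> forall n, `|avgs s F n| <= c.
Proof. by move=> c0 Fc; elim: s => //= p s IH; apply: avg_norm_le. Qed.

Lemma avg_le M v F G :
  (forall n, F n <= G n) -> forall n, avg M v F n <= avg M v G n.
Proof. by move=> FG n; rewrite ler_wpM2l ?invr_ge0 ?ler0n// ler_sum. Qed.

Lemma avgs_le s F G :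
  (forall n, F n <= G n) -> forall n, avgs s F n <= avgs s G n.
Proof. by move=> FG; elim: s => //= p s IH; apply: avg_le. Qed.

Lemma avgsB s F G n : avgs s (fun n => F n - G n) n = avgs s F n - avgs s G n.
Proof.
elim: s n => //= p s IH n; rewrite /avg; under eq_bigr do rewrite IH.
by rewrite sumrB mulrBr.
Qed.

Lemma avgs_cst s (c : K) n :
  all (fun p => (0 < p.1)%N) s -> avgs s (fun=> c) n = c.
Proof.
elim: s n => //= p s IH n /andP[p0 sP]; rewrite /avg.
under eq_bigr do rewrite IH//.
by rewrite sumr_const card_ord -[c *+ _]mulr_natl mulKf // pnatr_eq0 -lt0n.
Qed.

Lemma avgs_sum s (I : Type) (r : seq I) (F : I -> T -> K) n :
  avgs s (fun n => \sum_(i <- r) F i n) n = \sum_(i <- r) avgs s (F i) n.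
Proof.
elim: s n => //= p s IH n; rewrite /avg.
under [X in _ * X = _]eq_bigr do rewrite IH.
by rewrite exchange_big mulr_sumr.
Qed.

Lemma avgsZ s (c : K) F n : avgs s (fun n => c * F n) n = c * avgs s F n.
Proof.
elim: s n => //= p s IH n; rewrite /avg; under eq_bigr do rewrite IH.
by rewrite -mulr_sumr mulrCA.
Qed.

End Averages.

Lemma avgs_morph (K K' : numFieldType) (T : zmodType) (f : {rmorphism K -> K'})
  s (F : T -> K) n : f (avgs s F n) = avgs s (f \o F) n.
Proof.
elim: s n => //= p s IH n.
by rewrite /avg rmorphM fmorphV rmorph_nat rmorph_sum; under eq_bigr do rewrite IH.
Qed.

Section Perimeter.
Context {R : realType} {T : zmodType}.
Implicit Types (F : T -> R) (v : T) (N : {fset T}).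

Definition edge_bd v N : nat :=
  \sum_(n <- N) (((n + v)%R \notin N) + ((n - v)%R \notin N)).

(** The terms F(n) with n - v in N and the terms F(n' + v) with n' + v in N are the same and cancel.
    What survives is indexed by the points counted in [edge_bd]. *)
Lemma sum_shift_le v N F (c : R) : (forall n, `|F n| <= c) ->
  `|\sum_(n <- N) F n - \sum_(n <- N) F (n + v)| <= c * (edge_bd v N)%:R.
Proof.
move=> Fc.
have [-> ->] : \sum_(n <- N) F n = \sum_(n <- N | n - v \in N) F n +
                                   \sum_(n <- N | n - v \notin N) F n /\
   \sum_(n <- N) F (n + v) = \sum_(n <- N | n + v \in N) F (n + v) +
                             \sum_(n <- N | n + v \notin N) F (n + v).
  by split; [rewrite (bigID (fun n => n - v \in N)) | rewrite (bigID (fun n => n + v \in N))].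
have -> : \sum_(n <- N | n - v \in N) F n = \sum_(n <- N | n + v \in N) F (n + v).
  rewrite -big_filter -[RHS]big_filter -(big_map (+%R^~ v) predT F).
  apply: perm_big; apply: uniq_perm.
  - by rewrite filter_uniq ?fset_uniq.
  - by rewrite (map_inj_uniq (@addIr _ v)) filter_uniq ?fset_uniq.
  move=> n; rewrite mem_filter; apply/idP/mapP => [/andP[nv nN]|].
    by exists (n - v); rewrite ?subrK // mem_filter subrK nN.
  by case=> n'; rewrite mem_filter => /andP[? ?] ->; rewrite addrK; apply/andP.
rewrite opprD addrACA subrr add0r (le_trans (ler_normB _ _)) //.
rewrite /edge_bd big_split /= addnC natrD mulrDr !natr_sum !mulr_sumr.
rewrite lerD // (le_trans (ler_norm_sum _ _ _)) // big_mkcond ler_sum // => n _.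
  by case: ifP; rewrite ?mulr1 ?mulr0.
by case: ifP; rewrite ?mulr1 ?mulr0.
Qed.

(** A shift by k v is k shifts by v, each costing c times [edge_bd], and k < M. *)
Lemma sum_avg_le M v N F (c : R) : (0 < M)%N -> (forall n, `|F n| <= c) ->
  `|\sum_(n <- N) F n - \sum_(n <- N) avg M v F n| <=
    c * M%:R * (edge_bd v N)%:R.
Proof.
move=> M0 Fc; have M0' : 0 < M%:R :> R by rewrite ltr0n.
have c0 : 0 <= c by apply: le_trans (Fc 0).
have step k : `|\sum_(n <- N) F n - \sum_(n <- N) F (n + v *+ k)| <=
    c * k%:R * (edge_bd v N)%:R.
  elim: k => [|k IH].
    by under [X in _ - X]eq_bigr do rewrite mulr0n addr0; rewrite subrr normr0 mulr0 mul0r.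
  have H := @sum_shift_le v N (fun n => F (n + v *+ k)) c (fun n => Fc _).
  rewrite -natr1 mulrDr mulr1 mulrDl (le_trans _ (lerD IH H)) //.
  under [X in _ <= _ + `|_ - X|]eq_bigr do rewrite addrAC -addrA -mulrSr.
  by rewrite (le_trans _ (ler_normD _ _)) // addrA subrK.
have -> : \sum_(n <- N) F n - \sum_(n <- N) avg M v F n =
    M%:R^-1 * \sum_(k < M) (\sum_(n <- N) F n - \sum_(n <- N) F (n + v *+ k)).
  rewrite sumrB sumr_const card_ord -[(\sum_(n <- N) F n) *+ M]mulr_natl mulrBr mulKf ?gt_eqF //.
  by congr (_ - _); rewrite exchange_big mulr_sumr; apply: eq_bigr.
rewrite normrM gtr0_norm ?invr_gt0 // mulrC ler_pdivrMr //.
rewrite (le_trans (ler_norm_sum _ _ _)) //.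
apply: (@le_trans _ _ (\sum_(k < M) c * M%:R * (edge_bd v N)%:R)).
  apply: ler_sum => k _; apply: le_trans (step k) _.
  by rewrite ler_wpM2r // ler_wpM2l // ler_nat ltnW.
by rewrite sumr_const card_ord -[leLHS]mulr_natr.
Qed.

Lemma sum_avgs_le M N F (c : R) (vs : seq T) : (0 < M)%N -> (forall n, `|F n| <= c) ->
  `|\sum_(n <- N) F n - \sum_(n <- N) avgs [seq (M, v) | v <- vs] F n| <=
    c * M%:R * (\sum_(v <- vs) edge_bd v N)%:R.
Proof.
move=> M0 Fc; have c0 : 0 <= c by apply: le_trans (Fc 0).
elim: vs => [|v vs IH] /=; first by rewrite subrr normr0 big_nil mulr0.
rewrite big_cons natrD mulrDr [leRHS]addrC.
have H := @sum_avg_le M v N _ c M0 (avgs_norm_le [seq (M, v) | v <- vs] c0 Fc).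
by rewrite (le_trans _ (lerD IH H)) // (le_trans _ (ler_normD _ _)) // addrA subrK.
Qed.

(** * Telescoping over the scales 2^8j *)

Section Telescope.
Context {d : nat}.
Variables (e : 'I_d -> T) (p : nat).

Definition perimeter N : nat := \sum_i edge_bd (e i) N.

(** Repeating each direction p times raises the damping factor of a character to the power p, while
    the cost in perimeter grows only by the factor p. *)
Definition avg_dirs : seq T := flatten (nseq p [seq e i | i <- enum 'I_d]).

Definition avg_steps j : seq (nat * T) := [seq ((2 ^ (8 * j))%N, v) | v <- avg_dirs].

Fixpoint telescope_avg F j : T -> R :=
  if j is j'.+1 then avgs (avg_steps j') (telescope_avg F j') else F.

(** Averages commute, so the average at scale j may be applied to F before the earlier ones, which
    do not increase the sup norm. *)
Lemma avgs_telescope s F j :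
  avgs s (telescope_avg F j) = telescope_avg (avgs s F) j.
Proof. by elim: j => //= j IH; rewrite avgsC IH. Qed.

Lemma telescope_avg_norm_le F j (c : R) : 0 <= c ->
  (forall n, `|F n| <= c) -> forall n, `|telescope_avg F j n| <= c.
Proof. by move=> c0 Fc; elim: j => //= j IH; apply: avgs_norm_le. Qed.

Lemma sum_edge_dirs N : (\sum_(v <- avg_dirs) edge_bd v N)%N = (p * perimeter N)%N.
Proof.
rewrite /avg_dirs; elim: (p) => [|q IH] /=; first by rewrite big_nil.
by rewrite big_cat IH big_map big_enum mulSn.
Qed.

(* The sums over [N] of two consecutive iterated averages differ by at most
   (sup of the first) * 2^8j * perimeter <= C * 2^-9(j-1) * 2^8j * perimeter,
   which is summable. *)
Lemma sum_le_perimeter F (C : R) :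
  (forall n, `|F n| <= C) ->
  (forall j n, `|avgs (avg_steps j) F n| <= C * 2^-1 ^+ (9 * j)) ->
  forall N, `|\sum_(n <- N) F n| <= C * (2 ^+ 10 * p%:R) * (perimeter N)%:R.
Proof.
move=> FC HC N; have C0 : 0 <= C by apply: le_trans (FC 0).
have h0 k : 0 <= 2^-1 ^+ k :> R by rewrite exprn_ge0.
have sup j n : `|telescope_avg F j n| <= C * (2 ^+ 9 * 2^-1 ^+ (9 * j)).
  case: j => [|j] /=.
    by rewrite muln0 expr0 mulr1 (le_trans (FC n)) // ler_peMr ?exprn_ege1 ?ler1n.
  rewrite avgs_telescope.
  suff -> : 2 ^+ 9 * 2^-1 ^+ (9 * j.+1) = 2^-1 ^+ (9 * j) :> R.
    by apply: telescope_avg_norm_le => [|n']; [rewrite mulr_ge0 | exact: HC].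
  by rewrite mulnS exprD mulrA exprVn divff ?mul1r // expf_neq0 // pnatr_eq0.
have step j : `|\sum_(n <- N) telescope_avg F j n - \sum_(n <- N) telescope_avg F j.+1 n|
    <= C * (2 ^+ 9 * p%:R) * (perimeter N)%:R * 2^-1 ^+ j.
  apply: le_trans (sum_avgs_le _ _ _ (sup j)) _; first by rewrite expn_gt0.
  rewrite sum_edge_dirs natrM natrX.
  suff -> : 2^-1 ^+ (9 * j) = 2^-1 ^+ (8 * j) * 2^-1 ^+ j :> R.
    rewrite le_eqVlt; apply/orP; left; apply/eqP.
    have : 2^-1 ^+ (8 * j) * 2 ^+ (8 * j) = 1 :> R.
      by rewrite -exprMn mulVf ?expr1n // pnatr_eq0.
    move: (2^-1 ^+ (8 * j)) (2 ^+ (8 * j)) (2^-1 ^+ j) => x y z xy.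
    by transitivity (C * (2 ^+ 9 * p%:R) * (perimeter N)%:R * z * (x * y)); [ring | rewrite xy mulr1].
  by rewrite -exprD; congr (_ ^+ _); lia.
(* The telescoping stops at scale J; the remaining sum is at most #N times the sup norm there, which
   tends to 0 as J grows with N fixed. *)
have bd J : `|\sum_(n <- N) F n| <=
   C * (2 ^+ 10 * p%:R) * (perimeter N)%:R + C * 2 ^+ 9 * (#|` N|)%:R * 2^-1 ^+ J.
  have tele : `|\sum_(n <- N) F n - \sum_(n <- N) telescope_avg F J n| <=
      C * (2 ^+ 10 * p%:R) * (perimeter N)%:R * (1 - 2^-1 ^+ J).
    elim: J => [|J IH]; first by rewrite subrr normr0 expr0 subrr mulr0.
    have := lerD IH (step J) => /(le_trans (ler_normD _ _)).
    rewrite addrA subrK => /le_trans; apply; rewrite le_eqVlt; apply/orP; left.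
    by apply/eqP; rewrite [2^-1 ^+ J.+1]exprS; move: (2^-1 ^+ J) => x; field.
  have last : `|\sum_(n <- N) telescope_avg F J n| <= C * 2 ^+ 9 * (#|` N|)%:R * 2^-1 ^+ J.
    rewrite (le_trans (ler_norm_sum _ _ _)) //.
    apply: (@le_trans _ _ (\sum_(n <- N) C * (2 ^+ 9 * 2^-1 ^+ J))).
      apply: ler_sum => n _; apply: le_trans (sup J n) _.
      by rewrite !ler_wpM2l // ler_wiXn2l ?invr_ge0 ?invf_le1 ?ler1n // leq_pmull.
    by rewrite big_const_seq count_predT iter_addr_0 -[leLHS]mulr_natr [leRHS]mulrAC !mulrA.
  rewrite -[X in `|X|](subrK (\sum_(n <- N) telescope_avg F J n)).
  rewrite (le_trans (ler_normD _ _)) // lerD // (le_trans tele) //.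
  by rewrite ler_piMr ?mulr_ge0 // gerBl.
apply/ler_addgt0Pr => eps eps0.
have [J HJ] : exists J, C * 2 ^+ 9 * (#|` N|)%:R * 2^-1 ^+ J <= eps.
  pose x := C * 2 ^+ 9 * (#|` N|)%:R / eps; exists (Num.truncn x).+1.
  set J := (Num.truncn x).+1; have xJ : x < J%:R by exact: truncnS_gt.
  have HJ : J%:R <= 2 ^+ J :> R by rewrite -natrX ler_nat ltnW // ltn_expl.
  rewrite exprVn ler_pdivrMr ?exprn_gt0 // -ler_pdivrMl // mulrC.
  exact: le_trans (ltW xJ) HJ.
by apply: le_trans (bd J) _; rewrite lerD2l.
Qed.

End Telescope.
End Perimeter.

(** * The characters e(t) = exp(2 pi i t) *)


Section Expi.
Context {R : realType}.
Implicit Types t : R.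

Definition expi t : R[i] := cos (2 * pi * t) +i* sin (2 * pi * t).

Lemma expiD s t : expi (s + t) = expi s * expi t.
Proof. by rewrite /expi mulrDr cosD sinD; simpc; congr (_ +i* _); rewrite addrC. Qed.

Lemma expi0 : expi 0 = 1.
Proof. by rewrite /expi mulr0 cos0 sin0. Qed.

Lemma expiN t : expi (- t) = conjc (expi t).
Proof. by rewrite /expi mulrN cosN sinN. Qed.

Lemma expi_conjM t : expi t * conjc (expi t) = 1.
Proof. by rewrite -expiN -expiD subrr expi0. Qed.

Lemma norm_expi t : `|expi t| = 1.
Proof. by apply/eqP; rewrite -sqrp_eq1 // sqr_normc expi_conjM. Qed.

Lemma expi1 : expi 1 = 1.
Proof.
rewrite /expi mulr1 mulr_natl -[X in cos X]add0r -[X in sin X]add0r.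
by rewrite cosD2pi sinD2pi cos0 sin0.
Qed.

Lemma expiMn t k : expi (t *+ k) = expi t ^+ k.
Proof. by elim: k => [|k IH]; rewrite ?mulr0n ?expi0 // mulrS expiD IH exprS. Qed.

Lemma expi_int (z : int) : expi z%:~R = 1.
Proof.
have nat_case n : expi n%:R = 1 by rewrite expiMn expi1 expr1n.
by case: z => n; rewrite ?NegzE ?mulrNz ?expiN nat_case // conjc1.
Qed.

Lemma expi_sum (I : Type) (r : seq I) (F : I -> R) :
  expi (\sum_(i <- r) F i) = \prod_(i <- r) expi (F i).
Proof. by apply: (big_morph expi expiD expi0). Qed.

(** A weak form of Jordan's inequality. With x = pi t, the mean value theorem gives x cos x <= sin
    x; squaring and eliminating the cosine gives x^2 <= (1 + x^2) sin^2 x, and 1 + x^2 <= pi^2 since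
    x <= pi/2. *)
Lemma sqr_sin_ge t : `|t| <= 1 / 2 -> t ^+ 2 <= sin (pi * t) ^+ 2.
Proof.
wlog t0 : t / 0 <= t => [H th|].
  case: (leP 0 t) => [t0|t0]; first exact: H.
  by rewrite -sqrrN -(sqrrN (sin _)) -sinN -mulrN H ?normrN // oppr_ge0 ltW.
rewrite ger0_norm // => th; have pi2 := @pi_ge2 R.
case: (eqVneq t 0) => [->|tn0]; first by rewrite mulr0 sin0.
have tgt : 0 < t by rewrite lt_neqAle eq_sym tn0.
set x := pi * t; have x0 : 0 < x by rewrite mulr_gt0 // pi_gt0.
have xpi : x <= pi by rewrite /x -[leRHS]mulr1 ler_pM2l ?pi_gt0 //; lra.
have [c /andP[c0 cx]] : exists2 c, 0 < c < x & sin x - sin 0 = cos c * (x - 0).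
  have [c] := @MVT R sin cos 0 x x0 (fun y _ => @is_derive_sin R y)
    (continuous_subspaceT (@continuous_sin R)).
  by rewrite in_itv /= => ? ?; exists c.
rewrite sin0 !subr0 => sinE.
have cosc : cos x <= cos c by apply: ltW; rewrite ltr_cos ?in_itv /=; try lra.
have h1 : x * cos x <= sin x by rewrite sinE mulrC ler_pM2r.
have s0 : 0 <= sin x by apply: sin_ge0_pi; lra.
have h2 : x ^+ 2 * (1 - sin x ^+ 2) <= sin x ^+ 2.
  rewrite -cos2sin2 -exprMn; case: (leP 0 (cos x)) => cs0.
    by rewrite ler_sqr ?nnegrE // mulr_ge0 // ltW.
  have : pi / 2 <= x by rewrite leNgt; apply/negP => H; move: cs0; rewrite ltNge cos_ge0_pihalf //; lra.
  rewrite /x ler_pdivrMr // => H; have -> : t = 1 / 2.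
    have : 1 <= t * 2 by rewrite -(ler_pM2l (@pi_gt0 R)) mulr1 mulrA.
    lra.
  by rewrite mul1r cos_pihalf mulr0 expr0n /= sqr_ge0.
have h3 : x ^+ 2 <= sin x ^+ 2 * (1 + x ^+ 2) by lra.
have h4 : 1 + x ^+ 2 <= pi ^+ 2.
  have : x <= pi / 2 by rewrite /x ler_pM2l ?pi_gt0 //; lra.
  by move=> H; nra.
have h5 : x ^+ 2 <= sin x ^+ 2 * pi ^+ 2.
  by apply: (le_trans h3); rewrite ler_wpM2l // sqr_ge0.
by move: h5; rewrite {1}/x exprMn mulrC ler_pM2r // exprn_gt0 ?pi_gt0.
Qed.

(** |1 - e(t)| = 2 |sin(pi t)|, and e has period 1, so that t may be reduced to |t| <= 1/2, the
    range of [sqr_sin_ge]. *)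
Lemma norm_sub1_expi_ge t (tau : R) :
  (forall z : int, tau <= `|t - z%:~R|) -> (2 * tau)%:C <= `|1 - expi t|.
Proof.
move=> Ht; set z := Num.floor (t + 1 / 2); set t' := t - z%:~R.
have -> : expi t = expi t' by rewrite expiD -mulrNz expi_int mulr1.
have t'h : `|t'| <= 1 / 2.
  have := floor_le (t + 1/2); have := @floorD1_gt R (t + 1/2).
  rewrite -/z intrD1 /t' => h1 h2; rewrite ler_norml; lra.
case: (leP tau 0) => tau0.
  by apply: (le_trans _ (normr_ge0 _)); rewrite -[0]/(0%:C) lecR; lra.
have sq : (2 * tau) ^+ 2 <= (1 - cos (2 * pi * t')) ^+ 2 + sin (2 * pi * t') ^+ 2.
  have -> : 2 * pi * t' = (pi * t') *+ 2 by rewrite -[RHS]mulr_natl mulrA.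
  set y := pi * t'; rewrite cos_mulr2n sin_mulr2n.
  have H1 : tau ^+ 2 <= sin y ^+ 2.
    apply: le_trans (sqr_sin_ge t'h).
    by rewrite -(real_normK (num_real t')) ler_sqr ?nnegrE //; [exact: Ht | exact: ltW].
  have := cos2Dsin2 y; move: (cos y) (sin y) H1 => c s H1 cs.
  have -> : (1 - (c ^+ 2 *+ 2 - 1)) ^+ 2 + ((c * s) *+ 2) ^+ 2 = 4 * s ^+ 2.
    have c2 : c ^+ 2 = 1 - s ^+ 2 by rewrite -cs addrK.
    transitivity ((2 - 2 * c ^+ 2) ^+ 2 + 4 * c ^+ 2 * s ^+ 2); first by ring.
    by rewrite c2; ring.
  by rewrite exprMn; lra.
rewrite normc_def lecR /= /expi /=.
rewrite -(ler_sqr) ?nnegrE ?sqrtr_ge0 ?sqr_sqrtr ?addr_ge0 ?sqr_ge0 //; last lra.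
by rewrite add0r sqrrN.
Qed.

Lemma norm_geom_sum_le t (tau : R) N : 0 < tau ->
  (forall z : int, tau <= `|t - z%:~R|) ->
  `|\sum_(k < N) expi (t *+ k)| <= (tau^-1)%:C.
Proof.
move=> tau0 Ht; have := norm_sub1_expi_ge Ht => H.
have : `|1 - expi t| * `|\sum_(k < N) expi (t *+ k)| <= 2.
  rewrite -normrM; under eq_bigr do rewrite expiMn.
  have -> : (1 - expi t) * \sum_(i < N) expi t ^+ i = 1 - expi t ^+ N.
    by rewrite -[1 in RHS](expr1n _ N) subrXX; congr (_ * _); apply: eq_bigr => i _; rewrite expr1n mul1r.
  by rewrite (le_trans (ler_normB _ _)) // normr1 normrX norm_expi expr1n.
move=> H2; have H3 := le_trans (ler_wpM2r (normr_ge0 _) H) H2.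
have t2 : (0 : R[i]) < (2 * tau)%:C by rewrite ltcR; lra.
have E : (2 * tau)%:C * (tau^-1)%:C = 2 :> R[i].
  by rewrite -rmorphM /= mulfK ?gt_eqF // rmorph_nat.
by rewrite -(ler_pM2l t2) E.
Qed.

End Expi.

(** * Trigonometric majorants of intervals *)

Section FejerMajorant.
Context {R : realType}.
Implicit Types (x t : R) (g k : int).

Definition dif H (hh : 'I_H * 'I_H) : int := (hh.1 : nat)%:Z - (hh.2 : nat)%:Z.

Lemma absz_dif_le H (hh : 'I_H * 'I_H) : (`|dif hh| <= H)%N.
Proof. by case: hh => h h'; have := ltn_ord h; have := ltn_ord h'; rewrite /dif /=; lia. Qed.

(** Coefficients are indexed by pairs (h, h') instead of frequencies h - h', as in the expansion of
    a squared Dirichlet sum. Each frequency is thus repeated, which the factor 1/H in the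
    coefficient bounds compensates. *)
Definition trig_poly H (w : 'I_H * 'I_H -> R[i]) x : R[i] :=
  \sum_hh w hh * expi ((dif hh)%:~R * x).

(** Its squared modulus is H times the Fejer kernel. *)
Definition dirichlet H t : R[i] := \sum_(h < H) expi (t *+ h).

Lemma sqr_norm_dirichlet H t :
  `|dirichlet H t| ^+ 2 = \sum_(hh : 'I_H * 'I_H) expi ((dif hh)%:~R * t).
Proof.
rewrite sqr_normc /dirichlet rmorph_sum mulr_suml.
rewrite (eq_bigr (fun hh : 'I_H * 'I_H => expi (t *+ hh.1) * conjc (expi (t *+ hh.2)))); last first.
  move=> hh _; rewrite -expiN -expiD; congr expi.
  by rewrite /dif rmorphB /= mulrBl !mulr_natl.
rewrite -(pair_bigA _ (fun i j : 'I_H => expi (t *+ i) * conjc (expi (t *+ j)))) /=.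
by apply: eq_bigr => i _; rewrite mulr_sumr.
Qed.

Definition int_seq k0 (n : nat) : seq int := [seq k0 + i%:Z | i <- iota 0 n].

Lemma mem_int_seq k0 n k : (k \in int_seq k0 n) = (k0 <= k < k0 + n%:Z).
Proof.
apply/mapP/idP => [[l]|H]; first by rewrite mem_iota => ? ->; lia.
by exists `|k - k0|%N; rewrite ?mem_iota; lia.
Qed.

Lemma int_seq_uniq k0 n : uniq (int_seq k0 n).
Proof. by rewrite map_inj_uniq ?iota_uniq // => i j /addrI []. Qed.

Lemma size_int_seq k0 n : size (int_seq k0 n) = n.
Proof. by rewrite size_map size_iota. Qed.

Lemma big_mem_swap (V : nmodType) (T : eqType) (s1 s2 : seq T) (f : T -> V) :
  uniq s1 -> uniq s2 ->
  \sum_(z <- s1 | z \in s2) f z = \sum_(z <- s2 | z \in s1) f z.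
Proof.
move=> u1 u2; rewrite -big_filter -[RHS]big_filter; apply: perm_big.
by apply: uniq_perm; rewrite ?filter_uniq // => z; rewrite !mem_filter andbC.
Qed.

(** The reason for nodes k/2H rather than k/H: frequencies |g| <= H then keep g/2H in [-1/2, 1/2],
    where 0 is a nearest integer. *)
Lemma dist_frac_ge (H : nat) g (z : int) : (0 < H)%N -> (`|g| <= H)%N ->
  (`|g|%N)%:R / (2 * H)%:R <= `|- (g%:~R / (2 * H)%:R) - z%:~R| :> R.
Proof.
move=> H0 gH; have q0 : 0 < (2 * H)%:R :> R by rewrite ltr0n; lia.
rewrite ler_pdivrMr // -[X in _ <= _ * X](gtr0_norm q0) -normrM mulrBl mulNr divfK ?gt_eqF //.
have -> : - g%:~R - z%:~R * (2 * H)%:R = (- g - z * (2 * H)%:Z)%:~R :> R.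
  by rewrite intrB mulrNz intrM.
rewrite -intr_norm [X in X <= _]pmulrn ler_int /=.
have [->|z0] := eqVneq z 0; first by rewrite mul0r subr0 normrN abszE.
have h1 : (2 * H)%:Z <= `|z * (2 * H)%:Z|.
  by rewrite normrM -[leLHS]mul1r ler_pM //; lia.
by move: h1 gH; move: (z * _) => y; lia.
Qed.

Lemma sum_expi_int_seq g k0 (n : nat) (q : R) :
  \sum_(k <- int_seq k0 n) expi (- (g%:~R * k%:~R / q)) =
  expi (- (g%:~R * k0%:~R / q)) * \sum_(i < n) expi ((- (g%:~R / q)) *+ i).
Proof.
rewrite big_map mulr_sumr -[n in iota 0 n]subn0 big_mkord.
apply: eq_bigr => i _; rewrite -expiD; congr expi.
by rewrite intrD -mulr_natr mulrDr mulrDl opprD mulNr; congr (_ + - _); rewrite mulrAC.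
Qed.

Lemma sum_expi_full (H : nat) g k0 : (0 < H)%N -> (0 < `|g| <= H)%N ->
  \sum_(k <- int_seq k0 (2 * H)) expi (- (g%:~R * k%:~R / (2 * H)%:R)) = 0 :> R[i].
Proof.
move=> H0 /andP[g0 gH]; have q0 : 0 < (2 * H)%:R :> R by rewrite ltr0n; lia.
rewrite sum_expi_int_seq; set t := - (g%:~R / _).
suff -> : \sum_(i < 2 * H) expi (t *+ i) = 0 by rewrite mulr0.
have : (1 - expi t) * \sum_(i < 2 * H) expi (t *+ i) = 0.
  under eq_bigr do rewrite expiMn.
  rewrite -opprB mulNr -subrX1 -expiMn -mulr_natr /t mulNr divfK ?gt_eqF //.
  by rewrite -mulrNz expi_int subrr oppr0.
move/eqP; rewrite mulf_eq0 => /orP[|/eqP //]; rewrite -normr_eq0 => /eqP n0.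
have h : 0 < (`|g|%N)%:R / (2 * H)%:R :> R by rewrite divr_gt0 // ltr0n.
have := norm_sub1_expi_ge (fun z => @dist_frac_ge H g z H0 gH).
by rewrite n0 -[0]/(0%:C) lecR leNgt mulr_gt0.
Qed.

Lemma norm_sum_expi_le (H : nat) g k0 n : (0 < H)%N -> (0 < `|g| <= H)%N ->
  `|\sum_(k <- int_seq k0 n) expi (- (g%:~R * k%:~R / (2 * H)%:R))| <=
    ((2 * H)%:R / `|g|%:R)%:C :> R[i].
Proof.
move=> H0 /andP[g0 gH]; rewrite sum_expi_int_seq normrM norm_expi mul1r.
have tau0 : 0 < (`|g|%N)%:R / (2 * H)%:R :> R by rewrite divr_gt0 ?ltr0n //; lia.
have := norm_geom_sum_le n tau0 (fun z => @dist_frac_ge H g z H0 gH).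
by rewrite invf_div.
Qed.

Lemma sum_dif0 (V : nmodType) H (x : V) :
  \sum_(hh : 'I_H * 'I_H | dif hh == 0) x = x *+ H.
Proof.
rewrite sumr_const; congr (_ *+ _).
rewrite -[RHS](card_ord H) -(card_imset _ (_ : injective (fun i : 'I_H => (i, i)))); last by move=> i j [].
apply: eq_card => -[h h']; apply/idP/imsetP => [hh0|[l _ [-> ->]]]; last first.
  by rewrite unfold_in /dif subrr.
have : (h : nat)%:Z - (h' : nat)%:Z == 0 by exact: hh0.
by rewrite subr_eq0 => /eqP [/val_inj ->]; exists h'.
Qed.

(** Over a full period of nodes only the diagonal pairs h = h' survive. Up to normalisation, the
    kernels centred at the nodes form a partition of unity. *)
Lemma sum_sqr_dirichlet_full H k0 x : (0 < H)%N ->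
  \sum_(k <- int_seq k0 (2 * H)) `|dirichlet H (x - k%:~R / (2 * H)%:R)| ^+ 2 =
    ((2 * H * H)%:R)%:C.
Proof.
move=> H0; under eq_bigr do rewrite sqr_norm_dirichlet.
rewrite exchange_big /=.
rewrite (eq_bigr (fun hh => if dif hh == 0 then (2 * H)%:R else 0)); last first.
  move=> hh _; have [hh0|hh0] := eqVneq (dif hh) 0.
    under eq_bigr do rewrite hh0 mul0r expi0.
    by rewrite big_const_seq count_predT size_int_seq iter_addr_0.
  transitivity (expi ((dif hh)%:~R * x) *
      \sum_(k <- int_seq k0 (2 * H)) expi (- ((dif hh)%:~R * k%:~R / (2 * H)%:R))).
    rewrite mulr_sumr; apply: eq_bigr => k _; rewrite -expiD; congr expi.
    by rewrite mulrBr mulrA.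
  by rewrite sum_expi_full ?mulr0 // absz_gt0 hh0 absz_dif_le.
by rewrite -big_mkcond sum_dif0 rmorph_nat -mulrnA.
Qed.

Lemma norm_dirichlet_far H t (delta : R) : 0 < delta <= 1 / 2 ->
  delta <= `|t| -> `|t| <= 1 / 2 -> `|dirichlet H t| ^+ 2 <= (delta ^- 2)%:C.
Proof.
move=> /andP[d0 d1] td t1.
have Ht z : delta <= `|t - z%:~R|.
  have [->|z0] := eqVneq z 0; first by rewrite subr0.
  have : 1 <= `|z%:~R| :> R by rewrite -intr_norm -[1]/(1%:~R) ler_int; lia.
  by move=> z1; have := ler_normB t (t - z%:~R); rewrite opprB addrC subrK; lra.
have := norm_geom_sum_le H d0 Ht; rewrite -/(dirichlet H t) => h.
rewrite -exprVn rmorphXn /= lerXn2r // nnegrE ?normr_ge0 //.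
by rewrite ler0c invr_ge0 ltW.
Qed.

Lemma int_outside_far (q delta a b x : R) (k0 k1 k : int) : 0 < q ->
  (k0 - 1)%:~R < (a - delta) * q -> (b + delta) * q < (k1 + 1)%:~R ->
  a <= x <= b -> ~~ (k0 <= k <= k1) -> delta <= `|x - k%:~R / q|.
Proof.
move=> q0 h0 h1 /andP[ax xb]; rewrite ler_normr negb_and -!ltNge => /orP[h|h].
  have : k%:~R <= (k0 - 1)%:~R :> R by rewrite ler_int; lia.
  move=> /le_lt_trans /(_ h0).
  by rewrite -ltr_pdivrMr // => h2; apply/orP; left; lra.
have : (k1 + 1)%:~R <= k%:~R :> R by rewrite ler_int; lia.
move=> /(lt_le_trans h1).
by rewrite -ltr_pdivlMr // => h2; apply/orP; right; lra.
Qed.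

Lemma int_window_near (H : nat) (x : R) (s k : int) : (0 < H)%N ->
  (s - 1)%:~R < x * (2 * H)%:R - H%:R <= s%:~R -> s <= k < s + (2 * H)%:Z ->
  `|x - k%:~R / (2 * H)%:R| <= 1 / 2.
Proof.
move=> H0; rewrite intrB => /andP[s1 s2] /andP[sk ks].
have h1 : s%:~R <= k%:~R :> R by rewrite ler_int.
have h2 : k%:~R <= s%:~R + (2 * H)%:R - 1 :> R.
  rewrite -[(2 * H)%:R]/((2 * H)%:Z%:~R) -[1]/(1%:~R) -intrD -intrB ler_int.
  by clear -ks; lia.
have q0 : 0 < (2 * H)%:R :> R by rewrite ltr0n muln_gt0.
have qE : (2 * H)%:R = 2 * H%:R :> R by rewrite natrM.
have h3 : (x - 1 / 2) * (2 * H)%:R <= k%:~R by lra.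
have h4 : k%:~R <= (x + 1 / 2) * (2 * H)%:R by lra.
rewrite -ler_pdivlMr // in h3; rewrite -ler_pdivrMr // in h4.
by rewrite ler_norml; apply/andP; split; lra.
Qed.

(* Discretised Fejer kernels centred at the points k / 2H, delta-close to [a, b]. *)
Lemma fejer_majorant H (delta a b : R) :
  0 < delta <= 1 / 2 -> 1 <= H%:R * delta ^+ 3 -> a <= b <= a + 1 ->
  exists w : 'I_H * 'I_H -> R[i],
  [/\ forall x, 0 <= trig_poly w x,
      forall x, a <= x <= b -> 1 <= trig_poly w x,
      exists2 mu : R, 0 <= mu <= b - a + 11 * delta &
        \sum_(hh | dif hh == 0) w hh = mu%:C
    & forall hh, `|w hh| <= (6 / H%:R / (maxn 1 `|dif hh|)%:R)%:C].
Proof.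
move=> /andP[d0 d1] Hd /andP[ab ba].
have H0 : (0 < H)%N by case: H Hd => //; rewrite mul0r; lra.
have HR0 : 0 < H%:R :> R by rewrite ltr0n.
set q := (2 * H)%:R : R; have q0 : 0 < q by rewrite ltr0n; lia.
have qE : q = 2 * H%:R by rewrite /q natrM.
have [k0 k0h] : exists k0 : int, (k0 - 1)%:~R < (a - delta) * q <= k0%:~R.
  by exists (Num.ceil ((a - delta) * q)); exact: ceil_itv.
have [k1 k1h] : exists k1 : int, k1%:~R <= (b + delta) * q < (k1 + 1)%:~R.
  by exists (Num.floor ((b + delta) * q)); exact: floor_itv.
set len := absz (k1 - k0 + 1).
have k01 : k0 <= k1 + 1.
  rewrite -ltzD1 -(@ltr_int R) intrD.
  have h : (a - delta) * q < (b + delta) * q by rewrite ltr_pM2r //; lra.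
  move: k0h k1h; rewrite intrB intrD => /andP[? ?] /andP[? ?]; lra.
have lenE : (len%:Z = k1 - k0 + 1)%R by rewrite gez0_abs // addrAC subr_ge0.
have lenq : len%:R <= (b - a + 2 * delta) * q + 1.
  rewrite -[len%:R]/(len%:Z%:~R) lenE intrD intrB.
  move: k0h k1h; rewrite intrB intrD => /andP[? ?] /andP[? ?]; lra.
(* The kernels of a full period have total mass q H. At a point of [a, b] those centred outside
   [a - delta, b + delta] carry at most q delta^-2 <= delta q H, because H delta^3 >= 1. The factor
   1 - delta makes up for this loss. *)
pose c := (q * H%:R * (1 - delta))^-1.
have c0 : 0 < c by rewrite invr_gt0 !mulr_gt0 //; lra.
pose w (hh : 'I_H * 'I_H) := c%:C * \sum_(k <- int_seq k0 len) expi (- ((dif hh)%:~R * k%:~R / q)).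
have wE x : trig_poly w x =
    c%:C * \sum_(k <- int_seq k0 len) `|dirichlet H (x - k%:~R / q)| ^+ 2.
  under eq_bigr do rewrite sqr_norm_dirichlet.
  rewrite exchange_big mulr_sumr; apply: eq_bigr => hh _.
  rewrite /w -mulrA mulr_suml; congr (_ * _); apply: eq_bigr => k _.
  by rewrite -expiD; congr expi; rewrite mulrBr mulrA addrC.
have D0 t : 0 <= `|dirichlet H t| ^+ 2 by rewrite exprn_ge0.
have cC0 : (0 : R[i]) < c%:C by rewrite ltcR.
have qH : 1 <= q * delta.
  have : delta ^+ 3 <= delta by rewrite -[leRHS]expr1 ler_wiXn2l //; lra.
  move=> h; apply: (le_trans Hd); rewrite qE -mulrA -[leLHS]mul1r.
  by rewrite ler_pM ?mulr_ge0 ?exprn_ge0 ?ler_wpM2l //; lra.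
exists w; split.
- by move=> x; rewrite wE; apply: mulr_ge0; [exact: ltW | exact: sumr_ge0].
- move=> x /andP[ax xb]; rewrite wE.
  (* The full period of nodes within distance 1/2 of x, where the distance modulo 1 is the plain
     absolute value. *)
  have [s0 s0h] : exists s0 : int, (s0 - 1)%:~R < x * q - H%:R <= s0%:~R.
    by exists (Num.ceil (x * q - H%:R)); exact: ceil_itv.
  have sumE := sum_sqr_dirichlet_full s0 x H0.
  rewrite (bigID (mem (int_seq k0 len))) /= in sumE.
  rewrite (big_mem_swap _ (int_seq_uniq _ _) (int_seq_uniq _ _)) in sumE.
  have le1 : \sum_(z <- int_seq k0 len | z \in int_seq s0 (2 * H))
      `|dirichlet H (x - z%:~R / (2 * H)%:R)| ^+ 2 <=
      \sum_(k <- int_seq k0 len) `|dirichlet H (x - k%:~R / q)| ^+ 2.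
    by rewrite [leRHS](bigID (mem (int_seq s0 (2 * H)))) /= lerDl; apply: sumr_ge0.
  have le2 : \sum_(i <- int_seq s0 (2 * H) | i \notin int_seq k0 len)
      `|dirichlet H (x - i%:~R / (2 * H)%:R)| ^+ 2 <= (q * delta ^- 2)%:C.
    have -> : (q * delta ^- 2)%:C =
        \sum_(i <- int_seq s0 (2 * H)) (delta ^- 2)%:C :> R[i].
      by rewrite big_const_seq count_predT size_int_seq iter_addr_0 -mulr_natl rmorphM rmorph_nat.
    rewrite [leRHS](bigID (fun i => i \notin int_seq k0 len)) /= -[leLHS]addr0 lerD //; last first.
      by rewrite sumr_ge0 // => i _; rewrite ler0c invr_ge0 exprn_ge0 // ltW.
    rewrite big_seq_cond [leRHS]big_seq_cond; apply: ler_sum => i /andP[].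
    rewrite !mem_int_seq lenE => i1 i3; apply: norm_dirichlet_far; first by rewrite d0.
      move: i3; rewrite (_ : k0 + _ = k1 + 1); last by ring.
      case/andP: k0h => k0h _; case/andP: k1h => _ k1h; rewrite ltzD1.
      by apply: int_outside_far q0 k0h k1h _; apply/andP.
    exact: int_window_near H0 s0h i1.
  have le3 : ((2 * H * H)%:R - q * delta ^- 2)%:C <=
      \sum_(k <- int_seq k0 len) `|dirichlet H (x - k%:~R / q)| ^+ 2.
    by apply: le_trans le1; rewrite rmorphB /= -sumE lerBlDr lerD2l.
  have le4 : c * ((2 * H * H)%:R - q * delta ^- 2) = (H%:R - delta ^- 2) / (H%:R * (1 - delta)).
    rewrite natrM -/q /c; move: (delta ^- 2) => y; field.
    by rewrite !gt_eqF //; lra.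
  have le5 : 1 <= c * ((2 * H * H)%:R - q * delta ^- 2).
    rewrite le4 ler_pdivlMr ?mul1r; last by rewrite mulr_gt0 //; lra.
    have : delta ^- 2 <= H%:R * delta.
      by rewrite -[leLHS]mul1r ler_pdivrMr ?exprn_gt0 // -mulrA -exprS.
    by move: (delta ^- 2) => y; lra.
  apply: (@le_trans _ _ (c%:C * ((2 * H * H)%:R - q * delta ^- 2)%:C)).
    by rewrite -rmorphM /= -[1]/(1%:C) lecR.
  by rewrite ler_pM2l.
(* The value is len / (q (1 - delta)), with len <= (b - a + 3 delta) q: 2 delta of padding, and a
   rounding error 1 <= q delta. Dividing by 1 - delta >= 1/2 raises 3 delta to at most 11 delta, as
   b - a <= 1. *)
- exists (H%:R * (c * len%:R)).
    rewrite !mulr_ge0 ?(ltW c0) //=.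
    have -> : H%:R * (c * len%:R) = len%:R / (q * (1 - delta)).
      by rewrite /c; field; rewrite !gt_eqF //; lra.
    rewrite ler_pdivrMr; last by rewrite mulr_gt0 //; lra.
    apply: (le_trans lenq).
    apply: (@le_trans _ _ ((b - a + 3 * delta) * q)); first by lra.
    rewrite [leRHS]mulrCA [leLHS]mulrC ler_pM2l //.
    suff : delta * (b - a + 11 * delta) <= delta * 8 by lra.
    by rewrite ler_pM2l //; lra.
  rewrite (eq_bigr (fun=> (c * len%:R)%:C)) => [|hh /eqP hh0]; last first.
    rewrite /w hh0; under eq_bigr do rewrite !mul0r oppr0 expi0.
    by rewrite big_const_seq count_predT size_int_seq iter_addr_0 rmorphM rmorph_nat.
  by rewrite sum_dif0 -rmorphMn /= mulr_natl.
move=> hh; rewrite /w normrM [X in X * _]gtr0_norm //.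
have [hh0|hh0] := eqVneq (dif hh) 0.
  rewrite hh0; under eq_bigr do rewrite !mul0r oppr0 expi0.
  rewrite big_const_seq count_predT size_int_seq iter_addr_0 normr_nat.
  rewrite (_ : maxn 1 _ = 1%N) // -(rmorph_nat (real_complex R)) -rmorphM lecR divr1.
  rewrite /c mulrC ler_pdivrMr; last by rewrite !mulr_gt0 //; lra.
  rewrite (_ : 6 / H%:R * _ = 6 * q * (1 - delta)); last by field; rewrite gt_eqF.
  apply: (le_trans lenq).
  have : q * delta <= q * (1 / 2) by rewrite ler_pM2l.
  have : q * (b - a) <= q * 1 by rewrite ler_pM2l //; lra.
  by lra.
have g0 : (0 < `|dif hh| <= H)%N.
  by rewrite absz_gt0 hh0 absz_dif_le.
rewrite (maxn_idPr _); last by case/andP: g0.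
apply: (le_trans (ler_wpM2l (ltW cC0) (norm_sum_expi_le _ _ H0 g0))).
have gR : 0 < (`|dif hh|%N)%:R :> R by rewrite ltr0n; case/andP: g0.
rewrite -rmorphM lecR mulrA ler_pM2r ?invr_gt0 //.
rewrite /c -/q mulrC ler_pdivrMr; last by rewrite !mulr_gt0 //; lra.
rewrite (_ : 6 / H%:R * _ = 6 * q * (1 - delta)); last by field; rewrite gt_eqF.
have : q * delta <= q * (1 / 2) by rewrite ler_pM2l.
by lra.
Qed.

End FejerMajorant.

(** * Averages of box indicators along an orbit on the torus *)

Section DistZ.
Context {R : realType}.
Implicit Types x : R.

Definition frac_part x : R := x - (Num.floor x)%:~R.

Lemma frac_part_itv x : 0 <= frac_part x < 1.
Proof.
have := floor_itv x; rewrite /frac_part intrD => /andP[h1 h2].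
by rewrite subr_ge0 h1 ltrBlDr addrC.
Qed.

Definition distZ x : R := `|x - (Num.floor (x + 1 / 2))%:~R|.

Lemma distZ_le x (z : int) : distZ x <= `|x - z%:~R|.
Proof.
rewrite /distZ; have := floor_itv (x + 1 / 2); move: (Num.floor _) => k.
rewrite intrD => /andP[h1 h2]; have [->//|zk] := eqVneq z k.
have h3 : 1 <= `|(z - k)%:~R| :> R.
  by rewrite -intr_norm -[1]/(1%:~R) ler_int; move: zk; rewrite -subr_eq0; move: (z - k) => y; lia.
rewrite intrB in h3; have h4 : `|x - k%:~R| <= 1 / 2 by rewrite ler_norml; lra.
have := ler_normB (x - k%:~R) (x - z%:~R).
have -> : x - k%:~R - (x - z%:~R) = z%:~R - k%:~R by ring.
by lra.
Qed.

End DistZ.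

(** * Harmonic sums and the weights of frequencies *)

Section Harmonic.
Context {R : realType}.

(** Each dyadic block contributes at most 1; with powers of 2 as end points, a stands for the
    logarithm. *)
Lemma sum_inv_dyadic_le a : \sum_(1 <= g < 2 ^ a) g%:R^-1 <= a%:R :> R.
Proof.
elim: a => [|a IH]; first by rewrite big_geq.
have p0 : (0 < 2 ^ a)%N by rewrite expn_gt0.
rewrite (big_cat_nat _ (n := 2 ^ a)) //=; last by rewrite leq_exp2l.
rewrite -natr1 lerD //.
apply: (@le_trans _ _ (\sum_(2 ^ a <= g < 2 ^ a.+1) (2 ^ a)%:R^-1)).
  rewrite big_nat [leRHS]big_nat; apply: ler_sum => g /andP[h _].
  by rewrite lef_pV2 ?posrE ?ltr0n ?ler_nat //; exact: leq_trans h.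
by rewrite sumr_const_nat expnS mul2n -addnn addnK -[leLHS]mulr_natl divff // pnatr_eq0 -lt0n.
Qed.

(** The coefficient bound of [fejer_majorant] without its factor 6. Its sum over all pairs is
    logarithmic in H. *)
Definition dif_weight H (hh : 'I_H * 'I_H) : R :=
  H%:R^-1 / (maxn 1 `|dif hh|)%:R.

Lemma dif_weight_ge0 H hh : 0 <= @dif_weight H hh.
Proof. by rewrite /dif_weight mulr_ge0 ?invr_ge0. Qed.

Lemma sum_inv_dist_le H (h : 'I_H) :
  \sum_(h' < H) (maxn 1 `|dif (h, h')|)%:R^-1 <=
    1 + 2 * \sum_(1 <= g < H) g%:R^-1 :> R.
Proof.
have H0 : (0 < H)%N by apply: leq_ltn_trans (ltn_ord h).
rewrite -(big_mkord predT (fun l => (maxn 1 `|(h : nat)%:Z - l%:Z|)%:R^-1)).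
have mono (n : nat) : (n <= H)%N -> \sum_(1 <= g < n) g%:R^-1 <= \sum_(1 <= g < H) g%:R^-1 :> R.
  case: n => [|n] nH; first by rewrite big_geq // sumr_ge0 // => i _; rewrite invr_ge0.
  by rewrite [leRHS](big_cat_nat _ (n := n.+1)) //= lerDl sumr_ge0 // => i _; rewrite invr_ge0.
rewrite (big_cat_nat _ (n := h)) //=; last exact: ltnW.
have h1 : \sum_(0 <= l < h) (maxn 1 `|(h : nat)%:Z - l%:Z|)%:R^-1 <=
    \sum_(1 <= g < H) g%:R^-1 :> R.
  apply: (le_trans _ (mono h.+1 (ltn_ord h))).
  rewrite big_nat_rev /= add0n big_add1 /=.
  rewrite big_nat [leRHS]big_nat le_eqVlt; apply/orP; left; apply/eqP.
  apply: eq_bigr => l lh; congr (_%:R^-1); move: lh; move: (h : nat) => h'; lia.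
have h2 : \sum_(h <= l < H) (maxn 1 `|(h : nat)%:Z - l%:Z|)%:R^-1 <=
    1 + \sum_(1 <= g < H) g%:R^-1 :> R.
  rewrite big_ltn ?ltn_ord // subrr lerD ?invr1 //.
  apply: (le_trans _ (mono (H - h)%N (leq_subr _ _))).
  rewrite -{1}[h.+1]add1n big_addn big_nat [leRHS]big_nat le_eqVlt; apply/orP; left; apply/eqP.
  apply: eq_bigr => l lh; congr (_%:R^-1); move: lh; move: (h : nat) => h'; lia.
by apply: (le_trans (lerD h1 h2)); rewrite mulr_natl mulr2n addrCA.
Qed.

Lemma sum_dif_weight_le a :
  \sum_hh @dif_weight (2 ^ a) hh <= 1 + 2 * a%:R.
Proof.
have p0 : 0 < (2 ^ a)%:R :> R by rewrite ltr0n expn_gt0.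
rewrite -mulr_sumr ler_pdivrMl //.
rewrite -(pair_bigA _ (fun h h' : 'I_(2 ^ a) => (maxn 1 `|dif (h, h')|)%:R^-1)) /=.
apply: (@le_trans _ _ (\sum_(h < 2 ^ a) (1 + 2 * a%:R))); last first.
  by rewrite sumr_const card_ord [leRHS]mulr_natl.
apply: ler_sum => h _; apply: (le_trans (sum_inv_dist_le h)).
by rewrite lerD2l ler_wpM2l // sum_inv_dyadic_le.
Qed.

End Harmonic.

(** * Characters along the orbit and their resonances *)

Section Orbit.
Context {R : realType} {d m : nat}.
Local Notation T := 'cV[int]_d.
Implicit Types (L : 'M[R]_(m, d)) (u : 'cV[R]_m) (n v : T).

Definition int_vec n : 'cV[R]_d := map_mx intr n.

Lemma int_vecD n v : int_vec (n + v) = int_vec n + int_vec v.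
Proof. by rewrite /int_vec map_mxD. Qed.

Lemma int_vecMn n k : int_vec (n *+ k) = int_vec n *+ k.
Proof. by elim: k => [|k IH]; rewrite ?mulr0n ?mulrS ?int_vecD ?IH // /int_vec map_mx0. Qed.

Definition unit_vec (i : 'I_d) : T := delta_mx i 0.

Definition orbit L u n (i : 'I_m) : R := frac_part (u i 0 - (L *m int_vec n) i 0).

Lemma orbit_itv L u n i : 0 <= orbit L u n i < 1.
Proof. exact: frac_part_itv. Qed.

Local Notation freqs H := {ffun 'I_m -> 'I_H * 'I_H}.

Definition weight H (phi : freqs H) : R := \prod_i dif_weight (phi i).

Lemma weight_ge0 H (phi : freqs H) : 0 <= weight phi.
Proof. by apply: prodr_ge0 => i _; apply: dif_weight_ge0. Qed.

Lemma sum_weight_le a : \sum_(phi : freqs (2 ^ a)) weight phi <= (1 + 2 * a%:R) ^+ m.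
Proof.
rewrite -(bigA_distr_bigA (fun (_ : 'I_m) hh => @dif_weight R (2 ^ a) hh)) /=.
rewrite prodr_const card_ord; apply: lerXn2r; rewrite ?nnegrE ?sum_dif_weight_le //.
by apply: sumr_ge0 => hh _; apply: dif_weight_ge0.

Qed.

Definition nonzero H (phi : freqs H) : bool := [exists i, dif (phi i) != 0].

(** The j-th coordinate of the transpose of L applied to the frequency vector. One step in direction
    j multiplies the character by e of its opposite. *)
Definition dual_freq L H (phi : freqs H) (j : 'I_d) : R :=
  \sum_i (dif (phi i))%:~R * L i j.

Definition resonant tau L H (phi : freqs H) : bool :=
  [forall j, distZ (dual_freq L phi j) < tau].

(** The weight carried by the nonzero frequencies whose damping is guaranteed in no direction. *)
Definition resonance tau L H : R :=
  \sum_(phi : freqs H | nonzero phi && resonant tau L phi) weight phi.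

Definition character L u H (phi : freqs H) n : R[i] :=
  expi (\sum_i (dif (phi i))%:~R * (u i 0 - (L *m int_vec n) i 0)).

Lemma character_shift L u H (phi : freqs H) n j k :
  character L u phi (n + unit_vec j *+ k) =
    expi ((- dual_freq L phi j) *+ k) * character L u phi n.
Proof.
rewrite /character -expiD; congr expi.
rewrite /dual_freq -sumrN -sumrMnl -big_split; apply: eq_bigr => i _ /=.
have -> : (L *m int_vec (n + unit_vec j *+ k)) i 0 =
    (L *m int_vec n) i 0 + k%:R * L i j.
  rewrite int_vecD int_vecMn -[_ *+ k]scaler_nat mulmxDr -scalemxAr mxE; congr (_ + _).
  rewrite mxE; congr (_ * _).
  rewrite mxE (bigD1 j) //= big1 ?addr0 => [|l lj]; rewrite !mxE ?eqxx ?mulr1 //.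
  by rewrite (negPf lj) mulr0.
by rewrite -[_ *+ k]mulr_natl; ring.
Qed.

Definition avg_factor L H (phi : freqs H) M j : R[i] :=
  M%:R^-1 * \sum_(k < M) expi ((- dual_freq L phi j) *+ k).

(** Characters are common eigenfunctions of all the averages. *)
Lemma avg_character L u H (phi : freqs H) M j :
  avg M (unit_vec j) (character L u phi) =
    fun n => avg_factor L phi M j * character L u phi n.
Proof.
apply/funext => n; rewrite /avg /avg_factor -mulrA mulr_suml; congr (_ * _).
by apply: eq_bigr => k _; rewrite character_shift.
Qed.

Lemma norm_avg_factor_le1 L H (phi : freqs H) M j : (0 < M)%N ->
  `|avg_factor L phi M j| <= 1.
Proof.
move=> M0; rewrite /avg_factor normrM normfV normr_nat mulrC ler_pdivrMr ?ltr0n // mul1r.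
rewrite (le_trans (ler_norm_sum _ _ _)) //; under eq_bigr do rewrite norm_expi.
by rewrite sumr_const card_ord.
Qed.

Lemma norm_avg_factor_le L H (phi : freqs H) M j (tau : R) : (0 < M)%N -> 0 < tau ->
  tau <= distZ (dual_freq L phi j) -> `|avg_factor L phi M j| <= ((M%:R * tau)^-1)%:C.
Proof.
move=> M0 tau0 Ht; rewrite /avg_factor normrM normfV normr_nat.
have H1 (z : int) : tau <= `|- dual_freq L phi j - z%:~R|.
  apply: (le_trans Ht); apply: (le_trans (distZ_le _ (- z))).
  by rewrite mulrNz opprK -[leRHS]normrN opprB addrC opprK.
have := norm_geom_sum_le M tau0 H1 => h.
rewrite invfM rmorphM /= -(rmorph_nat (real_complex R)) fmorphV.
by rewrite ler_wpM2l // invr_ge0 ler0c.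
Qed.

Definition avg_list M p : seq (nat * T) :=
  [seq (M, v) | v <- avg_dirs unit_vec p].

Lemma avgs_character L u H (phi : freqs H) M p n :
  avgs (avg_list M p) (character L u phi) n =
    (\prod_j avg_factor L phi M j) ^+ p * character L u phi n.
Proof.
suff E : avgs (avg_list M p) (character L u phi) =
    fun n => (\prod_j avg_factor L phi M j) ^+ p * character L u phi n by rewrite E.
have step (s : seq 'I_d) c : avgs [seq (M, v) | v <- [seq unit_vec i | i <- s]]
    (fun n => c * character L u phi n) =
    fun n => (\prod_(j <- s) avg_factor L phi M j) * c * character L u phi n.
  elim: s => [|j s IHs] /=.
    by rewrite big_nil; apply/funext => n'; rewrite mul1r.
  rewrite IHs big_cons; apply/funext => n'.
  have := congr1 (fun f => f n') (avg_character L u phi M j); rewrite /avg => E.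
  by rewrite -mulr_sumr mulrCA E; ring.
rewrite /avg_list /avg_dirs; elim: p => [|p IH] /=.
  by apply/funext => n'; rewrite mul1r.
by rewrite map_cat avgs_cat IH step exprS big_enum.
Qed.

(** Integer frequencies do not see the reduction modulo 1 in [orbit], so the expanded product
    consists of characters of n. *)
Lemma prod_trig_poly L u n H (w : 'I_m -> 'I_H * 'I_H -> R[i]) :
  \prod_i trig_poly (w i) (orbit L u n i) =
  \sum_(phi : freqs H) (\prod_i w i (phi i)) * character L u phi n.
Proof.
rewrite /trig_poly bigA_distr_bigA /=; apply: eq_bigr => phi _.
rewrite big_split /= /character expi_sum; congr (_ * _); apply: eq_bigr => i _.
by rewrite /orbit /frac_part mulrBr -intrM -mulrNz expiD expi_int mulr1.
Qed.

End Orbit.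

(** * Box discrepancy for nonresonant maps *)

Section BoxDiscrepancy.
Context {R : realType}.

(** One factor at a time: (c + eps)(Q + 8^m eps) exceeds c Q by at most (1 + 7) 8^m eps, since Q <=
    1 and c + eps <= 7. The bound 6 leaves room for eps = 11 delta with delta <= 1/2. *)
Lemma prod_le_add m (c mu : 'I_m -> R) (eps : R) : 0 <= eps <= 6 ->
  (forall i, 0 <= c i <= 1) -> (forall i, 0 <= mu i <= c i + eps) ->
  \prod_i mu i <= \prod_i c i + 8 ^+ m * eps.
Proof.
move=> /andP[e0 e6]; elim: m c mu => [|m IH] c mu hc hmu.
  by rewrite !big_ord0 expr0 mul1r lerDl.
rewrite !big_ord_recl.
have := IH (fun i => c (lift ord0 i)) (fun i => mu (lift ord0 i))
  (fun i => hc _) (fun i => hmu _).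
have /andP[c0 c1] := hc ord0; have /andP[m0 m1] := hmu ord0.
have P0 : 0 <= \prod_i mu (lift ord0 i) by apply: prodr_ge0 => i _; case/andP: (hmu (lift ord0 i)).
have Q0 : 0 <= \prod_i c (lift ord0 i) <= 1.
  rewrite prodr_ge0 /=; last by move=> i _; case/andP: (hc (lift ord0 i)).
  by apply: prodr_ile1 => i _; apply: hc.
have E1 : (1 : R) <= 8 ^+ m by rewrite exprn_ege1 // ler1n.
move: (mu ord0) (c ord0) (\prod_i mu _) (\prod_i c _) P0 Q0 m0 m1 c0 c1 =>
  x y P Q P0 /andP[Q0 Q1] m0 m1 c0 c1 h.
rewrite exprS; move: (8 ^+ m) E1 h => E E1 h.
apply: (@le_trans _ _ ((y + eps) * (Q + E * eps))); first by rewrite ler_pM.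
have h1 : eps * Q <= eps * E by rewrite ler_wpM2l //; lra.
have h2 : (y + eps) * (E * eps) <= 7 * (E * eps).
  by rewrite ler_wpM2r ?mulr_ge0 //; lra.
lra.
Qed.

Lemma prod_split3 (I : finType) (t : I) (f g h k : I -> R) :
  (forall i, i != t -> [/\ f i = g i, h i = g i & k i = g i]) ->
  f t = g t + h t + k t ->
  \prod_i f i = \prod_i g i + \prod_i h i + \prod_i k i.
Proof.
move=> H E; rewrite [LHS](bigD1 t) // [\prod_i g i](bigD1 t) //.
rewrite [\prod_i h i](bigD1 t) // [\prod_i k i](bigD1 t) //= E 2!mulrDl.
have eqH := eq_bigr _ (fun i (it : i != t) => let: And3 _ e _ := H i it in e).
have eqK := eq_bigr _ (fun i (it : i != t) => let: And3 _ _ e := H i it in e).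
have eqF := eq_bigr _ (fun i (it : i != t) => let: And3 e _ _ := H i it in e).
by rewrite eqH eqK eqF.
Qed.

Context {d m : nat}.
Local Notation T := 'cV[int]_d.
Implicit Types (L : 'M[R]_(m, d)) (u : 'cV[R]_m) (a b x : 'I_m -> R).

Definition box_ind a b x : R := \prod_i (a i <= x i < b i)%R%:R.

Definition box_vol a b : R := \prod_i (b i - a i).

Lemma box_indP a b x : box_ind a b x = [forall i, (a i <= x i < b i)%R]%:R.
Proof.
rewrite /box_ind; case: (boolP [forall i, _]) => [/forallP H|].
  by rewrite big1 // => i _; rewrite H.
by rewrite negb_forall => /existsP[i /negPf hi]; rewrite (bigD1 i) //= hi mul0r.
Qed.

Lemma complex_le_norm (c : R) (z : R[i]) (r : R) : c%:C <= z -> `|z| <= r%:C -> c <= r.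
Proof.
rewrite lecE /= => /andP[_ cz] zr; apply: (le_trans cz); apply: (le_trans (ler_norm _)).
by rewrite -lecR; apply: (le_trans (normc_ge_Re _)).
Qed.

(** A single nonresonant direction is enough: the factors of the other directions have modulus at
    most 1. *)
Lemma norm_prod_avg_factor_le L H M (phi : {ffun 'I_m -> 'I_H * 'I_H}) (tau : R) :
  (0 < M)%N -> 0 < tau -> ~~ resonant tau L phi ->
  `|\prod_j avg_factor L phi M j| <= ((M%:R * tau)^-1)%:C.
Proof.
move=> M0 tau0; rewrite /resonant negb_forall => /existsP[j]; rewrite -leNgt => hj.
rewrite (bigD1 j) //= normrM -[leRHS]mulr1; apply: ler_pM => //.
  exact: norm_avg_factor_le.
by rewrite normr_prod; apply: prodr_ile1 => i _; rewrite normr_ge0 norm_avg_factor_le1.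
Qed.

(** The product of the majorants of the m sides is a sum of characters. Its zero frequency gives the
    volume up to 8^m 11 delta; resonant frequencies are bounded trivially, and the others by (M
    tau)^-p. The factor 6^m comes from the coefficient bound of each side. *)
Lemma avgs_box_ind_le L u H M p (delta tau : R) a b n :
  0 < delta <= 1 / 2 -> 1 <= H%:R * delta ^+ 3 -> (0 < M)%N -> 0 < tau ->
  (forall i, a i <= b i <= a i + 1) ->
  avgs (avg_list M p) (fun n => box_ind a b (orbit L u n)) n <=
    box_vol a b + 8 ^+ m * (11 * delta) +
    6 ^+ m * (resonance tau L H +
      (M%:R * tau)^-1 ^+ p * \sum_(phi : {ffun 'I_m -> 'I_H * 'I_H}) weight phi).
Proof.
move=> hd hH M0 tau0 hab.
have /choice[w hw] := fun i => fejer_majorant hd hH (hab i).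
have /choice[mu hmu] : forall i, exists mu : R, 0 <= mu <= b i - a i + 11 * delta /\
    \sum_(hh | dif hh == 0) w i hh = mu%:C.
  by move=> i; have [_ _ [mu h1 h2] _] := hw i; exists mu.
set Fav := avgs _ _ _; pose W (phi : {ffun 'I_m -> 'I_H * 'I_H}) := \prod_i w i (phi i).
have major n' : (box_ind a b (orbit L u n'))%:C <= \sum_phi W phi * character L u phi n'.
  rewrite -prod_trig_poly box_indP; case: (boolP [forall i, _]) => [/forallP hb|_].
    rewrite /=; elim/big_ind: _ => [//|x y|i _]; first exact: mulr_ege1.
    have [_ h _ _] := hw i; apply: h; case/andP: (hb i) => -> /ltW ->; exact: isT.
  by apply: prodr_ge0 => i _; have [h _ _ _] := hw i; apply: h.
have avle : Fav%:C <= \sum_phi W phi *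
    ((\prod_j avg_factor L phi M j) ^+ p * character L u phi n).
  rewrite /Fav (avgs_morph (real_complex R)).
  apply: le_trans (@avgs_le _ _ (avg_list M p) (fun n' => (box_ind a b (orbit L u n'))%:C) _ major n) _.
  rewrite avgs_sum le_eqVlt; apply/orP; left; apply/eqP; apply: eq_bigr => phi _.
  by rewrite avgsZ avgs_character.
rewrite (bigID (fun phi => ~~ nonzero phi)) /= in avle.
(* Many [phi] represent the zero frequency, one for each choice of diagonal pairs; the sum of their
   coefficients factors over the coordinates. *)
have mainE : \sum_(phi | ~~ nonzero phi) W phi *
    ((\prod_j avg_factor L phi M j) ^+ p * character L u phi n) = (\prod_i mu i)%:C.
  rewrite rmorph_prod /= (eq_bigr (fun i => \sum_(hh | dif hh == 0) w i hh)); last first.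
    by move=> i _; have [_ ->] := hmu i.
  rewrite (bigA_distr_big_dep (fun _ hh => dif hh == 0)) /=.
  rewrite [RHS](eq_bigl (fun phi => ~~ nonzero phi)); last first.
    move=> phi; rewrite /nonzero negb_exists; apply/familyP/forallP => h i.
      by have := h i; rewrite unfold_in negbK.
    by have := h i; rewrite negbK.
  apply: eq_bigr => phi; rewrite /nonzero negb_exists => /forallP h.
  have h' i : dif (phi i) = 0 by apply/eqP; have := h i; rewrite negbK.
  have -> : character L u phi n = 1.
    by rewrite /character big1 ?expi0 // => i _; rewrite h' mul0r.
  rewrite big1 ?expr1n ?mulr1 // => j _; rewrite /avg_factor.
  have -> : dual_freq L phi j = 0 by rewrite /dual_freq big1 // => i _; rewrite h' mul0r.
  under eq_bigr do rewrite oppr0 mul0rn expi0.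
  by rewrite sumr_const card_ord mulVf // pnatr_eq0 -lt0n.
rewrite {}mainE in avle.
set S := \sum_(i | ~~ ~~ nonzero i) _ in avle.
set err := 6 ^+ m * _.
have Sle : `|S| <= err%:C.
  apply: (@le_trans _ _ (\sum_(phi : {ffun 'I_m -> 'I_H * 'I_H} | nonzero phi)
     (6 ^+ m * (weight phi * (if resonant tau L phi then 1 else (M%:R * tau)^-1 ^+ p)))%:C)).
    rewrite /S (eq_bigl (@nonzero m H)) => [|phi]; last by rewrite negbK.
    apply: (le_trans (ler_norm_sum _ _ _)); apply: ler_sum => phi _.
    rewrite [X in _ <= X%:C]mulrA rmorphM normrM; apply: ler_pM => //.
      rewrite /W normr_prod; apply: (@le_trans _ _ (\prod_i (6 * dif_weight (phi i))%:C)).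
        apply: ler_prod => i _; rewrite normr_ge0 /=; have [_ _ _ h] := hw i.
        by apply: (le_trans (h _)); rewrite lecR /dif_weight mulrA.
      by rewrite -rmorph_prod lecR big_split /= prodr_const card_ord.
    rewrite normrM /character norm_expi mulr1 normrX.
    case: ifPn => [_|hr].
      apply: exprn_ile1; first exact: normr_ge0.
      by rewrite normr_prod; apply: prodr_ile1 => i _; rewrite normr_ge0 norm_avg_factor_le1.
    rewrite (rmorphXn (real_complex R)) /=; apply: lerXn2r; rewrite ?nnegrE ?normr_ge0 //.
      by rewrite ler0c invr_ge0 mulr_ge0 // ltW.
    exact: norm_prod_avg_factor_le.
  rewrite -rmorph_sum lecR -mulr_sumr; apply: ler_wpM2l; first by rewrite exprn_ge0.
  rewrite (bigID (@resonant R d m tau L H)) /=; apply: lerD.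
    by rewrite /resonance; apply: ler_sum => phi /andP[_ ->]; rewrite mulr1.
  rewrite mulr_sumr big_mkcond; apply: ler_sum => phi _.
  have q0 : 0 <= (M%:R * tau)^-1 ^+ p by rewrite exprn_ge0 // invr_ge0 mulr_ge0 // ltW.
  case: ifP => [/andP[_ /negPf ->]|_]; first by rewrite mulrC.
  by rewrite mulr_ge0 // weight_ge0.
have h1 : Fav <= \prod_i mu i + err.
  rewrite -lerBlDl; apply: complex_le_norm Sle.
  by rewrite rmorphB lerBlDl.
apply: (le_trans h1); rewrite lerD2r /box_vol.
apply: prod_le_add => [|i|i].
- by have /andP[? ?] := hd; lra.
- by have /andP[? ?] := hab i; lra.
- by have [] := hmu i.
Qed.

(* Scale j: averages over steps of length 2^8j, trigonometric polynomials of
   degree 2^27j, resonance threshold 2^-7j and precision 2^-9j. *)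
Definition nonresonant L : Prop := exists j0 : nat, forall j, (j0 <= j)%N ->
  resonance (2^-1 ^+ (7 * j)) L (2 ^ (27 * j)) <= 2^-1 ^+ (9 * j).

(** Measuring j in units of q gives 1 + c j = O(2^(j / q)), whose q-th power is O(2^j). This absorbs
    the powers of j left by logarithms of the degree. *)
Lemma poly_le_exp2 (q c : nat) :
  exists2 K : R, 0 <= K & forall j : nat, (1 + c%:R * j%:R) ^+ q <= K * 2 ^+ j.
Proof.
case: q => [|q]; first by exists 1 => // j; rewrite expr0 mul1r exprn_ege1 ?ler1n.
exists (((1 + c%:R) * q.+1%:R) ^+ q.+1) => [|j].
  by rewrite exprn_ge0 // mulr_ge0 // addr_ge0.
have h1 : 1 + c%:R * j%:R <= (1 + c%:R) * q.+1%:R * (1 + (j %/ q.+1)%:R) :> R.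
  have : (1 + c * j <= (1 + c) * q.+1 * (1 + j %/ q.+1))%N.
    have := ltn_ceil j (ltn0Sn q); nia.
  by rewrite -(ler_nat R) natrD !natrM !natrD.
have h2 : 1 + (j %/ q.+1)%:R <= 2 ^+ (j %/ q.+1) :> R.
  by rewrite addrC natr1 -natrX ler_nat ltn_expl.
apply: (@le_trans _ _ (((1 + c%:R) * q.+1%:R * 2 ^+ (j %/ q.+1)) ^+ q.+1)).
  rewrite lerXn2r ?nnegrE ?addr_ge0 ?mulr_ge0 ?exprn_ge0 ?addr_ge0 //.
  by apply: (le_trans h1); rewrite ler_wpM2l // mulr_ge0 // addr_ge0.
rewrite exprMn -exprM ler_wpM2l ?exprn_ge0 ?mulr_ge0 ?addr_ge0 //.
by rewrite ler_weXn2l ?ler1n // leq_trunc_div.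
Qed.

Lemma half_expK (a b : nat) : (b <= a)%N -> 2^-1 ^+ a * 2 ^+ b = 2^-1 ^+ (a - b) :> R.
Proof.
by move=> ba; rewrite -{1}(subnK ba) exprD -mulrA -exprMn mulVf ?expr1n ?mulr1.
Qed.

Lemma avgs_box_upper L : nonresonant L -> exists K : R, exists j1 : nat, 0 <= K /\
  forall j, (j1 <= j)%N -> forall u a b n, (forall i, a i <= b i <= a i + 1) ->
  avgs (avg_steps unit_vec 10 j) (fun n => box_ind a b (orbit L u n)) n <=
    box_vol a b + K * 2^-1 ^+ (9 * j).
Proof.
(* 54 is twice 27: frequencies of degree 2^27j have total weight at most (1 + 54 j)^m. Taking j >= 1
   below ensures 2^-9j <= 1/2. *)
move=> [j0 hj0]; have [K2 K20 hK2] := poly_le_exp2 m 54.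
exists (8 ^+ m * 11 + 6 ^+ m * (1 + K2)), (maxn 1 j0); split.
  by rewrite addr_ge0 ?mulr_ge0 ?exprn_ge0 ?addr_ge0.
move=> j; rewrite geq_max => /andP[j1 jj0] u a b n hab.
have x0 k : 0 < 2^-1 ^+ k :> R by rewrite exprn_gt0 // invr_gt0.
have M0 : (0 < 2 ^ (8 * j))%N by rewrite expn_gt0.
have d0 : (0 : R) < 2^-1 ^+ (9 * j) <= (1 / 2 : R).
  rewrite x0 mul1r -[leRHS]expr1 ler_wiXn2l ?invr_ge0 ?invf_le1 ?ler1n //.
  by rewrite (leq_trans j1) // leq_pmull.
have dH : 1 <= (2 ^ (27 * j))%:R * (2^-1 ^+ (9 * j)) ^+ 3 :> R.
  rewrite natrX -exprM mulrC half_expK; last by rewrite mulnAC leq_mul2r orbT.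
  by rewrite (_ : (_ - _ = 0)%N) ?expr0 // mulnAC subnn.
have Mtau : ((2 ^ (8 * j))%:R * 2^-1 ^+ (7 * j))^-1 = 2^-1 ^+ j :> R.
  rewrite natrX invfM -!exprVn invrK half_expK; last by rewrite leq_mul2r orbT.
  by rewrite -mulnBl mul1n.
have := avgs_box_ind_le L u 10 n d0 dH M0 (x0 (7 * j)%N) hab.
move=> /le_trans; apply; rewrite -addrA lerD2l [leRHS]mulrDl lerD //; first by rewrite mulrA.
rewrite -[leRHS]mulrA ler_wpM2l ?exprn_ge0 // [leRHS]mulrDl mul1r lerD ?hj0 // Mtau -exprM.
apply: (@le_trans _ _ (2^-1 ^+ (j * 10) * (K2 * 2 ^+ j))).
  rewrite ler_wpM2l ?(ltW (x0 _)) //; apply: (le_trans (sum_weight_le _)).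
  by apply: (le_trans _ (hK2 j)); rewrite natrM mulrA -natrM.
rewrite mulrCA ler_wpM2l // half_expK; last by rewrite leq_pmulr.
by rewrite (_ : (j * 10 - j = 9 * j)%N) //; lia.
Qed.

Lemma box_ind_itv a b x : 0 <= box_ind a b x <= 1.
Proof. by rewrite box_indP; case: [forall i, _]; rewrite ?ler01 ?lexx. Qed.

Lemma box_vol_itv a b : (forall i, 0 <= a i /\ a i <= b i <= 1) -> 0 <= box_vol a b <= 1.
Proof.
move=> h; rewrite prodr_ge0 /=; last by move=> i _; have [? /andP[? ?]] := h i; lra.
by apply: prodr_ile1 => i _; have [? /andP[? ?]] := h i; lra.
Qed.

Definition upd a (t : 'I_m) (v : R) : 'I_m -> R := fun i => if i == t then v else a i.

Lemma box_split (t : 'I_m) a b (a0 b0 : R) x : a t <= a0 -> a0 <= b0 -> b0 <= b t ->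
  box_ind a b x = box_ind a (upd b t a0) x + box_ind (upd a t a0) (upd b t b0) x +
                  box_ind (upd a t b0) b x /\
  box_vol a b = box_vol a (upd b t a0) + box_vol (upd a t a0) (upd b t b0) +
                  box_vol (upd a t b0) b.
Proof.
move=> h1 h2 h3; split; apply: (prod_split3 (t := t)).
- by move=> i /negPf it; rewrite /upd it.
- rewrite /upd eqxx; case: (leP a0 (x t)) => y1; case: (leP b0 (x t)) => y2.
  + by rewrite (le_trans h1 y1) ?andbF ?andbT /= ?add0r ?addr0.
  + by rewrite (le_trans h1 y1) (lt_le_trans y2 h3) ?andbF ?andbT /= ?add0r ?addr0.
  + by have := le_trans h2 y2; rewrite leNgt y1.
  + by rewrite (lt_le_trans y2 h3) ?andbF ?andbT /= ?add0r ?addr0.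
- by move=> i /negPf it; rewrite /upd it.
- by rewrite /upd eqxx; ring.
Qed.

Lemma avgsD (s : seq (nat * T)) (F G : T -> R) n :
  avgs s (fun n => F n + G n) n = avgs s F n + avgs s G n.
Proof.
have := avgsB s (fun n => F n + G n) G n => /eqP; rewrite eq_sym subr_eq => /eqP ->.
by congr (avgs s _ n + _); apply/funext => k; rewrite addrK.
Qed.

(* Widening the coordinates one at a time to [0, 1), the lower bound follows
   from upper bounds for the two boxes cut off in each coordinate. *)
Lemma avgs_box_lower L u (s : seq (nat * T)) (err : R) n :
  all (fun p => (0 < p.1)%N) s ->
  (forall a b, (forall i, a i <= b i <= a i + 1) ->
    avgs s (fun n => box_ind a b (orbit L u n)) n <= box_vol a b + err) ->
  forall a b, (forall i, 0 <= a i /\ a i <= b i <= 1) ->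
  box_vol a b - (2 * m)%:R * err <= avgs s (fun n => box_ind a b (orbit L u n)) n.
Proof.
move=> s0 upper a b hab.
pose A t (i : 'I_m) := if (i < t)%N then a i else 0.
pose B t (i : 'I_m) := if (i < t)%N then b i else 1.
have hAB t i : 0 <= A t i /\ A t i <= B t i <= 1.
  by rewrite /A /B; case: ifP => _; [exact: hab | rewrite lexx ler01 lexx].
suff H t : (t <= m)%N -> box_vol (A t) (B t) - (2 * t)%:R * err <=
    avgs s (fun n => box_ind (A t) (B t) (orbit L u n)) n.
  have := H m (leqnn m); have -> : A m = a by apply/funext => i; rewrite /A ltn_ord.
  by have -> : B m = b by apply/funext => i; rewrite /B ltn_ord.
elim: t => [_|t IH tm].
  have -> : (fun n => box_ind (A 0%N) (B 0%N) (orbit L u n)) = (fun=> 1).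
    apply/funext => k; rewrite box_indP; case: (boolP [forall i, _]) => // /negP[].
    by apply/forallP => i; exact: orbit_itv.
  rewrite avgs_cst // muln0 mul0r subr0 /box_vol big1 // => i _.
  by rewrite /A /B ltn0 subr0.
have {IH} := IH (ltnW tm); pose i0 := Ordinal tm.
have At : A t.+1 = upd (A t) i0 (a i0).
  apply/funext => i; rewrite /A /upd ltnS leq_eqVlt -(inj_eq val_inj) /=.
  by case: eqP => //= E; congr a; apply: val_inj.
have Bt : B t.+1 = upd (B t) i0 (b i0).
  apply/funext => i; rewrite /B /upd ltnS leq_eqVlt -(inj_eq val_inj) /=.
  by case: eqP => //= E; congr b; apply: val_inj.
have [ha /andP[hb1 hb2]] := hab i0.
have A0 : A t i0 = 0 by rewrite /A ltnn.
have B0 : B t i0 = 1 by rewrite /B ltnn.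
have spl x := @box_split i0 (A t) (B t) (a i0) (b i0) x.
rewrite A0 B0 in spl; have {}spl x := spl x ha hb1 hb2.
rewrite -At -Bt in spl.
have hup c e (P : forall i, 0 <= c i /\ c i <= e i <= 1) := upper c e
   (fun i => let: conj h1 h2 := P i in introT andP (conj (proj1 (andP h2))
     (le_trans (proj2 (andP h2)) (ler_wpDl h1 (lexx 1))))).
have u1 : avgs s (fun n => box_ind (A t) (upd (B t) i0 (a i0)) (orbit L u n)) n <=
    box_vol (A t) (upd (B t) i0 (a i0)) + err.
  apply: hup => i; rewrite /upd; case: eqP => [->|_]; last exact: hAB.
  by rewrite A0; split; [exact: lexx | apply/andP; split; lra].
have u2 : avgs s (fun n => box_ind (upd (A t) i0 (b i0)) (B t) (orbit L u n)) n <=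
    box_vol (upd (A t) i0 (b i0)) (B t) + err.
  apply: hup => i; rewrite /upd; case: eqP => [->|_]; last exact: hAB.
  by rewrite B0; split; [lra | apply/andP; split; lra].
have -> : (fun n => box_ind (A t) (B t) (orbit L u n)) =
   (fun n => box_ind (A t) (upd (B t) i0 (a i0)) (orbit L u n) +
     box_ind (A t.+1) (B t.+1) (orbit L u n) +
     box_ind (upd (A t) i0 (b i0)) (B t) (orbit L u n)).
  by apply/funext => k; have [-> _] := spl (orbit L u k).
have [_ ->] := spl (orbit L u n).
rewrite !avgsD -[(2 * t.+1)%:R]/((2 * t.+1)%:R) mulnS natrD mulrDl => h.
lra.
Qed.

Theorem box_discrepancy L : nonresonant L -> exists2 K : R, 0 <= K &
  forall u a b, (forall i, 0 <= a i /\ a i <= b i <= 1) -> forall N : {fset T},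
  `|\sum_(n <- N) (box_ind a b (orbit L u n) - box_vol a b)| <=
    K * (perimeter unit_vec N)%:R.
Proof.
move=> /avgs_box_upper[K1 [j1 [K10 hup]]].
(* The first term covers the scales below j1, where only the trivial bound 1 is available and 2^-9j
   >= 2^-9j1; the second covers the upper and lower bounds at the other scales. *)
pose C := 2 ^+ (9 * j1) + (1 + (2 * m)%:R) * K1.
have C0 : 0 <= C by rewrite addr_ge0 ?exprn_ge0 ?mulr_ge0 ?addr_ge0.
exists (C * (2 ^+ 10 * 10%:R)) => [|u a b hab N]; first by rewrite !mulr_ge0 ?exprn_ge0.
have x0 k : 0 <= 2^-1 ^+ k :> R by rewrite exprn_ge0.
have K2 : 0 <= (1 + (2 * m)%:R) * K1 by rewrite mulr_ge0 ?addr_ge0.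
have F1 n : `|box_ind a b (orbit L u n) - box_vol a b| <= 1.
  have /andP[? ?] := box_ind_itv a b (orbit L u n); have /andP[? ?] := box_vol_itv hab.
  by rewrite ler_norml; lra.
apply: sum_le_perimeter => [n|j n].
  apply: (le_trans (F1 n)); rewrite /C -[leLHS]addr0 lerD // exprn_ege1 // ler1n //.
case: (leqP j1 j) => jj; last first.
  apply: (@le_trans _ _ 1); first by apply: avgs_norm_le.
  apply: (@le_trans _ _ (2 ^+ (9 * j1) * 2^-1 ^+ (9 * j))); last first.
    by rewrite ler_wpM2r // /C lerDl.
  rewrite exprVn -ler_pdivrMr ?invr_gt0 ?exprn_gt0 // invrK mul1r.
  by rewrite ler_weXn2l ?ler1n // leq_mul2l ltnW ?orbT.
have s0 : all (fun p => (0 < p.1)%N) (avg_steps (@unit_vec d) 10 j).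
  by apply/allP => p /mapP[v _ ->]; rewrite /= expn_gt0.
rewrite avgsB avgs_cst //.
have h1 a' b' (h : forall i, a' i <= b' i <= a' i + 1) := hup j jj u a' b' n h.
have h2 := avgs_box_lower s0 h1 hab.
have h3 : avgs (avg_steps unit_vec 10 j) (fun n => box_ind a b (orbit L u n)) n <=
    box_vol a b + K1 * 2^-1 ^+ (9 * j).
  by apply: h1 => i; have [? /andP[? ?]] := hab i; lra.
have h4 : 0 <= K1 * 2^-1 ^+ (9 * j) by rewrite mulr_ge0.
have h5 : 0 <= (2 * m)%:R * (K1 * 2^-1 ^+ (9 * j)) by rewrite mulr_ge0.
have h6 : 0 <= 2 ^+ (9 * j1) * 2^-1 ^+ (9 * j) :> R by rewrite mulr_ge0 ?exprn_ge0.
have -> : C * 2^-1 ^+ (9 * j) = 2 ^+ (9 * j1) * 2^-1 ^+ (9 * j) + K1 * 2^-1 ^+ (9 * j) +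
    (2 * m)%:R * (K1 * 2^-1 ^+ (9 * j)) by rewrite /C; ring.
move: h2 h3 h4 h5 h6; move: (avgs _ _ _) (box_vol a b) (K1 * _) (2 ^+ _ * _) ((2 * m)%:R * _).
by move=> x v y z w h2 h3 h4 h5 h6; rewrite ler_norml; lra.
Qed.

End BoxDiscrepancy.

(** * Null sets for the outer measure *)

Section OuterMeasure.
Context {R : realType} {p q : nat}.
Local Notation M := 'M[R]_(p, q).
Implicit Types (X Y : set M) (s : seq (M * M)).

Lemma box_volume_ge0 (a b : M) : 0 <= box_volume a b.
Proof. by do 2!(apply: prodr_ge0 => ? _); rewrite le_max lexx. Qed.

Lemma lebesgue_mx_ge0 X : (0 <= lebesgue_mx X)%E.
Proof.
apply: le_ereal_inf_tmp => _ [a [b [_ ->]]].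
by apply: nneseries_ge0 => n _ _; rewrite lee_fin box_volume_ge0.
Qed.

Lemma le_lebesgue_mx X Y : X `<=` Y -> (lebesgue_mx X <= lebesgue_mx Y)%E.
Proof.
move=> XY; apply: ereal_inf_le_tmp => l [a [b [Yab ->]]].
by exists a, b; split => //; apply: subset_trans Yab.
Qed.

(** The finite lists are concatenated into the one sequence of boxes that the outer measure asks
    for. A point box in front of each list guarantees that the first n lists hold at least n boxes;
    its volume is 0 because p and q are positive. *)
Lemma lebesgue_mx_le_seq (hp : (0 < p)%N) (hq : (0 < q)%N) X
    (S : nat -> seq (M * M)) (v : R) :
  (forall x, X x -> exists j, exists2 c, c \in S j & box c.1 c.2 x) ->
  (forall n, \sum_(j < n) \sum_(c <- S j) box_volume c.1 c.2 <= v) ->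
  (lebesgue_mx X <= v%:E)%E.
Proof.
move=> XS Sv; pose S' j : seq (M * M) := (0, 0) :: S j.
have v0 : box_volume (0 : M) 0 = 0.
  by rewrite /box_volume (bigD1 (Ordinal hp)) //= (bigD1 (Ordinal hq)) //= !mxE subrr maxxx !mul0r.
pose C n := flatten [seq S' j | j <- iota 0 n].
have CS n : C n.+1 = C n ++ S' n by rewrite /C -addn1 iotaD map_cat flatten_cat /= cats0.
have Csz n : (n <= size (C n))%N.
  by elim: n => // n IH; rewrite CS size_cat /= addnS ltnS (leq_trans IH) // leq_addr.
have Cpre n k : (n <= k)%N -> exists t, C k = C n ++ t.
  move=> nk; rewrite -(subnKC nk); elim: (k - n)%N => [|i [t IH]].
    by exists [::]; rewrite addn0 cats0.
  by exists (t ++ S' (n + i)%N); rewrite addnS CS IH catA.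
pose f n : M * M := nth (0, 0) (C n.+1) n.
have fE n k : (n < k)%N -> f n = nth (0, 0) (C k) n.
  by move=> nk; have [t ->] := Cpre _ _ nk; rewrite nth_cat Csz.
apply: (@le_trans _ _ (\sum_(0 <= n <oo) (box_volume (f n).1 (f n).2)%:E)%E).
  apply: ereal_inf_lbound; exists (fun n => (f n).1), (fun n => (f n).2); split => //.
  move=> x /XS[j [c cS cx]].
  have cC : c \in C j.+1 by rewrite CS mem_cat inE cS !orbT.
  have /(nthP (0, 0))[k klt ck] := cC.
  exists k => //; suff -> : f k = c by [].
  rewrite -ck; have [kj|jk] := ltnP k j.+1; first by rewrite (fE k j.+1).
  have [t Ct] := Cpre j.+1 k.+1 (leqW jk).
  by rewrite /f Ct nth_cat klt.
apply: lime_le; first by apply: is_cvg_nneseries => n _ _; rewrite lee_fin box_volume_ge0.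
apply: nearW => n; rewrite sumEFin lee_fin.
apply: le_trans (Sv n).
have -> : \sum_(j < n) \sum_(c <- S j) box_volume c.1 c.2 =
    \sum_(c <- C n) box_volume c.1 c.2.
  rewrite -(big_mkord predT (fun j => \sum_(c <- S j) box_volume c.1 c.2)).
  rewrite /C big_flatten /= big_map /index_iota subn0; apply: eq_bigr => j _.
  by rewrite big_cons v0 add0r.
rewrite (big_nth (0, 0)) [leRHS](big_cat_nat _ (n := n)) //= ?Csz //.
rewrite big_nat [X in _ <= X + _]big_nat (eq_bigr (fun i => box_volume (nth (0, 0) (C n) i).1 (nth (0, 0) (C n) i).2)).
  by rewrite lerDl sumr_ge0 // => i _; rewrite box_volume_ge0.
by move=> i /= ilt; rewrite (fE i n).
Qed.

(** The Borel-Cantelli lemma: the limsup set is covered by the boxes of all scales from j1 + J on,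
    of total volume at most 2 K 2^-(j1 + J). *)
Lemma null_limsup_boxes (hp : (0 < p)%N) (hq : (0 < q)%N) (E : nat -> set M)
    (S : nat -> seq (M * M)) (K : R) (j1 : nat) :
  (forall j, (j1 <= j)%N -> forall x, E j x -> exists2 c, c \in S j & box c.1 c.2 x) ->
  (forall j, (j1 <= j)%N -> \sum_(c <- S j) box_volume c.1 c.2 <= K * 2^-1 ^+ j) ->
  lebesgue_mx [set x | forall j0, exists2 j, (j0 <= j)%N & E j x] = 0%E.
Proof.
move=> hE hS; apply/eqP; rewrite eq_le lebesgue_mx_ge0 andbT.
have K0 : 0 <= K.
  have := hS j1 (leqnn _); rewrite -ler_pdivrMr ?exprn_gt0 ?invr_gt0 //.
  apply: le_trans; rewrite divr_ge0 ?exprn_ge0 ?invr_ge0 //.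
  by apply: sumr_ge0 => c _; apply: box_volume_ge0.
have half J : (lebesgue_mx [set x | forall j0, exists2 j, (j0 <= j)%N & E j x] <=
    (2 * K * 2^-1 ^+ (j1 + J))%:E)%E.
  apply: (@lebesgue_mx_le_seq hp hq _ (fun j => S (j1 + J + j)%N)) => [x /(_ (j1 + J)%N)[j jJ Ejx]|n].
    exists (j - (j1 + J))%N; rewrite subnKC //; apply: hE => //.
    by apply: leq_trans jJ; apply: leq_addr.
  apply: (@le_trans _ _ (\sum_(j < n) K * 2^-1 ^+ (j1 + J + j))).
    by apply: ler_sum => j _; apply: hS; rewrite -addnA leq_addr.
  have -> : \sum_(j < n) K * 2^-1 ^+ (j1 + J + j) =
      2 * K * 2^-1 ^+ (j1 + J) * (1 - 2^-1 ^+ n).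
    elim: n => [|n IH]; first by rewrite big_ord0 expr0 subrr mulr0.
    by rewrite big_ord_recr /= IH [2^-1 ^+ n.+1]exprS [2^-1 ^+ (_ + n)]exprD; field.
  by rewrite ler_piMr ?mulr_ge0 ?exprn_ge0 ?invr_ge0 // gerBl exprn_ge0 ?invr_ge0.
apply/lee_addgt0Pr => eps eps0; rewrite add0e.
pose y := 2 * K * 2^-1 ^+ j1 / eps; pose J := (Num.truncn y).+1.
apply: (le_trans (half J)); rewrite lee_fin.
have yJ : y < J%:R by exact: truncnS_gt.
have HJ : J%:R <= 2 ^+ J :> R by rewrite -natrX ler_nat ltnW // ltn_expl.
rewrite exprD mulrA [2^-1 ^+ J]exprVn ler_pdivrMr ?exprn_gt0 // -ler_pdivrMl // mulrC.
exact: le_trans (ltW yJ) HJ.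
Qed.

End OuterMeasure.

(** * Almost every map is nonresonant *)

Section Counting.
Context {R : realType}.

Lemma size_int_window (s : seq int) (x D : R) : uniq s -> 0 <= D ->
  (forall a, a \in s -> x <= a%:~R <= x + D) -> (size s)%:R <= D + 1.
Proof.
move=> us D0 hs; have [k0 k0h] : exists k0 : int, (k0 - 1)%:~R < x <= k0%:~R.
  by exists (Num.ceil x); exact: ceil_itv.
have [k1 k1h] : exists k1 : int, k1%:~R <= x + D < (k1 + 1)%:~R.
  by exists (Num.floor (x + D)); exact: floor_itv.
move: k0h k1h; rewrite intrB intrD => /andP[h1 h2] /andP[h3 h4].
have k01 : k0 <= k1 + 1 by rewrite -ltzD1 -(@ltr_int R) !intrD; lra.
have len : (absz (k1 - k0 + 1))%:Z = k1 - k0 + 1 by rewrite gez0_abs // addrAC subr_ge0.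
have : (size s <= size (int_seq k0 (absz (k1 - k0 + 1)%R)))%N.
  apply: uniq_leq_size => // a /hs /andP[a1 a2]; rewrite mem_int_seq len.
  have -> : k0 + (k1 - k0 + 1) = k1 + 1 by ring.
  by rewrite -ltzD1 -!(@ltr_int R) !intrD; apply/andP; split; lra.
rewrite size_int_seq -(ler_nat R) -[X in _ <= X]/(((absz (k1 - k0 + 1)%R)%:Z%:~R)) len.
by rewrite intrD intrB; move=> h; lra.
Qed.

Lemma size_le_fibres (T U : eqType) (f : T -> U) (s : seq T) (W : seq U) (b : R) :
  uniq W -> (forall a, a \in s -> f a \in W) ->
  (forall z, z \in W -> (count (fun a => f a == z) s)%:R <= b) ->
  (size s)%:R <= (size W)%:R * b.
Proof.
move=> uW sW hb.
have -> : (size s)%:R = \sum_(z <- W) (count (fun a => f a == z) s)%:R :> R.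
  rewrite -natr_sum; congr (_%:R).
  under eq_bigr do rewrite -sum1_count big_mkcond.
  rewrite exchange_big /= -sum1_size big_seq [RHS]big_seq; apply: eq_bigr => a /sW fa.
  rewrite -big_mkcond sum1_count /= (eq_count (a2 := pred1 (f a))).
    by rewrite count_uniq_mem // fa.
  by move=> z; rewrite /= eq_sym.
apply: (@le_trans _ _ (\sum_(z <- W) b)).
  by rewrite big_seq [leRHS]big_seq; apply: ler_sum => z; exact: hb.
by rewrite big_const_seq count_predT iter_addr_0 mulr_natl.
Qed.

(* The values g a / M + beta run over an interval of length 2 j |g|; near each
   integer they stay within 2 tau for at most 4 tau M / |g| + 1 values of a. *)
Lemma count_near_int (M j : nat) (g : int) (tau beta : R) : (0 < j)%N -> (0 < M)%N ->
  0 < tau <= 1 -> g != 0 -> (`|g|%N)%:R <= M%:R * tau ->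
  (count (fun a : nat => distZ (g%:~R * a%:R / M%:R + beta) < 2 * tau) (iota 0 (2 * j * M)))%:R
    <= 18 * tau * (2 * j * M)%:R.
Proof.
move=> j0 M0 /andP[t0 t1] g0 gM; set n := (2 * j * M)%N.
pose y (a : nat) := g%:~R * a%:R / M%:R + beta : R.
pose f a := Num.floor (y a + 1 / 2).
set s := [seq a <- iota 0 n | distZ (y a) < 2 * tau].
have MR : 0 < M%:R :> R by rewrite ltr0n.
have jR : 1 <= j%:R :> R by rewrite ler1n.
have nE : n%:R = 2 * j%:R * M%:R :> R by rewrite !natrM.
set G := (`|g|%N)%:R : R; have G1 : 1 <= G by rewrite ler1n absz_gt0.
have GE : `|g%:~R| = G :> R by rewrite /G -intr_norm pmulrn.
have near a : a \in s -> `|y a - (f a)%:~R| < 2 * tau.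
  by rewrite mem_filter => /andP[].
pose b0 : R := if 0 <= g then beta else beta - 2 * j%:R * G.
have yb a : (a < n)%N -> b0 <= y a <= b0 + 2 * j%:R * G.
  move=> an; have a1 : a%:R / M%:R <= 2 * j%:R :> R by rewrite ler_pdivrMr // -nE ler_nat ltnW.
  have a0 : 0 <= a%:R / M%:R :> R by rewrite divr_ge0.
  rewrite /y /b0 -(mulrA g%:~R); move: (a%:R / M%:R) a0 a1 => z a0 a1.
  case: (leP 0 g) => gs /=.
    have -> : g%:~R = G :> R by rewrite -GE ger0_norm // ler0z.
    have ? : 0 <= G * z by rewrite mulr_ge0 //; lra.
    have ? : G * z <= G * (2 * j%:R) by rewrite ler_pM2l //; lra.
    by apply/andP; split; lra.
  have -> : g%:~R = - G :> R by rewrite -GE ltr0_norm ?opprK // ltrz0.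
  have ? : 0 <= G * z by rewrite mulr_ge0 //; lra.
  have ? : G * z <= G * (2 * j%:R) by rewrite ler_pM2l //; lra.
  by apply/andP; split; lra.
have -> : (count (fun a : nat => distZ (g%:~R * a%:R / M%:R + beta) < 2 * tau)
    (iota 0 n))%:R = (size s)%:R :> R by rewrite -size_filter.
have jG : 1 <= j%:R * G by rewrite mulr_ege1.
have W1 : (size (undup (map f s)))%:R <= 7 * j%:R * G.
  apply: (@le_trans _ _ ((2 * j%:R * G + 4 * tau) + 1)); last by lra.
  apply: (@size_int_window _ (b0 - 2 * tau)); rewrite ?undup_uniq //; first by lra.
  move=> z; rewrite mem_undup => /mapP[a sa ->]; have := near a sa.
  move: sa; rewrite mem_filter mem_iota add0n => /andP[_ /yb /andP[? ?]].
  by rewrite ltr_norml => /andP[? ?]; apply/andP; split; lra.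
have tMG : 1 <= M%:R * tau / G by rewrite ler_pdivlMr ?mul1r //; lra.
have := @size_le_fibres _ _ f s (undup (map f s)) (5 * (M%:R * tau / G)) (undup_uniq _).
move=> /(_ _ _)/le_trans; apply.
- by move=> a sa; rewrite mem_undup map_f.
- move=> z _; rewrite -size_filter -(size_map (fun a : nat => a%:Z)).
  apply: (@le_trans _ _ (4 * (M%:R * tau / G) + 1)); last by lra.
  apply: (@size_int_window _ ((z%:~R - beta) * M%:R / g%:~R - 2 * (M%:R * tau / G))).
  + by rewrite map_inj_uniq ?filter_uniq ?iota_uniq // => ? ? [].
  + by lra.
  move=> _ /mapP[a + ->]; rewrite mem_filter => /andP[/eqP fz sa].
  have gR : g%:~R != 0 :> R by rewrite intr_eq0.
  have := near a sa; rewrite fz => h.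
  have : `|a%:R - (z%:~R - beta) * M%:R / g%:~R| < 2 * (M%:R * tau / G).
    have -> : a%:R - (z%:~R - beta) * M%:R / g%:~R = (y a - z%:~R) * (M%:R / g%:~R).
      by rewrite /y; field; rewrite gR gt_eqF.
    rewrite normrM normf_div GE (gtr0_norm MR).
    rewrite (_ : 2 * (M%:R * tau / G) = 2 * tau * (M%:R / G)); last by ring.
    by rewrite ltr_pM2r // divr_gt0 //; lra.
  rewrite -[a%:Z%:~R]/(a%:R : R) ltr_norml => /andP[? ?]; apply/andP; split; lra.
(* At most 7 j G integers are approached, each by at most 5 M tau / G values of a. The product 35 j
   M tau is below 18 tau times 2 j M. *)
apply: (@le_trans _ _ (7 * j%:R * G * (5 * (M%:R * tau / G)))).
  by rewrite ler_wpM2r //; lra.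
rewrite nE (_ : 7 * j%:R * G * _ = 35 * (j%:R * (M%:R * tau))); last by field; rewrite gt_eqF //; lra.
have : 0 <= j%:R * (M%:R * tau) by rewrite !mulr_ge0 //; lra.
by lra.
Qed.

(** Fubini in the coordinate i0: on pairs (f, a), the involution exchanging a with f(i0) turns the
    count of all f, taken n times, into a sum of counts over lines. *)
Lemma card_slice_le (m n : nat) (i0 : 'I_m) (P : pred {ffun 'I_m -> 'I_n}) (B : R) :
  (forall f, #|[pred a | P [ffun i => if i == i0 then a else f i]]|%:R <= B * n%:R) ->
  (0 < n)%N -> #|P|%:R <= B * n%:R ^+ m.
Proof.
move=> hP n0; have nR : 0 < n%:R :> R by rewrite ltr0n.
rewrite -(ler_pM2r nR) mulrAC.
pose u (fa : {ffun 'I_m -> 'I_n} * 'I_n) :=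
  ([ffun i => if i == i0 then fa.2 else fa.1 i], fa.1 i0).
have uu : involutive u.
  move=> [f a]; rewrite /u /= ffunE eqxx; congr pair.
  by apply/ffunP => i; rewrite !ffunE; case: eqP => // ->.
have -> : #|P|%:R * n%:R = \sum_(fa : {ffun 'I_m -> 'I_n} * 'I_n) (P fa.1)%:R :> R.
  rewrite -(pair_bigA _ (fun (f : {ffun 'I_m -> 'I_n}) (a : 'I_n) => (P f)%:R)) /=.
  under eq_bigr do rewrite sumr_const card_ord.
  rewrite sumrMnl -[RHS]mulr_natr -natr_sum; congr (_%:R * _).
  by rewrite -sum1_card big_mkcond; apply: eq_bigr => f _; rewrite unfold_in; case: (P f).
rewrite (reindex_inj (can_inj uu)) /=.
rewrite -(pair_bigA _ (fun (f : {ffun 'I_m -> 'I_n}) (a : 'I_n) => (P [ffun i => if i == i0 then a else f i])%:R)) /=.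
apply: (@le_trans _ _ (\sum_(f : {ffun 'I_m -> 'I_n}) B * n%:R)).
  apply: ler_sum => f _; apply: le_trans (hP f).
  rewrite -natr_sum ler_nat -sum1_card [leqRHS]big_mkcond.
  by apply: leq_sum => a _; rewrite inE; case: (P _).
rewrite sumr_const card_ffun !card_ord -[leLHS]mulr_natr natrX.
by rewrite mulrAC.
Qed.

End Counting.

Section AlmostAll.
Context {R : realType} {d m : nat}.
Implicit Types (L c : 'M[R]_(m, d)).
Local Notation freqs H := {ffun 'I_m -> 'I_H * 'I_H}.

Lemma distZ_lip (x y : R) : distZ x <= distZ y + `|x - y|.
Proof.
apply: (le_trans (distZ_le x (Num.floor (y + 1 / 2)))); rewrite /distZ [leRHS]addrC.
by apply: (le_trans _ (ler_normD _ _)); rewrite subrKA.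
Qed.

Lemma dual_freq_lip L c H (phi : freqs H) (r : R) k :
  (forall i k, `|L i k - c i k| <= r) ->
  `|dual_freq L phi k - dual_freq c phi k| <= m%:R * H%:R * r.
Proof.
move=> hr; rewrite /dual_freq -sumrB.
apply: (le_trans (ler_norm_sum _ _ _)).
apply: (@le_trans _ _ (\sum_(i < m) H%:R * r)); last first.
  by rewrite sumr_const card_ord -[leLHS]mulr_natl mulrA.
apply: ler_sum => i _; rewrite -mulrBr normrM ler_pM // -intr_norm.
by rewrite -[H%:R]/(H%:Z%:~R) ler_int; have := absz_dif_le (phi i); lia.
Qed.

(** Lets finitely many corners stand for all maps: what resonates at L still resonates, at twice the
    threshold, at the corner c of its cell. *)
Lemma resonance_lip L c H (tau r : R) :
  (forall i k, `|L i k - c i k| <= r) -> m%:R * H%:R * r <= tau ->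
  resonance tau L H <= resonance (2 * tau) c H.
Proof.
move=> hr htau; rewrite /resonance big_mkcond [leRHS]big_mkcond; apply: ler_sum => phi _.
case: ifPn => [/andP[-> /forallP hL]|_]; last by case: ifP => _; rewrite ?weight_ge0.
suff -> : resonant (2 * tau) c phi by [].
apply/forallP => k; apply: (le_lt_trans (distZ_lip _ (dual_freq L phi k))).
have := hL k; have := dual_freq_lip phi k hr; rewrite distrC => h1 h2; lra.
Qed.

(** For n = 2 j M these are the lower corners of the cells of mesh 1/M in the cube of maps with
    entries in [-j, j). The outer index of g is the column, since resonance in direction k concerns
    column k alone. *)
Definition corner (n M j : nat) (g : {ffun 'I_d -> {ffun 'I_m -> 'I_n}}) : 'M[R]_(m, d) :=
  \matrix_(i, k) ((g k i)%:R / M%:R - j%:R).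

(** The conditions on different columns are independent, whence the power d. Within a column, all
    entries but one with nonzero frequency are fixed, and [count_near_int] counts the values of that
    one. *)
Lemma card_resonant_corner_le H (M j : nat) (tau : R) (phi : freqs H) :
  (0 < j)%N -> (0 < M)%N -> 0 < tau <= 1 -> H%:R <= M%:R * tau -> nonzero phi ->
  #|[pred g | resonant (2 * tau) (@corner (2 * j * M) M j g) phi]|%:R <=
    (18 * tau * (2 * j * M)%:R ^+ m) ^+ d.
Proof.
move=> j0 M0 ht HM /existsP[i0 hi0]; set n := (2 * j * M)%N.
have n0 : (0 < n)%N by rewrite !muln_gt0 j0.
pose P := [pred f : {ffun 'I_m -> 'I_n} |
  distZ (\sum_i (dif (phi i))%:~R * ((f i)%:R / M%:R - j%:R)) < 2 * tau].
have -> : #|[pred g | resonant (2 * tau) (@corner n M j g) phi]| = (#|P| ^ d)%N.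
  rewrite -[d in RHS]card_ord -card_ffun_on; apply: eq_card => g; rewrite inE.
  apply/forallP/ffun_onP => h k; have := h k; rewrite ?inE /dual_freq.
    by under eq_bigr do rewrite mxE.
  by under [X in _ -> is_true (distZ X < _)]eq_bigr do rewrite mxE.
rewrite natrX lerXn2r ?nnegrE ?mulr_ge0 ?exprn_ge0 //; try by have /andP[? ?] := ht; lra.
apply: (@card_slice_le _ _ _ i0) => // f.
set g0 := dif (phi i0).
pose beta := \sum_(i | i != i0) (dif (phi i))%:~R * ((f i)%:R / M%:R - j%:R) - g0%:~R * j%:R : R.
have gH : (`|g0|%N)%:R <= M%:R * tau.
  by apply: le_trans HM; rewrite ler_nat absz_dif_le.
apply: le_trans (count_near_int beta j0 M0 ht hi0 gH).
rewrite ler_nat -sum1_count -sum1_card -/n -[n in iota 0 n]subn0 -/(index_iota 0 n) big_mkord.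
apply: eq_leq; apply: eq_bigl => a; rewrite !inE /=; congr (distZ _ < _).
rewrite (bigD1 i0) //= ffunE eqxx /beta mulrBr -/g0 mulrA addrAC -addrA; congr (_ + _).
congr (_ + _); apply: eq_bigr => i /negPf ii; by rewrite ffunE ii.
Qed.

Lemma sum_resonance_corner_le H (M j : nat) (tau : R) :
  (0 < j)%N -> (0 < M)%N -> 0 < tau <= 1 -> H%:R <= M%:R * tau ->
  \sum_g resonance (2 * tau) (@corner (2 * j * M) M j g) H <=
    (18 * tau * (2 * j * M)%:R ^+ m) ^+ d * \sum_(phi : freqs H) weight phi.
Proof.
move=> j0 M0 ht HM; have /andP[t0 t1] := ht.
have B0 : 0 <= (18 * tau * (2 * j * M)%:R ^+ m) ^+ d.
  by rewrite exprn_ge0 // !mulr_ge0 ?exprn_ge0 //; lra.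
rewrite /resonance; under eq_bigr do rewrite big_mkcond.
rewrite exchange_big mulr_sumr; apply: ler_sum => phi _.
case: (boolP (nonzero phi)) => hphi /=; last first.
  by rewrite big1 ?mulr_ge0 ?weight_ge0.
rewrite -big_mkcond sumr_const -[leLHS]mulr_natl ler_wpM2r ?weight_ge0 //.
exact: card_resonant_corner_le.
Qed.

Lemma corner_near L (M j : nat) : (0 < M)%N -> (0 < j)%N ->
  (forall i k, `|L i k| < j%:R) ->
  exists g, forall i k, 0 <= L i k - @corner (2 * j * M) M j g i k <= M%:R^-1.
Proof.
move=> M0 j0 hL; have MR : 0 < M%:R :> R by rewrite ltr0n.
have n0 : (0 < 2 * j * M)%N by rewrite !muln_gt0 j0.
pose z i k := (L i k + j%:R) * M%:R.
have z0 i k : 0 <= z i k.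
  by rewrite mulr_ge0 ?(ltW MR) //; have := hL i k; rewrite ltr_norml => /andP[? ?]; lra.
have zn i k : (Num.truncn (z i k) < 2 * j * M)%N.
  rewrite truncn_lt_nat //; rewrite !natrM ltr_pM2r //.
  by have := hL i k; rewrite ltr_norml => /andP[? ?]; lra.
exists [ffun k => [ffun i => Ordinal (zn i k)]] => i k; rewrite !mxE !ffunE /=.
have /andP[h1 h2] := truncn_itv (z0 i k).
have -> : L i k - ((Num.truncn (z i k))%:R / M%:R - j%:R) =
    (z i k - (Num.truncn (z i k))%:R) / M%:R by rewrite /z; field; rewrite gt_eqF.
rewrite mulr_ge0 ?subr_ge0 ?invr_ge0 //= ler_pdivrMr // mulVf ?gt_eqF //.
by rewrite lerBlDl natr1 ltW.
Qed.

(* Borel-Cantelli over the scales j: at scale j the resonant maps of norm < j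
   are covered by grid cells, whose number Markov's inequality bounds through
   the mean resonance of the corners, of order 2^-14j up to powers of j. *)
Theorem almost_all_nonresonant (hm : (0 < m)%N) (hd : (2 <= d)%N) :
  almost_all (@nonresonant R d m).
Proof.
(* 34 = 27 + 7: the mesh 1/M makes m H / M equal to tau, the variation inside a cell that
   [resonance_lip] allows. *)
pose H j := (2 ^ (27 * j))%N; pose M j := (m * 2 ^ (34 * j))%N.
pose tau j : R := 2^-1 ^+ (7 * j).
pose E j := [set L : 'M[R]_(m, d) | (forall i k, `|L i k| < j%:R) /\
   2^-1 ^+ (9 * j) < resonance (tau j) L (H j)].
pose G j := [seq g <- enum {ffun 'I_d -> {ffun 'I_m -> 'I_(2 * j * M j)}} |
   2^-1 ^+ (9 * j) < resonance (2 * tau j) (corner (M j) j g) (H j)].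
pose S j := [seq (corner (M j) j g, corner (M j) j g + const_mx (M j)%:R^-1) | g <- G j].
have M0 j : (0 < M j)%N by rewrite muln_gt0 hm expn_gt0.
have MR j : 0 < (M j)%:R :> R by rewrite ltr0n.
have tau0 j : 0 < tau j <= 1.
  by rewrite exprn_gt0 ?invr_gt0 // exprn_ile1 ?invr_ge0 // invf_le1 ?ler1n.
have tau00 j : 0 <= tau j by case/andP: (tau0 j) => /ltW.
have tauE j : m%:R * (H j)%:R * (M j)%:R^-1 = tau j.
  have m0 : m%:R != 0 :> R by rewrite pnatr_eq0 -lt0n.
  have e0 : 2 ^+ (27 * j) != 0 :> R by rewrite expf_neq0 // pnatr_eq0.
  rewrite /M /H /tau natrM !natrX (_ : 34 * j = 27 * j + 7 * j)%N; last by rewrite -mulnDl.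
  by rewrite exprD exprVn; field; rewrite m0 e0 expf_neq0 // pnatr_eq0.
have HM j : (H j)%:R <= (M j)%:R * tau j.
  rewrite -tauE mulrCA divff ?gt_eqF // mulr1 -natrM ler_nat leq_pmull //.
have [K1 K10 hK1] := poly_le_exp2 (R := R) m 54.
(* [K1] pays for the total weight of the frequencies, [K2] for the volume (2 j)^(m d) of the cube
   that is being covered. *)
have [K2 K20 hK2] := poly_le_exp2 (R := R) (m * d) 2.
pose K := 18 ^+ d * K1 * K2.
have K0 : 0 <= K by rewrite !mulr_ge0 ?exprn_ge0.
have x0 k : 0 < 2^-1 ^+ k :> R by rewrite exprn_gt0 // invr_gt0.
have cover j : (1 <= j)%N -> forall L, E j L -> exists2 c, c \in S j & box c.1 c.2 L.
  move=> j0 L [hL1 hL2]; have [g hg] := corner_near (M0 j) j0 hL1.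
  exists (corner (M j) j g, corner (M j) j g + const_mx (M j)%:R^-1); last first.
    move=> i k /=; have /andP[h1 h2] := hg i k.
    by rewrite [(_ + const_mx _) i k]mxE [const_mx _ i k]mxE; apply/andP; split; lra.
  apply: map_f; rewrite mem_filter mem_enum andbT; apply: (lt_le_trans hL2).
  apply: (@resonance_lip _ _ _ _ (M j)%:R^-1); last by rewrite tauE.
  by move=> i k; have /andP[h1 h2] := hg i k; rewrite ger0_norm.
have vol j : (1 <= j)%N -> \sum_(c <- S j) box_volume c.1 c.2 <= K * 2^-1 ^+ j.
  move=> j0; rewrite big_map.
  rewrite (eq_bigr (fun=> (M j)%:R^-1 ^+ (m * d))) => [|g _]; last first.
    rewrite /box_volume (eq_bigr (fun=> (M j)%:R^-1 ^+ d)) => [|i _]; last first.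
      rewrite (eq_bigr (fun=> (M j)%:R^-1)) ?prodr_const ?card_ord // => k _ /=.
      by rewrite [(_ + const_mx _) i k]mxE [const_mx _ i k]mxE addrAC subrr add0r max_r ?invr_ge0.
    by rewrite prodr_const card_ord -exprM mulnC.
  rewrite big_const_seq count_predT iter_addr_0 -[leLHS]mulr_natl.
  have sizeG : (size (G j))%:R * 2^-1 ^+ (9 * j) <=
      (18 * tau j * (2 * j * M j)%:R ^+ m) ^+ d * (K1 * 2 ^+ j).
    apply: (@le_trans _ _ ((18 * tau j * (2 * j * M j)%:R ^+ m) ^+ d *
        \sum_(phi : freqs (H j)) weight phi)); last first.
      rewrite ler_wpM2l ?exprn_ge0 ?mulr_ge0 ?exprn_ge0 //.
      apply: (le_trans (sum_weight_le _)).
      by apply: (le_trans _ (hK1 j)); rewrite natrM mulrA -natrM.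
    apply: (le_trans _ (sum_resonance_corner_le j0 (M0 j) (tau0 j) (HM j))).
    apply: (@le_trans _ _ (\sum_(g <- G j) resonance (2 * tau j) (corner (M j) j g) (H j))).
      rewrite mulr_natl -iter_addr_0 -count_predT -big_const_seq.
      rewrite big_seq [leRHS]big_seq; apply: ler_sum => g.
      by rewrite mem_filter => /andP[/ltW].
    rewrite big_filter big_enum_cond big_mkcond /=; apply: ler_sum => g _.
    by case: ifP => // _; apply: sumr_ge0 => phi _; apply: weight_ge0.
  have key : (18 * tau j * (2 * j * M j)%:R ^+ m) ^+ d * (M j)%:R^-1 ^+ (m * d) =
      (18 * tau j) ^+ d * (2 * j)%:R ^+ (m * d).
    rewrite exprMn -exprM (natrM R (2 * j) (M j)) (exprMn _ (2 * j)%:R).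
    by rewrite exprVn mulrA mulfK // expf_neq0 // gt_eqF.
  have : (size (G j))%:R * 2^-1 ^+ (9 * j) * (M j)%:R^-1 ^+ (m * d) <=
      (18 * tau j) ^+ d * (2 * j)%:R ^+ (m * d) * (K1 * 2 ^+ j).
    by rewrite -key [leRHS]mulrAC ler_pM2r // exprn_gt0 // invr_gt0.
  have h1 : (2 * j)%:R ^+ (m * d) <= K2 * 2 ^+ j :> R.
    apply: le_trans (hK2 j); rewrite lerXn2r ?nnegrE ?addr_ge0 ?mulr_ge0 //.
    by rewrite natrM lerDr.
  (* Here d >= 2 enters: 2^-14j stays summable after Markov's inequality divides by 2^-9j and the
     two polynomial factors cost 2^j each. *)
  have h2 : (18 * tau j) ^+ d <= 18 ^+ d * 2^-1 ^+ (14 * j).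
    rewrite exprMn ler_wpM2l ?exprn_ge0 // /tau -exprM.
    by rewrite ler_wiXn2l ?invr_ge0 ?invf_le1 ?ler1n // mulnAC leq_mul2r -[14%N]/(7 * 2)%N leq_mul2l hd !orbT.
  move=> h3; have h4 : (size (G j))%:R * 2^-1 ^+ (9 * j) * (M j)%:R^-1 ^+ (m * d) <=
      18 ^+ d * 2^-1 ^+ (14 * j) * (K2 * 2 ^+ j) * (K1 * 2 ^+ j).
    apply: (le_trans h3); rewrite ler_wpM2r ?mulr_ge0 ?exprn_ge0 //.
    by rewrite ler_pM // ?exprn_ge0 // mulr_ge0.
  rewrite -(ler_pM2r (x0 (9 * j)%N)) mulrAC; apply: (le_trans h4).
  rewrite [leLHS](_ : _ = K * (2^-1 ^+ (14 * j) * 2 ^+ (j + j))); last by rewrite /K exprD; ring.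
  rewrite -[leRHS]mulrA ler_wpM2l // half_expK; last by lia.
  by rewrite -exprD ler_wiXn2l ?invr_ge0 ?invf_le1 ?ler1n //; lia.
apply/eqP; rewrite eq_le lebesgue_mx_ge0 andbT.
rewrite -(null_limsup_boxes hm (ltnW hd) cover vol); apply: le_lebesgue_mx => L /= hL j0.
(* Beyond this bound on the entries, L lies in the cube considered at every scale j, so each
   violation of nonresonance puts it in [E j]. *)
pose B := \big[Num.max/0]_i \big[Num.max/0]_k `|L i k|.
pose j2 := maxn j0 (Num.truncn B).+1.
have LB i k : `|L i k| < (Num.truncn B).+1%:R.
  apply: (le_lt_trans _ (truncnS_gt B)).
  apply: (le_trans _ (le_bigmax _ _ i)).
  by apply: (le_trans _ (le_bigmax _ _ k)).
apply: contrapT => hn; apply: hL; exists j2 => j jj; rewrite leNgt; apply/negP => hr.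
apply: hn; exists j; first by apply: leq_trans jj; rewrite leq_maxl.
split => // i k; apply: (lt_le_trans (LB i k)); rewrite ler_nat.
by apply: leq_trans jj; rewrite leq_maxr.
Qed.

End AlmostAll.

(** * Lower bound for the outer measure *)

Section LowerBound.
Context {R : realType}.

Definition itv_ind (a b t : R) : R := (a <= t <= b)%R%:R.

Lemma itv_ind_ge0 a b t : 0 <= itv_ind a b t.
Proof. exact: ler0n. Qed.

Lemma itv_indE a b : itv_ind a b = \1_(`[a, b]%classic : set R).
Proof.
apply/funext => t; rewrite indicE /itv_ind.
have -> // : (a <= t <= b)%R = (t \in `[a, b]%classic).
by apply/idP/idP => [h|/set_mem]; [apply/mem_set; rewrite /= in_itv | rewrite /= in_itv].
Qed.

Lemma measurable_itv_ind (c a b : R) :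
  measurable_fun [set: R] (fun t => (c * itv_ind a b t)%:E).
Proof.
apply/measurable_EFinP; apply: measurable_funM => //.
by rewrite itv_indE; apply: measurable_indic.
Qed.

Lemma integral_itv_ind (c a b : R) : 0 <= c ->
  (\int[@lebesgue_measure R]_(t in [set: R]) (c * itv_ind a b t)%:E =
    (c * Num.max 0 (b - a))%:E)%E.
Proof.
move=> c0; under eq_integral do rewrite EFinM.
rewrite ge0_integralZl_EFin //; first last.
- by have := measurable_itv_ind 1 a b; under eq_fun do rewrite mul1r.
- by move=> t _; rewrite lee_fin itv_ind_ge0.
rewrite EFinM; congr (_ * _)%E; rewrite itv_indE integral_indic // setIT.
rewrite [LHS](lebesgue_measure_itv `[a, b]) /= lte_fin; case: ltP => ab; last by rewrite max_l // subr_le0.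
by rewrite max_r // subr_ge0 ltW.
Qed.

(* Integrating an inequality between weighted sums of indicators of boxes, one
   coordinate at a time. *)
Lemma le_volume_of_ind n (w v : nat -> R) (a b a' b' : nat -> 'I_n -> R) :
  (forall k, 0 <= w k) -> (forall k, 0 <= v k) ->
  (forall x : 'I_n -> R,
    (\sum_(0 <= k <oo) (w k * \prod_i itv_ind (a k i) (b k i) (x i))%:E <=
     \sum_(0 <= k <oo) (v k * \prod_i itv_ind (a' k i) (b' k i) (x i))%:E)%E) ->
  (\sum_(0 <= k <oo) (w k * \prod_i Num.max 0 (b k i - a k i))%:E <=
   \sum_(0 <= k <oo) (v k * \prod_i Num.max 0 (b' k i - a' k i))%:E)%E.
Proof.
elim: n w v a b a' b' => [|n IH] w v a b a' b' w0 v0 H.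
  have E0 (u : nat -> R) (g : nat -> 'I_0 -> R) :
      (\sum_(0 <= k <oo) (u k * \prod_i g k i)%:E = \sum_(0 <= k <oo) (u k)%:E)%E.
    by apply: eq_eseriesr => k _; rewrite big_ord0 mulr1.
  have := H (fun=> 0).
  rewrite (E0 w (fun k i => itv_ind (a k i) (b k i) 0)).
  rewrite (E0 v (fun k i => itv_ind (a' k i) (b' k i) 0)).
  rewrite (E0 w (fun k i => Num.max 0 (b k i - a k i))).
  by rewrite (E0 v (fun k i => Num.max 0 (b' k i - a' k i))).
have P0 (c e : nat -> 'I_n.+1 -> R) k :
    0 <= \prod_(i < n) Num.max 0 (e k (lift ord0 i) - c k (lift ord0 i)).
  by apply: prodr_ge0 => i _; rewrite le_max lexx.
have step t : (\sum_(0 <= k <oo) (w k * \prod_(i < n) Num.max 0 (b k (lift ord0 i) - a k (lift ord0 i)) *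
       itv_ind (a k ord0) (b k ord0) t)%:E <=
    \sum_(0 <= k <oo) (v k * \prod_(i < n) Num.max 0 (b' k (lift ord0 i) - a' k (lift ord0 i)) *
       itv_ind (a' k ord0) (b' k ord0) t)%:E)%E.
  have E1 (u : nat -> R) (c e : nat -> 'I_n.+1 -> R) :
      (\sum_(0 <= k <oo) (u k * \prod_(i < n) Num.max 0 (e k (lift ord0 i) - c k (lift ord0 i)) *
         itv_ind (c k ord0) (e k ord0) t)%:E =
       \sum_(0 <= k <oo) (u k * itv_ind (c k ord0) (e k ord0) t *
         \prod_(i < n) Num.max 0 (e k (lift ord0 i) - c k (lift ord0 i)))%:E)%E.
    by apply: eq_eseriesr => k _; rewrite mulrAC.
  have E2 (u : nat -> R) (c e : nat -> 'I_n.+1 -> R) (x : 'I_n -> R) :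
      (\sum_(0 <= k <oo) (u k * \prod_i itv_ind (c k i) (e k i)
         (if unlift ord0 i is Some j then x j else t))%:E =
       \sum_(0 <= k <oo) (u k * itv_ind (c k ord0) (e k ord0) t *
         \prod_(i < n) itv_ind (c k (lift ord0 i)) (e k (lift ord0 i)) (x i))%:E)%E.
    apply: eq_eseriesr => k _; rewrite big_ord_recl unlift_none mulrA.
    by under eq_bigr do rewrite liftK.
  rewrite !E1.
  apply: (IH (fun k => w k * itv_ind (a k ord0) (b k ord0) t)
    (fun k => v k * itv_ind (a' k ord0) (b' k ord0) t)
    (fun k i => a k (lift ord0 i)) (fun k i => b k (lift ord0 i))
    (fun k i => a' k (lift ord0 i)) (fun k i => b' k (lift ord0 i))).
  - by move=> k; rewrite mulr_ge0 ?itv_ind_ge0.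
  - by move=> k; rewrite mulr_ge0 ?itv_ind_ge0.
  move=> x; have := H (fun i => if unlift ord0 i is Some j then x j else t).
  by rewrite !E2.
have intE (u : nat -> R) (c e : nat -> 'I_n.+1 -> R) : (forall k, 0 <= u k) ->
   (\int[@lebesgue_measure R]_(t in [set: R]) \sum_(0 <= k <oo)
     (u k * \prod_(i < n) Num.max 0 (e k (lift ord0 i) - c k (lift ord0 i)) *
       itv_ind (c k ord0) (e k ord0) t)%:E =
    \sum_(0 <= k <oo) (u k * \prod_i Num.max 0 (e k i - c k i))%:E)%E.
  move=> u0; rewrite integral_nneseries //; first last.
  - by move=> k t _; rewrite lee_fin !mulr_ge0 ?itv_ind_ge0.
  - by move=> k; apply: measurable_itv_ind.
  apply: eq_eseriesr => k _; rewrite integral_itv_ind; last by rewrite mulr_ge0.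
  by rewrite big_ord_recl mulrAC mulrA.
rewrite -!intE //; apply: ge0_le_integral => //.
- by move=> t _; apply: nneseries_ge0 => k _ _; rewrite lee_fin !mulr_ge0 ?itv_ind_ge0.
- apply: ge0_emeasurable_sum => [k t _ _|k _]; last exact: measurable_itv_ind.
  by rewrite lee_fin !mulr_ge0 ?itv_ind_ge0.
- apply: ge0_emeasurable_sum => [k t _ _|k _]; last exact: measurable_itv_ind.
  by rewrite lee_fin !mulr_ge0 ?itv_ind_ge0.
Qed.

Lemma prod_itv_ind n (a b x : 'I_n -> R) :
  \prod_i itv_ind (a i) (b i) (x i) = [forall i, (a i <= x i <= b i)%R]%:R.
Proof.
rewrite /itv_ind; case: (boolP [forall i, _]) => [/forallP H|].
  by rewrite big1 // => i _; rewrite H.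
by rewrite negb_forall => /existsP[i /negPf hi]; rewrite (bigD1 i) //= hi mul0r.
Qed.

Lemma sum_nat_eq_le1 k0 N : (\sum_(0 <= k < N) (k == k0) <= 1)%N.
Proof.
elim: N => [|N IH]; first by rewrite big_geq.
rewrite big_nat_recr //=; case: eqP => [<-|_]; last by rewrite addn0.
rewrite big1_seq // => k /andP[_]; rewrite mem_index_iota => /andP[_ kN].
by rewrite ltn_eqF.
Qed.

(** The indicators of disjoint cubes in X sum to at most 1, and the sum vanishes off X. It is
    therefore dominated pointwise by the indicators of any cover of X by boxes, and
    [le_volume_of_ind] passes to volumes. The argument tests each cover, so X may be any set. *)
Lemma lebesgue_mx_ge_cubes (T : eqType) n (s : seq T) (c : T -> 'cV[R]_n) (r : R)
    (X : set 'cV[R]_n) :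
  uniq s -> 0 <= r ->
  (forall i j (x : 'cV[R]_n), i \in s -> j \in s -> (forall k, `|x k 0 - c i k 0| <= r) ->
     (forall k, `|x k 0 - c j k 0| <= r) -> i = j) ->
  (forall i (x : 'cV[R]_n), i \in s -> (forall k, `|x k 0 - c i k 0| <= r) -> X x) ->
  ((((size s)%:R * (2 * r) ^+ n)%:E) <= lebesgue_mx X)%E.
Proof.
move=> us r0 disj sub; apply: le_ereal_inf_tmp => _ [a [b [cov ->]]].
have vol0 k : (0 <= (box_volume (a k) (b k))%:E)%E by rewrite lee_fin box_volume_ge0.
case: s us disj sub => [|i0 s'] us disj sub.
  by rewrite mul0r; apply: nneseries_ge0.
set s := i0 :: s' in us disj sub *.
pose C k := c (nth i0 s k); pose w k : R := (k < size s)%N%:R.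
pose A k (i : 'I_n) := C k i 0 - r; pose B k (i : 'I_n) := C k i 0 + r.
have w0 k : 0 <= w k by [].
have cubeP x k i : A k i <= x i <= B k i -> `|(\col_i x i : 'cV[R]_n) i 0 - C k i 0| <= r.
  by rewrite mxE ler_distl.
have rhs0 x k : (0 <= (1 * \prod_(i < n) itv_ind (a k i 0) (b k i 0) (x i))%:E)%E.
  by rewrite mul1r lee_fin; apply: prodr_ge0 => i _; exact: itv_ind_ge0.
have lhs0 x k : 0 <= w k * \prod_i itv_ind (A k i) (B k i) (x i).
  by rewrite mulr_ge0 //; apply: prodr_ge0 => i _; exact: itv_ind_ge0.
have pointwise (x : 'I_n -> R) :
    (\sum_(0 <= k <oo) (w k * \prod_i itv_ind (A k i) (B k i) (x i))%:E <=
     \sum_(0 <= k <oo) (1 * \prod_i itv_ind (a k i 0) (b k i 0) (x i))%:E)%E.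
  pose Q k := (k < size s)%N && [forall i, A k i <= x i <= B k i].
  have QE k : w k * \prod_i itv_ind (A k i) (B k i) (x i) = (Q k)%:R.
    by rewrite prod_itv_ind /w /Q; case: (k < size s)%N; rewrite ?mul1r ?mul0r.
  have [[k0 Qk0]|nQ] := pselect (exists k, Q k); last first.
    rewrite eseries0 => [|k _ _]; first by apply: nneseries_ge0.
    by rewrite QE; case E : (Q k) => //; case: nQ; exists k.
  have inX k : Q k -> X (\col_i x i).
    move=> /andP[ks /forallP h]; apply: (@sub (nth i0 s k)); first by rewrite mem_nth.
    by move=> i; apply: cubeP.
  have uQ k : Q k -> k = k0.
    move: Qk0 => /andP[ks0 /forallP h0] /andP[ks /forallP h].
    apply/eqP; rewrite -(nth_uniq i0 ks ks0 us); apply/eqP.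
    by apply: (@disj _ _ (\col_i x i)); rewrite ?mem_nth // => i; exact: cubeP.
  apply: (@le_trans _ _ 1%E).
    apply: lime_le; first by apply: is_cvg_nneseries => k _ _; rewrite lee_fin.
    apply: nearW => N; rewrite sumEFin lee_fin big_mkord.
    apply: (@le_trans _ _ (\sum_(k < N) (k == k0 :> nat)%:R)).
      by apply: ler_sum => k _; rewrite QE; case E : (Q k) => //; rewrite (uQ _ E) eqxx.
    rewrite -natr_sum -[leRHS]/(1%:R) ler_nat -(big_mkord predT (fun k => (k == k0) : nat)).
    by rewrite sum_nat_eq_le1.
  have [k1 _ bx] := cov _ (inX _ Qk0).
  apply: le_trans (nneseries_lim_ge k1.+1 (fun k _ _ => rhs0 x k)).
  rewrite sumEFin lee_fin big_nat_recr //= mul1r prod_itv_ind.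
  have -> : [forall i, a k1 i 0 <= x i <= b k1 i 0].
    by apply/forallP => i; have := bx i 0; rewrite mxE.
  by rewrite lerDr; apply: sumr_ge0 => k _; have := rhs0 x k.
have := le_volume_of_ind w0 (fun=> ler01) pointwise.
have volE k : \prod_i Num.max 0 (B k i - A k i) = (2 * r) ^+ n.
  rewrite (eq_bigr (fun=> 2 * r)) ?prodr_const ?card_ord // => i _.
  by rewrite /A /B max_r; [ring | lra].
have -> : (\sum_(0 <= k <oo) (1 * \prod_i Num.max 0 (b k i 0 - a k i 0))%:E =
    \sum_(0 <= k <oo) (box_volume (a k) (b k))%:E)%E.
  apply: eq_eseriesr => k _; rewrite mul1r /box_volume.
  by under [in RHS]eq_bigr do rewrite big_ord1.
apply: le_trans; apply: le_trans (nneseries_lim_ge (size s) _); last first.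
  by move=> k _ _; rewrite lee_fin volE mulr_ge0 ?exprn_ge0 ?mulr_ge0.
rewrite sumEFin lee_fin big_mkord (eq_bigr (fun=> (2 * r) ^+ n)).
  by rewrite sumr_const card_ord mulr_natl.
by move=> k _; rewrite volE /w ltn_ord mul1r.
Qed.

End LowerBound.

(** * Points of cut and project sets *)

Section CpsPoints.
Context {R : realType} {d m : nat}.
Local Notation V := 'cV[R]_(d + m).
Local Notation T := 'cV[int]_d.
Implicit Types (L : 'M[R]_(m, d)) (F : {vspace V}) (s y v : V) (n h : T).

Lemma coord_le_norm p (v : 'cV[R]_p) i : `|v i 0| <= `|v|.
Proof.
by rewrite [leRHS]mx_normrE; exact: (le_bigmax _ (fun ij : 'I_p * 'I_1 => `|v ij.1 ij.2|) (i, 0)).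
Qed.

Lemma norm_le_coord p (v : 'cV[R]_p) (c : R) : 0 <= c ->
  (forall i, `|v i 0| <= c) -> `|v| <= c.
Proof.
by move=> c0 h; rewrite [leLHS]mx_normrE; apply/bigmax_leP; split => //= -[i j] _; rewrite ord1.
Qed.

Lemma linear_bounded p q (f : {linear 'cV[R]_p -> 'cV[R]_q}) :
  exists2 c : R, 0 < c & forall v : 'cV[R]_p, `|f v| <= c * `|v|.
Proof.
exists (1 + \sum_i `|f (delta_mx i 0)|) => [|v].
  by rewrite ltr_wpDr // sumr_ge0.
have -> : f v = \sum_i v i 0 *: f (delta_mx i 0).
  rewrite {1}(matrix_sum_delta v) linear_sum; apply: eq_bigr => i _.
  by rewrite big_ord1 linearZ.
apply: (le_trans (ler_norm_sum _ _ _)); rewrite mulrDl mul1r ler_wpDl // mulr_suml.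
by apply: ler_sum => i _; rewrite normrZ mulrC ler_wpM2l // coord_le_norm.
Qed.

(** The source of all boxes: prescribing the jump of a floor places the fractional part of y in an
    interval of length 1. *)
Lemma floor_step (y t : R) (q : int) :
  (Num.floor y - Num.floor (y - t) == q) = (0 <= frac_part y + q%:~R - t < 1).
Proof.
rewrite /frac_part; apply/eqP/idP => [<-|/andP[h0 h1]].
  have := floor_itv (y - t); rewrite intrB intrD => /andP[? ?].
  by apply/andP; split; lra.
rewrite (@floor_def _ (y - t) (Num.floor y - q)); first by ring.
by rewrite !intrD mulrNz; apply/andP; split; lra.
Qed.

Definition graph_pt L (x : 'cV[R]_d) : V := col_mx x (L *m x).

Lemma graph_ptB L (x y : 'cV[R]_d) : graph_pt L (x - y) = graph_pt L x - graph_pt L y.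
Proof. by rewrite /graph_pt mulmxBr opp_col_mx add_col_mx. Qed.

Lemma graph_ptZ L (a : R) x : graph_pt L (a *: x) = a *: graph_pt L x.
Proof. by rewrite /graph_pt -scalemxAr scale_col_mx. Qed.

Lemma EsetP L v : Eset L v <-> v = graph_pt L (usubmx v).
Proof.
rewrite /Eset /=; split => [/mem_physE[x ->]|->]; first by rewrite /graph_pt col_mxKu.
by apply/mem_physE; exists (usubmx v).
Qed.

Lemma Eset_graph L x : Eset L (graph_pt L x).
Proof. by apply/mem_physE; exists x. Qed.

Lemma EsetD L v w : Eset L v -> Eset L w -> Eset L (v + w).
Proof. exact: memvD. Qed.

Lemma EsetB L v w : Eset L v -> Eset L w -> Eset L (v - w).
Proof. exact: memvB. Qed.

Lemma EsetZ L (a : R) v : Eset L v -> Eset L (a *: v).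
Proof. exact: memvZ. Qed.

(** The last m coordinates of the projection of v along E onto [Fref]. *)
Definition height L v : 'cV[R]_m := dsubmx v - L *m usubmx v.

Lemma heightB L v w : height L (v - w) = height L v - height L w.
Proof. by rewrite /height !linearB /= addrACA. Qed.

Lemma heightD L v w : height L (v + w) = height L v + height L w.
Proof. by rewrite /height !linearD /= addrACA. Qed.

Lemma height0P L v : height L v = 0 <-> Eset L v.
Proof.
rewrite EsetP /height; split => [/subr0_eq h|->]; last by rewrite /graph_pt col_mxKu col_mxKd subrr.
by rewrite /graph_pt -h vsubmxK.
Qed.

Lemma height_col_mx L x z : height L (col_mx x z) = z - L *m x.
Proof. by rewrite /height col_mxKu col_mxKd. Qed.

Section Admissible.
Variables (L : 'M[R]_(m, d)) (F : {vspace V}).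
Hypothesis adm : admissible L F.

Lemma projED v : projE L F v + projF L F v = v.
Proof. by have [h1 h2 _] := adm; apply: daddv_pi_add; rewrite // h1 memvf. Qed.

Lemma Eset_projE v : Eset L (projE L F v).
Proof. exact: memv_pi. Qed.

Lemma projE_id v : Eset L v -> projE L F v = v.
Proof. by have [_ h2 _] := adm; exact: daddv_pi_id. Qed.

Lemma height_projF v : height L (projF L F v) = height L v.
Proof.
have h0 : height L (projE L F v) = 0 by apply/height0P; exact: Eset_projE.
by rewrite -{2}(projED v) heightD h0 add0r.
Qed.

Lemma projF_height v w : height L v = height L w -> projF L F v = projF L F w.
Proof.
move=> e; apply/eqP; rewrite -subr_eq0 -linearB; apply/eqP.
have : Eset L (v - w) by apply/height0P; rewrite heightB e subrr.
move=> /projE_id h; have := projED (v - w).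
by rewrite h -[RHS]addr0 => /addrI.
Qed.

(** [projF] moves points only along E and so preserves heights: the strip is the same for every
    internal space. *)
Lemma sliceP v : slice L F v <-> forall i, 0 <= height L v i 0 <= 1.
Proof.
split=> [[w [c [cu cd] <-] [e Ee <-]] i|hv].
  rewrite heightD height_projF ((height0P L e).2 Ee) addr0.
  by rewrite /height cu mulmx0 subr0; apply: cd.
pose c := col_mx 0 (height L v) : V; exists (projF L F c).
  exists c => //; split; first by rewrite col_mxKu.
  by move=> i; rewrite col_mxKd.
exists (v - projF L F c); last by rewrite addrC subrK.
by apply/height0P; rewrite heightB height_projF height_col_mx mulmx0 subr0 subrr.
Qed.

(* Above each integer vector n the strip contains exactly one point of the
   coset of s when s is regular; [level] is its last m integer coordinates. *)
Definition level L s n : 'cV[int]_m :=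
  \col_i (- Num.floor (height L s i 0 - (L *m int_vec n) i 0)).

Definition lattice_pt (h : T) (q : 'cV[int]_m) : V :=
  col_mx (map_mx intr h) (map_mx intr q).

Lemma Zlattice_lattice_pt h q : Zlattice (lattice_pt h q).
Proof.
move=> i; rewrite /lattice_pt mxE; case: splitP => j _; rewrite mxE; exact: intr_int.
Qed.

Lemma lattice_ptE v : Zlattice v -> exists h q, v = lattice_pt h q.
Proof.
move=> hv; exists (map_mx Num.floor (usubmx v)), (map_mx Num.floor (dsubmx v)).
rewrite -[v in LHS]vsubmxK /lattice_pt; congr col_mx; apply/matrixP => i j; rewrite !mxE ord1.
  by rewrite floorK //; exact: hv.
by rewrite floorK //; exact: hv.
Qed.

Lemma lattice_pt_inj h q h' q' : lattice_pt h q = lattice_pt h' q' -> h = h' /\ q = q'.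
Proof.
by move=> /eq_col_mx[e1 e2]; split; apply/matrixP => i j;
  [have /matrixP/(_ i j) := e1 | have /matrixP/(_ i j) := e2]; rewrite !mxE => /intr_inj.
Qed.

Definition strip_pt s n : V := s + lattice_pt n (level L s n).

Definition cps_pt s n : V := projE L F (strip_pt s n).

Lemma height_lattice_pt h q i :
  height L (lattice_pt h q) i 0 = (q i 0)%:~R - (L *m int_vec h) i 0.
Proof. by rewrite /lattice_pt height_col_mx !mxE. Qed.

Lemma height_strip_pt s n i : height L (strip_pt s n) i 0 = orbit L (height L s) n i.
Proof.
rewrite heightD mxE height_lattice_pt [level L s n i 0]mxE mulrNz /orbit /frac_part.
by rewrite addrCA addrC.
Qed.

Lemma Zcoset_strip_pt s n : Zcoset s (strip_pt s n).
Proof. by exists (lattice_pt n (level L s n)); [exact: Zlattice_lattice_pt | rewrite addrC]. Qed.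

Lemma slice_strip_pt s n : slice L F (strip_pt s n).
Proof.
apply/sliceP => i; rewrite height_strip_pt.
by have /andP[-> /ltW ->] := orbit_itv L (height L s) n i.
Qed.

(* Moving a point of height 0 or 1 slightly off the strip shows that it lies on
   the boundary of the slice. *)
Lemma regular_height s v : regular L F s -> Zcoset s v -> slice L F v ->
  forall i, 0 < height L v i 0 < 1.
Proof.
move=> reg zv sv i; have /sliceP/(_ i)/andP[h0 h1] := sv.
have inn : (slice L F)° v.
  apply: contrapT => hn; suff : set0 v by [].
  by rewrite -reg; split => //; split => //; exact: subset_closure.
have [e /= e0 he] := (@nbhs_ballP _ _ v (slice L F)).1 inn.
pose w (c : R) : V := v + c *: col_mx 0 (delta_mx i 0).
have hw c : `|c| < e -> 0 <= height L v i 0 + c <= 1.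
  move=> ce; have : slice L F (w c).
    apply: he; rewrite -ball_normE /ball_ /= /w opprD addrA subrr sub0r normrN.
    apply: le_lt_trans ce; apply: norm_le_coord => // j; rewrite mxE normrM ler_piMr //.
    rewrite mxE; case: splitP => k _; rewrite !mxE ?normr0 //.
    by case: (_ && _); rewrite ?normr0 ?normr1.
  move=> /sliceP/(_ i); rewrite heightD mxE /height !linearZ /= col_mxKu col_mxKd.
  have e1 : (c *: delta_mx i 0 : 'cV[R]_m) i 0 = c by rewrite !mxE !eqxx mulr1.
  by rewrite mulmx0 oppr0 scaler0 addr0 e1.
have n1 : `|- (e / 2)| < e by rewrite normrN gtr0_norm; lra.
have n2 : `|e / 2| < e by rewrite gtr0_norm; lra.
have /andP[h2 _] := hw _ n1; have /andP[_ h3] := hw _ n2.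
by apply/andP; split; lra.
Qed.

Lemma regular_strip_pt s v : regular L F s -> Zcoset s v -> slice L F v ->
  exists n, v = strip_pt s n.
Proof.
move=> reg zv sv; have [z zZ zs] := zv; have [h [q zE]] := lattice_ptE zZ.
exists h; rewrite /strip_pt -zs addrC zE; congr (_ + lattice_pt _ _).
apply/matrixP => i j; rewrite ord1 mxE; have := regular_height reg zv sv i.
rewrite -zs zE heightD mxE height_lattice_pt => /andP[h0 h1].
apply/eqP; rewrite -eqr_oppLR eq_sym; apply/eqP; apply: floor_def.
by rewrite intrD mulrNz; apply/andP; split; lra.
Qed.

Lemma cpsP s y : regular L F s -> cps L F s y <-> exists n, y = cps_pt s n.
Proof.
move=> reg; split=> [[v [sv zv] <-]|[n ->]].
  by have [n ->] := regular_strip_pt reg zv sv; exists n.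
by exists (strip_pt s n) => //; split; [exact: slice_strip_pt | exact: Zcoset_strip_pt].
Qed.

Lemma projE_lattice_inj z z' : Zlattice z -> Zlattice z' -> projE L F z = projE L F z' -> z = z'.
Proof. by move=> hz hz'; have [_ _ inj] := adm; apply: inj; rewrite inE. Qed.

Lemma strip_ptB s n n' :
  strip_pt s n - strip_pt s n' = lattice_pt (n - n') (level L s n - level L s n').
Proof.
rewrite /strip_pt opprD addrACA subrr add0r /lattice_pt opp_col_mx add_col_mx.
by rewrite !map_mxB.
Qed.

Lemma cps_ptB s n n' :
  cps_pt s n - cps_pt s n' = projE L F (lattice_pt (n - n') (level L s n - level L s n')).
Proof. by rewrite -strip_ptB linearB. Qed.

Lemma lift_cps_pt s n : lift_pt L F s (cps_pt s n) = strip_pt s n.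
Proof.
rewrite /lift_pt; set X := [set v | _].
have [[z zZ <-] zE] : X (get X).
  apply: (@getPex _ X); exists (strip_pt s n); split => //; exact: Zcoset_strip_pt.
rewrite /strip_pt addrC; congr (_ + _); apply: projE_lattice_inj => //.
  exact: Zlattice_lattice_pt.
by move: zE; rewrite /cps_pt /strip_pt !linearD /= addrC => /addrI.
Qed.

Lemma cps_pt_inj s : injective (cps_pt s).
Proof.
move=> n n' e; have : strip_pt s n = strip_pt s n' by rewrite -!lift_cps_pt e.
by move=> /addrI/lattice_pt_inj[].
Qed.

(** Subtracting the point of E with the same first d coordinates leaves a vector of [Fref], which
    [rho] kills. Hence type II patches select lattice vectors (h, q) by h alone. *)
Lemma rhoE v : rho L v = graph_pt L (usubmx v).
Proof.
have h0 : (physE L :&: Fref = 0 :> {vspace V})%VS.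
  apply/eqP; rewrite -subv0; apply/subvP => w; rewrite memv_cap memv0 => /andP[].
  move=> /mem_physE[x ->] /mem_Fref[z] /eq_col_mx[-> _].
  by rewrite mulmx0 col_mx0.
rewrite /rho -{1}[v](subrK (graph_pt L (usubmx v))) linearD /=.
rewrite [X in _ + X]daddv_pi_id //; last exact: Eset_graph.
rewrite -[RHS]add0r; congr (_ + _).
have hF : v - graph_pt L (usubmx v) \in Fref.
  apply/mem_Fref; exists (dsubmx v - L *m usubmx v).
  by rewrite -{1}[v]vsubmxK /graph_pt opp_col_mx add_col_mx subrr.
have := @daddv_pi_add _ _ Fref (physE L) (v - graph_pt L (usubmx v)).
rewrite capvC h0 => /(_ erefl); rewrite (daddv_pi_id _ hF); last by rewrite capvC.
move=> /(_ (subvP (addvSl _ _) _ hF)) /eqP; rewrite -subr_eq0 addrAC subrr add0r.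
by move=> /eqP.
Qed.

(* [hits s n (h, q)] holds when the lattice vector (h, q) leads from the n-th
   point of the strip to another one, see [hitsP]. *)
Definition hits s n (hq : T * 'cV[int]_m) : bool :=
  [forall i, 0 <= orbit L (height L s) n i + (hq.2 i 0)%:~R - (L *m int_vec hq.1) i 0 < 1].

Lemma level_step s n h i : (level L s (n + h) - level L s n) i 0 =
  Num.floor (height L s i 0 - (L *m int_vec n) i 0) -
  Num.floor (height L s i 0 - (L *m int_vec n) i 0 - (L *m int_vec h) i 0).
Proof.
have lE k : level L s k i 0 = - Num.floor (height L s i 0 - (L *m int_vec k) i 0).
  by rewrite mxE.
rewrite mxE [X in _ + X]mxE !lE opprK addrC.
by rewrite int_vecD mulmxDr -[in RHS]addrA -opprD; congr (_ - Num.floor (_ - _)); rewrite mxE.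
Qed.

Lemma hitsP s n h q : hits s n (h, q) = (level L s (n + h) - level L s n == q).
Proof.
apply/forallP/eqP => [H|<- i].
  apply/matrixP => i j; rewrite ord1 level_step; apply/eqP.
  by rewrite floor_step; exact: H.
by rewrite /orbit /= -floor_step level_step.
Qed.

End Admissible.
End CpsPoints.

(** * Discrepancy of patch classes *)

Section ClassDiscrepancy.
Context {R : realType} {d m : nat}.
Local Notation V := 'cV[R]_(d + m).
Local Notation T := 'cV[int]_d.
Implicit Types (L : 'M[R]_(m, d)) (F : {vspace V}) (s y v : V) (n h : T).

Lemma finite_int_box p (c : R) : exists S : seq 'cV[int]_p,
  forall v : 'cV[int]_p, (forall i, `|(v i 0)%:~R| <= c) -> v \in S.
Proof.
have [k ck] : exists k : nat, c <= k%:R.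
  exists (absz (Num.ceil c)); have /andP[_ hc] := ceil_itv c.
  by apply: (le_trans hc); rewrite -[leRHS]/((absz (Num.ceil c))%:Z%:~R) ler_int abszE ler_norm.
pose fT := {ffun 'I_p -> 'I_(2 * k).+1}.
exists [seq \col_i ((f i : nat)%:Z - k%:Z) | f : fT <- enum {: fT}] => v hv.
have hk i : `|v i 0| <= k%:Z.
  by have := hv i; rewrite -intr_norm => /le_trans/(_ ck); rewrite -[k%:R]/(k%:Z%:~R) ler_int.
have lt i : (absz (v i 0 + k%:Z)%R < (2 * k).+1)%N by have := hk i; lia.
apply/mapP; exists [ffun i => Ordinal (lt i)]; first by rewrite mem_enum.
apply/matrixP => i j; rewrite ord1 mxE ffunE /=; have := hk i; lia.
Qed.

(** The end points of the intersection of [A, B) with [a, a + 1), clamped so that they remain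
    ordered and inside [A, B] when the intersection is empty. *)
Definition clip_lo (A B a : R) := Num.min B (Num.max A a).
Definition clip_hi (A B a : R) := Num.max (clip_lo A B a) (Num.min B (a + 1)).

Lemma clip_itv (A B a : R) : 0 <= A /\ A <= B <= 1 ->
  0 <= clip_lo A B a /\ clip_lo A B a <= clip_hi A B a <= 1.
Proof.
move=> [A0 /andP[AB B1]]; rewrite /clip_hi /clip_lo; split.
  by rewrite le_min (le_trans A0 AB) le_max A0.
by rewrite le_max lexx /= ge_max !ge_min B1.
Qed.

Lemma clipP (A B a x : R) : A <= B ->
  (clip_lo A B a <= x < clip_hi A B a) = (A <= x < B) && (a <= x < a + 1).
Proof.
move=> AB; rewrite /clip_hi lt_max; apply/idP/idP.
  move=> /andP[h1]; rewrite ltNge h1 /= lt_min => /andP[xB xa].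
  by move: h1; rewrite /clip_lo ge_min leNgt xB /= ge_max => /andP[-> ->].
move=> /andP[/andP[Ax xB] /andP[ax xa]]; rewrite [X in _ || X]lt_min xB xa orbT andbT.
by rewrite /clip_lo ge_min ge_max Ax ax orbT.
Qed.

(* The points of the box [a, b) whose translates by [c.1] stay in the strip
   exactly when [c.2] is true, for the conditions [c] of the list. *)
Definition cell_ind L s a b (Lam : seq ((T * 'cV[int]_m) * bool)) n : R :=
  box_ind a b (orbit L (height L s) n) * (all (fun c => hits L s n c.1 == c.2) Lam)%:R.

Definition hit_lo L (hq : T * 'cV[int]_m) (i : 'I_m) : R :=
  (L *m int_vec hq.1) i 0 - (hq.2 i 0)%:~R.

Lemma box_ind_clip L s n hq (a b : 'I_m -> R) : (forall i, a i <= b i) ->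
  box_ind (fun i => clip_lo (a i) (b i) (hit_lo L hq i))
          (fun i => clip_hi (a i) (b i) (hit_lo L hq i)) (orbit L (height L s) n) =
  box_ind a b (orbit L (height L s) n) * (hits L s n hq)%:R.
Proof.
move=> ab; rewrite !box_indP -natrM mulnb; congr (nat_of_bool _)%:R.
apply/forallP/andP => [H|[/forallP H1 /forallP H2] i].
  split; apply/forallP => i; have := H i; rewrite clipP // => /andP[// _].
  by rewrite /hit_lo => /andP[? ?]; apply/andP; split; lra.
rewrite clipP // H1 /=; have := H2 i; rewrite /hit_lo => /andP[? ?].
by apply/andP; split; lra.
Qed.

(** A condition to be met clips the box and costs nothing. A condition to be avoided is the
    difference of the cell without it and the cell where it is met, which doubles the constant. *)
Lemma cell_discrepancy L (K : R) :
  (forall u a b, (forall i, 0 <= a i /\ a i <= b i <= 1) -> forall N : {fset T},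
    `|\sum_(n <- N) (box_ind a b (orbit L u n) - box_vol a b)| <=
      K * (perimeter unit_vec N)%:R) ->
  forall s Lam (a b : 'I_m -> R), (forall i, 0 <= a i /\ a i <= b i <= 1) ->
  exists xi : R, forall N : {fset T},
    `|\sum_(n <- N) (cell_ind L s a b Lam n - xi)| <=
      2 ^+ (count (fun c => ~~ c.2) Lam) * K * (perimeter unit_vec N)%:R.
Proof.
move=> hK s; elim=> [|[hq t] Lam IH] a b hab.
  exists (box_vol a b) => N; rewrite expr0 mul1r.
  by under eq_bigr do rewrite /cell_ind mulr1; exact: hK.
have ab i : a i <= b i by have [_ /andP[]] := hab i.
have [xi1 h1] := IH _ _ (fun i => clip_itv (hit_lo L hq i) (hab i)).
have E n : cell_ind L s (fun i => clip_lo (a i) (b i) (hit_lo L hq i))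
    (fun i => clip_hi (a i) (b i) (hit_lo L hq i)) Lam n =
    cell_ind L s a b ((hq, true) :: Lam) n.
  rewrite /cell_ind box_ind_clip // -mulrA; congr (_ * _).
  by rewrite -natrM mulnb /= eqb_id.
case: t => /=.
  by exists xi1 => N; rewrite add0n; under eq_bigr do rewrite -E; exact: h1.
have [xi2 h2] := IH _ _ hab; exists (xi2 - xi1) => N.
have -> : \sum_(n <- N) (cell_ind L s a b ((hq, false) :: Lam) n - (xi2 - xi1)) =
    \sum_(n <- N) (cell_ind L s a b Lam n - xi2) -
    \sum_(n <- N) (cell_ind L s a b ((hq, true) :: Lam) n - xi1).
  rewrite -sumrB; apply: eq_bigr => n _; rewrite /cell_ind /= eqb_id eqbF_neg.
  case: (hits L s n hq) => /=; ring.
apply: (le_trans (ler_normB _ _)).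
rewrite add1n exprS -!mulrA [leRHS]mulr_natl mulr2n mulrA lerD //.
by under eq_bigr do rewrite -E; exact: h1.
Qed.

Section WithAdmissible.
Variables (L : 'M[R]_(m, d)) (F : {vspace V}).
Hypothesis adm : admissible L F.

Definition selected P h (q : 'cV[int]_m) : Prop :=
  [set pc_radius P *: w | w in pc_region P]
    (if pc_type P is TypeI then projE L F (lattice_pt h q) else graph_pt L (int_vec h)).

Definition step s n h : 'cV[int]_m := level L s (n + h) - level L s n.

Lemma patch_shapeP s P n z : regular L F s ->
  patch_shape L F s (pc_type P) (pc_radius P) (pc_region P) (cps_pt L F s n) z <->
  exists2 h, selected P h (step s n h) & z = projE L F (lattice_pt h (step s n h)).
Proof.
move=> reg; have hB h : cps_pt L F s (n + h) - cps_pt L F s n =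
    projE L F (lattice_pt h (step s n h)).
  by rewrite cps_ptB // addrC addKr.
have hR h : rho L (lift_pt L F s (cps_pt L F s (n + h)) - lift_pt L F s (cps_pt L F s n)) =
    graph_pt L (int_vec h).
  by rewrite !lift_cps_pt // rhoE strip_ptB [n + h]addrC addrK /lattice_pt col_mxKu.
split=> [[y' +  <-]|[h hs ->]].
  move=> hy'; have cy : cps L F s y' by case: (pc_type P) hy' => -[].
  have [n' yE] := (cpsP adm _ reg).1 cy.
  have yE' : y' = cps_pt L F s (n + (n' - n)) by rewrite addrC subrK.
  exists (n' - n); last by rewrite yE' hB.
  move: hy'; rewrite /selected -hB -yE'; case: (pc_type P) => /= -[_] //.
  by rewrite yE' hR.
exists (cps_pt L F s (n + h)); last exact: hB.
have cy : cps L F s (cps_pt L F s (n + h)) by apply/(cpsP adm _ reg); exists (n + h).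
move: hs; rewrite /selected; case: (pc_type P) => /= hs; split => //.
  by rewrite hB.
by rewrite hR.
Qed.

Lemma bounded_setP (A : set V) : bounded_set A -> exists2 M : R, 0 < M & forall v, A v -> `|v| <= M.
Proof.
move=> [M0 [_ hM]]; exists (Num.max 1 (M0 + 1)); first by rewrite lt_max ltr01.
by move=> v Av; apply: (hM (Num.max 1 (M0 + 1))) => //; rewrite lt_max ltrDl ltr01 orbT.
Qed.

Lemma norm_le_projE : exists2 c : R, 0 < c & forall v, (forall i, `|height L v i 0| <= 1) ->
  `|v| <= `|projE L F v| + c.
Proof.
have [c c0 hc] := linear_bounded (projF L F); exists c => // v hv.
rewrite -{1}(projED adm v); apply: (le_trans (ler_normD _ _)); rewrite lerD2l.
rewrite (projF_height adm (w := col_mx 0 (height L v))); last first.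
  by rewrite height_col_mx mulmx0 subr0.
apply: (le_trans (hc _)); rewrite -[leRHS]mulr1 ler_wpM2l ?(ltW c0) //.
apply: norm_le_coord => // i; rewrite mxE; case: splitP => k _; last exact: hv.
by rewrite mxE normr0.
Qed.

(** The bounded region controls the projection to E for type I and h for type II; the height of a
    difference of two strip points is at most 1, which controls the rest. The list is independent of
    s, as the constants must be. *)
Lemma selected_finite P : bounded_set (pc_region P) -> exists S : seq (T * 'cV[int]_m),
  forall h q, selected P h q -> (forall i, `|height L (lattice_pt h q) i 0| <= 1) ->
  (h, q) \in S.
Proof.
move=> /bounded_setP[M M0 hM]; have [c c0 hc] := norm_le_projE.
have [cL cL0 hL] := linear_bounded (mulmx L : {linear 'cV[R]_d -> 'cV[R]_m}).
set rr := `|pc_radius P| * M; have rr0 : 0 <= rr by rewrite mulr_ge0 // ltW.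
pose B := rr + c + (cL * rr + 1).
have B1 : rr + c <= B by rewrite lerDl addr_ge0 // mulr_ge0 // ltW.
have [Sh hSh] := finite_int_box d B; have [Sq hSq] := finite_int_box m B.
exists [seq (h, q) | h <- Sh, q <- Sq] => h q hs hv.
have bnd v : [set pc_radius P *: w | w in pc_region P] v -> `|v| <= rr.
  by move=> [w Aw <-]; rewrite normrZ ler_wpM2l // hM.
suff [b1 b2] : (forall i, `|(h i 0)%:~R| <= B) /\ (forall i, `|(q i 0)%:~R| <= B).
  by apply: allpairs_f; [exact: hSh | exact: hSq].
move: hs; rewrite /selected; case: (pc_type P) => /bnd hs.
  have vb : `|lattice_pt h q| <= rr + c.
    by apply: (le_trans (hc _ hv)); rewrite lerD2r.
  split=> i.
    have := le_trans (coord_le_norm (lattice_pt h q) (lshift m i)) vb.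
    by rewrite col_mxEu mxE => /le_trans; apply.
  have := le_trans (coord_le_norm (lattice_pt h q) (rshift d i)) vb.
  by rewrite col_mxEd mxE => /le_trans; apply.
have hb i : `|(h i 0)%:~R| <= rr.
  have := le_trans (coord_le_norm (graph_pt L (int_vec h)) (lshift m i)) hs.
  by rewrite col_mxEu mxE.
split=> i; first by apply: (le_trans (hb i)); rewrite /B -addrA lerDl !addr_ge0 ?mulr_ge0 // ltW.
have := hv i; rewrite height_lattice_pt => h1.
have h2 : `|(L *m int_vec h) i 0| <= cL * rr.
  apply: (le_trans (coord_le_norm _ _)); apply: (le_trans (hL _)).
  rewrite ler_wpM2l ?(ltW cL0) //; apply: norm_le_coord => // k; rewrite mxE; exact: hb.
have := ler_normD ((q i 0)%:~R - (L *m int_vec h) i 0) ((L *m int_vec h) i 0).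
by rewrite subrK /B; lra.
Qed.

Lemma height_step s n h i :
  `|height L (lattice_pt h (step s n h)) i 0| <= 1.
Proof.
have : hits L s n (h, step s n h) by rewrite hitsP.
move=> /forallP/(_ i)/=; have /andP[? ?] := orbit_itv L (height L s) n i.
by rewrite height_lattice_pt => /andP[? ?]; rewrite ler_norml; apply/andP; split; lra.
Qed.

(* For type II the vectors h of a patch are known beforehand, so that a class
   only prescribes the levels reached and is a single box; for type I it also
   forbids the vectors of [S] missing from the shape, at most [size S] of them
   whatever s is. *)
Lemma in_classP P : bounded_set (pc_region P) -> exists r : nat,
  (pc_type P = TypeII -> r = 0%N) /\
  forall s, regular L F s -> is_patch_class L F s P ->
  exists Lam : seq ((T * 'cV[int]_m) * bool), (count (fun c => ~~ c.2) Lam <= r)%N /\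
  forall n, in_class L F s P (cps_pt L F s n) <-> all (fun c => hits L s n c.1 == c.2) Lam.
Proof.
move=> /selected_finite[S hS].
exists (if pc_type P is TypeI then size S else 0%N); split; first by move=> ->.
move=> s reg [_ _ [y0 cy0 hy0]].
have [n0 y0E] := (cpsP adm _ reg).1 cy0; rewrite {}y0E in cy0 hy0.
have shape z : pc_shape P z <->
    exists2 h, selected P h (step s n0 h) & z = projE L F (lattice_pt h (step s n0 h)).
  by rewrite -hy0; apply: patch_shapeP.
have inS n h : selected P h (step s n h) -> (h, step s n h) \in S.
  by move=> /hS; apply => i; exact: height_step.
have inj h q h' q' : projE L F (lattice_pt h q) = projE L F (lattice_pt h' q') -> h = h' /\ q = q'.
  by move=> /(projE_lattice_inj adm (Zlattice_lattice_pt _ _) (Zlattice_lattice_pt _ _))/lattice_pt_inj.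
case tP : (pc_type P).
  pose S' := [seq hq <- S | `[< selected P hq.1 hq.2 >]].
  exists [seq (hq, `[< pc_shape P (projE L F (lattice_pt hq.1 hq.2)) >]) | hq <- S'].
  split.
    rewrite count_map; apply: (leq_trans (count_size _ _)).
    by rewrite size_filter count_size.
  move=> n; rewrite all_map; split=> [hn|/allP hn].
    apply/allP => -[h q]; rewrite mem_filter => /andP[/asboolP /= hsel _].
    rewrite hitsP -/(step s n h); apply/eqP; apply/idP/asboolP => [/eqP hE|].
      by rewrite -hn; apply/(patch_shapeP _ _ _ reg); exists h; rewrite ?hE.
    rewrite -hn => /(patch_shapeP _ _ _ reg)[h' _ /inj[e1 e2]].
    by rewrite e2 e1.
  apply/seteqP; split => z; rewrite ?patch_shapeP //.
    move=> [h hsel ->]; have := hn (h, step s n h).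
    rewrite mem_filter /= asboolT // inS // => /(_ isT).
    by rewrite hitsP eqxx eq_sym => /eqP/asboolP.
  move=> hz; have /shape[h hsel zE] := hz.
  have := hn (h, step s n0 h); rewrite mem_filter /= asboolT // inS // => /(_ isT).
  rewrite hitsP (asboolT (P := pc_shape P _)) -?zE // => /eqP/eqP hE.
  by exists h; rewrite /step hE.
(* The level 0 is a placeholder: for type II, selection depends on h only, see [selE]. *)
pose S' := [seq hq.1 | hq <- S & `[< selected P hq.1 0 >]].
have selE h q q' : selected P h q -> selected P h q' by rewrite /selected tP.
exists [seq ((h, step s n0 h), true) | h <- S']; split.
  by rewrite count_map /= count_pred0.
have memS' n h q : selected P h q -> h \in S'.
  move=> hsel; apply/mapP; exists (h, step s n h) => //.
  by rewrite mem_filter; apply/andP; split; [apply/asboolP | apply: inS]; exact: selE hsel.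
move=> n; rewrite all_map; split=> [hn|/allP hn].
  apply/allP => h /mapP[[h' q]]; rewrite mem_filter => /andP[/asboolP /= hsel _] ->.
  rewrite hitsP -/(step s n h') eqb_id.
  have : pc_shape P (projE L F (lattice_pt h' (step s n0 h'))).
    by apply/shape; exists h' => //; apply: selE hsel.
  by rewrite -hn => /(patch_shapeP _ _ _ reg)[h2 _ /inj[<- ->]].
have key h q : selected P h q -> step s n h = step s n0 h.
  by move=> hsel; have /= := hn h (memS' n0 _ _ hsel); rewrite hitsP eqb_id => /eqP.
apply/seteqP; split => z.
  move=> /(patch_shapeP _ _ _ reg)[h hsel ->]; apply/shape; exists h; first exact: selE hsel.
  by rewrite (key _ _ hsel).
move=> /shape[h hsel ->]; apply/(patch_shapeP _ _ _ reg); exists h; first exact: selE hsel.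
by rewrite (key _ _ hsel).
Qed.

(** C is fixed before s: the exponent [r P] bounds the number of forbidden vectors uniformly in s.
    Exponent 0 on type II makes C constant there, and K + 1 makes it positive. *)
Lemma class_discrepancy : nonresonant L ->
  exists C : patch_class R d m -> R, [/\ uniform_on_typeII C, forall P, 0 < C P &
  forall s, regular L F s -> forall P, is_patch_class L F s P ->
  exists xi : R, forall N : {fset T},
    `|\sum_(n <- N) (`[< in_class L F s P (cps_pt L F s n) >]%:R - xi)| <=
      C P * (perimeter unit_vec N)%:R].
Proof.
move=> /box_discrepancy[K K0 hK].
have /choice[r hr] : forall P : patch_class R d m, exists r : nat, bounded_set (pc_region P) ->
  (pc_type P = TypeII -> r = 0%N) /\
  forall s, regular L F s -> is_patch_class L F s P ->
  exists Lam : seq ((T * 'cV[int]_m) * bool), (count (fun c => ~~ c.2) Lam <= r)%N /\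
  forall n, in_class L F s P (cps_pt L F s n) <-> all (fun c => hits L s n c.1 == c.2) Lam.
  move=> P; have [/in_classP[r hr]|nb] := pselect (bounded_set (pc_region P)).
    by exists r.
  by exists 0%N.
exists (fun P => 2 ^+ (if pc_type P is TypeII then 0 else r P) * (K + 1)); split.
- by move=> P P' -> ->.
- by move=> P; rewrite mulr_gt0 ?exprn_gt0 // ltr_wpDl.
move=> s reg P hP; have [[_ _ bP _] _ _] := hP.
have [r0 /(_ s reg hP)[Lam [cnt hLam]]] := hr P bP.
have [] := @cell_discrepancy L K hK s Lam (fun=> 0) (fun=> 1).
  by move=> i; rewrite !lexx ler01.
move=> xi hxi; exists xi => N; have := hxi N.
have E n : cell_ind L s (fun=> 0) (fun=> 1) Lam n = `[< in_class L F s P (cps_pt L F s n) >]%:R.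
  rewrite /cell_ind box_indP (_ : [forall i, _]) ?mul1r; last by apply/forallP => i; exact: orbit_itv.
  by congr (nat_of_bool _)%:R; apply/idP/asboolP => /hLam.
under eq_bigr do rewrite E.
move=> /le_trans; apply; rewrite ler_wpM2r // ler_pM ?exprn_ge0 ?lerDl //.
rewrite ler_weXn2l ?ler1n //; apply: (leq_trans cnt).
by case: (pc_type P) r0 => // ->.
Qed.

End WithAdmissible.
End ClassDiscrepancy.

(** * Empirical and limit frequencies *)

Section Frequencies.
Context {R : realType} {d m : nat}.
Local Notation V := 'cV[R]_(d + m).
Local Notation T := 'cV[int]_d.
Implicit Types (s y v : V) (n h : T) (N : {fset T}).

Lemma card_of_image (f : T -> V) N (Q : T -> Prop) (X : set V) : injective f ->
  (forall y, X y <-> exists n, [/\ n \in N, Q n & y = f n]) ->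
  card_of X = \sum_(n <- N) `[< Q n >]%:R :> R.
Proof.
move=> inj hX; pose NQ := [fset n in N | `[< Q n >]]%fset.
have XE : X = [set` (f @` NQ)%fset].
  apply/seteqP; split => y /=.
    move=> /hX[n [nN Qn ->]]; apply/imfsetP; exists n => //=.
    by rewrite !inE /= nN; apply/asboolP.
  move=> /imfsetP[n /=]; rewrite !inE => /andP[nN /asboolP Qn] ->.
  by apply/hX; exists n.
rewrite /card_of XE set_fsetK card_imfset //= card_fset_sum1 natr_sum.
rewrite /NQ big_fset /= big_mkcond; apply: eq_bigr => n _.
by case: asboolP.
Qed.

Lemma ratio_dist_le N (Q : T -> Prop) (xi B : R) : (0 < #|` N|)%N ->
  `|\sum_(n <- N) (`[< Q n >]%:R - xi)| <= B ->
  `|(\sum_(n <- N) `[< Q n >]%:R) / (\sum_(n <- N) `[< True >]%:R) - xi| <= B / #|` N|%:R.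
Proof.
move=> N0 h; have NR : 0 < #|` N|%:R :> R by rewrite ltr0n.
have -> : \sum_(n <- N) `[< True >]%:R = #|` N|%:R :> R.
  rewrite card_fset_sum1 natr_sum; apply: eq_bigr => n _.
  by rewrite asboolT.
have -> : (\sum_(n <- N) `[< Q n >]%:R) / #|` N|%:R - xi =
    (\sum_(n <- N) (`[< Q n >]%:R - xi)) / #|` N|%:R.
  rewrite sumrB big_const_seq count_predT iter_addr_0 mulrBl -[xi *+ _]mulr_natr mulfK //.
  by rewrite gt_eqF.
by rewrite normrM [X in _ * X]gtr0_norm ?invr_gt0 // ler_pM2r ?invr_gt0.
Qed.

Definition box_point n0 (k : nat) (f : {ffun 'I_d -> 'I_(2 * k).+1}) : T :=
  \col_i (n0 i 0 + (f i : nat)%:Z - k%:Z).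

Definition idx_box n0 k : {fset T} :=
  [fset box_point n0 f | f in {ffun 'I_d -> 'I_(2 * k).+1}]%fset.

Lemma box_point_inj n0 k : injective (@box_point n0 k).
Proof.
move=> f f' /matrixP e; apply/ffunP => i; apply: val_inj; have := e i 0.
by rewrite !mxE => /addIr/addrI[].
Qed.

Lemma mem_idx_box n0 k n : (n \in idx_box n0 k) = [forall i, `|n i 0 - n0 i 0| <= k%:Z].
Proof.
apply/imfsetP/forallP => [[f _ ->] i|H].
  rewrite mxE; have := ltn_ord (f i); move: (n0 i 0) (nat_of_ord (f i)) => z a ?.
  by rewrite ler_norml; apply/andP; split; lia.
have lt i : (absz (n i 0 - n0 i 0 + k%:Z)%R < (2 * k).+1)%N by have := H i; lia.
exists [ffun i => Ordinal (lt i)] => //.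
by apply/matrixP => i j; rewrite ord1 mxE ffunE /=; have := H i; lia.
Qed.

Lemma sum_idx_box (W : nmodType) n0 k (G : T -> W) :
  \sum_(n <- idx_box n0 k) G n = \sum_(f : {ffun 'I_d -> 'I_(2 * k).+1}) G (box_point n0 f).
Proof.
by rewrite big_imfset /=; [rewrite big_enum | move=> f f' _ _; exact: box_point_inj].
Qed.

Lemma card_idx_box n0 k : #|` idx_box n0 k| = ((2 * k).+1 ^ d)%N.
Proof. by rewrite card_fset_sum1 sum_idx_box sum1_card card_ffun !card_ord. Qed.

Lemma card_face_le k (i : 'I_d) (c : 'I_(2 * k).+1) :
  #|[pred f : {ffun 'I_d -> 'I_(2 * k).+1} | f i == c]|%:R <=
    ((2 * k).+1)%:R^-1 * ((2 * k).+1)%:R ^+ d :> R.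
Proof.
apply: (@card_slice_le _ _ _ i) => // f; rewrite mulVf ?pnatr_eq0 //.
rewrite -[leRHS]/(1%:R) ler_nat; apply: (leq_trans _ (eq_leq (card1 c))); apply: subset_leq_card.
by apply/fintype.subsetP => a; rewrite !inE /= ffunE eqxx.
Qed.

(** An edge leaving the cube in direction i starts on one of the two faces orthogonal to it, each a
    fraction 1/(2k + 1) of the cube. *)
Lemma edge_idx_box_le n0 k (i : 'I_d) :
  (edge_bd (unit_vec i) (idx_box n0 k))%:R <= 2 * (((2 * k).+1)%:R^-1 * ((2 * k).+1)%:R ^+ d) :> R.
Proof.
rewrite /edge_bd big_split /= natrD mulr_natl mulr2n; apply: lerD.
  apply: le_trans (card_face_le i ord_max); rewrite ler_nat sum_idx_box -sum1_card.
  rewrite [leqRHS]big_mkcond /=; apply: leq_sum => f _; rewrite inE.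
  case: eqP => [|/eqP fi]; first by case: (_ \in _).
  rewrite mem_idx_box (_ : [forall j, _] = true) //; apply/forallP => j.
  have h := ltn_ord (f j); rewrite !mxE; case: eqP => [->|_] /=; last by lia.
  have : (f i < 2 * k)%N by rewrite ltn_neqAle -ltnS ltn_ord andbT.
  by rewrite ler_norml => ?; apply/andP; split; lia.
apply: le_trans (card_face_le i ord0); rewrite ler_nat sum_idx_box -sum1_card.
rewrite [leqRHS]big_mkcond /=; apply: leq_sum => f _; rewrite inE.
case: eqP => [|/eqP fi]; first by case: (_ \in _).
rewrite mem_idx_box (_ : [forall j, _] = true) //; apply/forallP => j.
have h := ltn_ord (f j); rewrite !mxE; case: eqP => [->|_] /=; last by lia.
have : (0 < f i)%N by rewrite lt0n.
have := ltn_ord (f i).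
by rewrite ler_norml => ? ?; apply/andP; split; lia.
Qed.

Lemma perimeter_idx_box_le n0 k :
  (perimeter unit_vec (idx_box n0 k))%:R <=
    (2 * d)%:R / ((2 * k).+1)%:R * #|` idx_box n0 k|%:R :> R.
Proof.
rewrite /perimeter natr_sum (le_trans (ler_sum _ (fun i _ => edge_idx_box_le n0 k i))) //.
rewrite sumr_const card_ord card_idx_box natrX -[leLHS]mulr_natl natrM le_eqVlt.
by apply/orP; left; apply/eqP; ring.
Qed.

Section WithAdmissible.
Variables (L : 'M[R]_(m, d)) (F : {vspace V}).
Hypothesis adm : admissible L F.

Lemma emp_freq_le s y (A : set V) P N (xi B : R) : regular L F s ->
  (forall n, n \in N <-> [set a + y | a in A] (cps_pt L F s n)) -> (0 < #|` N|)%N ->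
  `|\sum_(n <- N) (`[< in_class L F s P (cps_pt L F s n) >]%:R - xi)| <= B ->
  `|emp_freq L F s P y A - xi| <= B / #|` N|%:R.
Proof.
move=> reg hN N0 /(ratio_dist_le N0); rewrite /emp_freq.
rewrite (@card_of_image (cps_pt L F s) N (fun n => in_class L F s P (cps_pt L F s n))).
- rewrite (@card_of_image (cps_pt L F s) N (fun=> True)) //; first exact: cps_pt_inj.
  move=> z; split=> [[/(cpsP adm _ reg)[n ->] /hN ?]|[n [/hN ? _ ->]]]; first by exists n.
  by split => //; apply/(cpsP adm _ reg); exists n.
- exact: cps_pt_inj.
move=> z; split=> [[/(cpsP adm _ reg)[n ->] ? /hN ?]|[n [/hN ? ? ->]]]; first by exists n.
by split => //; apply/(cpsP adm _ reg); exists n.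
Qed.

Lemma Cbox_lift s n0 n (t : R) : 0 <= t ->
  Cbox t (lift_pt L F s (cps_pt L F s n) - lift_pt L F s (cps_pt L F s n0)) <->
  n \in idx_box n0 (Num.truncn t).
Proof.
move=> t0; rewrite !lift_cps_pt // strip_ptB /Cbox mem_idx_box.
have key (z : int) : (- t <= z%:~R <= t) = (`|z| <= (Num.truncn t)%:Z).
  rewrite -ler_norml -intr_norm -abszE lez_nat truncn_ge_nat //.
split=> [[_ /= H]|/forallP H].
  by apply/forallP => i; have := H i; rewrite col_mxKu !mxE key.
split; first exact: Zlattice_lattice_pt.
by move=> i /=; rewrite col_mxKu !mxE key; exact: H.
Qed.

(** [Cbox t] amounts to a cube of indices, whose perimeter is O(1/t) times its cardinality. So the
    ratios do converge, and to the same [xi] from every base point. *)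
Lemma freq_eq s P n0 (xi C : R) : regular L F s -> 0 <= C ->
  (forall N, `|\sum_(n <- N) (`[< in_class L F s P (cps_pt L F s n) >]%:R - xi)| <=
    C * (perimeter unit_vec N)%:R) ->
  freq L F s P (cps_pt L F s n0) = xi.
Proof.
move=> reg C0 hxi; apply/cvg_lim => //; apply/cvgrPdist_le => eps eps0.
have ratio t : 0 <= t -> `|freq_ratio L F s P (cps_pt L F s n0) t - xi| <=
    C * (2 * d)%:R / ((2 * Num.truncn t).+1)%:R.
  move=> t0; set N := idx_box n0 (Num.truncn t).
  have N0 : (0 < #|` N|)%N by rewrite card_idx_box expn_gt0.
  have NR : 0 < #|` N|%:R :> R by rewrite ltr0n.
  have := ratio_dist_le N0 (hxi N); rewrite /freq_ratio.
  rewrite (@card_of_image (cps_pt L F s) N (fun n => in_class L F s P (cps_pt L F s n))).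
  - rewrite (@card_of_image (cps_pt L F s) N (fun=> True)).
    + move=> /le_trans; apply; rewrite ler_pdivrMr // -!mulrA ler_wpM2l // mulrA.
      exact: perimeter_idx_box_le.
    + exact: cps_pt_inj.
    move=> z; split=> [[/(cpsP adm _ reg)[n ->] /(Cbox_lift _ _ _ t0) ?]|[n [h _ ->]]].
      by exists n.
    by split; [apply/(cpsP adm _ reg); exists n | apply/(Cbox_lift _ _ _ t0)].
  - exact: cps_pt_inj.
  move=> z; split=> [[/(cpsP adm _ reg)[n ->] ? /(Cbox_lift _ _ _ t0) ?]|[n [h ? ->]]].
    by exists n.
  by split; [apply/(cpsP adm _ reg); exists n | | apply/(Cbox_lift _ _ _ t0)].
exists (C * (2 * d)%:R / eps); split; first exact: num_real.
move=> t ht; have t0 : 0 <= t.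
  by apply: le_trans (ltW ht); rewrite divr_ge0 ?(ltW eps0) // mulr_ge0.
rewrite distrC; apply: (le_trans (ratio t t0)).
rewrite ler_pdivrMr ?ltr0n // [leRHS]mulrC -ler_pdivrMr //; apply: (le_trans (ltW ht)).
have /andP[_ /ltW h] := truncn_itv t0; apply: (le_trans h).
by rewrite ler_nat ltnS leq_pmull.
Qed.

End WithAdmissible.
End Frequencies.

(** * Regions, their boundaries and their cores *)

Section Geometry.
Context {R : realType} {d m : nat}.
Local Notation V := 'cV[R]_(d + m).
Local Notation T := 'cV[int]_d.
Implicit Types (L : 'M[R]_(m, d)) (F : {vspace V}) (s y v w : V) (n h : T) (A : set V).

Lemma closure_normP (X : set V) v :
  closure X v <-> forall e : R, 0 < e -> exists2 w, X w & `|v - w| < e.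
Proof.
split=> [cv e e0|H B /nbhs_ballP[e /= e0 eB]].
  have [w [Xw bw]] := cv (ball v e) (nbhsx_ballx v e e0).
  by exists w => //; move: bw; rewrite -ball_normE.
have [w Xw vw] := H e e0; exists w; split => //; apply: eB.
by rewrite -ball_normE.
Qed.

Lemma edist_le v w (c : R) : `|v - w| <= c -> Defs.edist v w <= (d + m)%:R * c.
Proof.
move=> h; have c0 : 0 <= c by apply: le_trans h.
have k0 : 0 <= (d + m)%:R * c by rewrite mulr_ge0.
rewrite /Defs.edist -[leRHS]ger0_norm // -sqrtr_sqr ler_wsqrtr // exprMn.
apply: (@le_trans _ _ (\sum_(i < d + m) c ^+ 2)).
  apply: ler_sum => i _; rewrite -[leLHS]real_normK ?num_real // lerXn2r ?nnegrE //.
  by apply: le_trans h; have := coord_le_norm (v - w) i; rewrite !mxE.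
rewrite sumr_const card_ord -[leLHS]mulr_natl ler_wpM2r ?sqr_ge0 //.
by rewrite -natrX ler_nat; case: (d + m)%N => // k; rewrite leq_pmulr.
Qed.

(** The boundary point sits at the supremum of the parameters for which the segment from a to b is
    in A. *)
Lemma segment_meets_bdE L A a b : A `<=` Eset L -> A a -> Eset L b -> ~ A b ->
  exists2 z, bdE L A z & `|z - a| <= `|b - a|.
Proof.
move=> AE Aa Eb Ab; have Ea := AE a Aa.
pose p (t : R) := a + t *: (b - a).
have pE t : Eset L (p t) by apply: EsetD => //; apply: EsetZ; exact: EsetB.
have pB t t' : `|p t - p t'| = `|t - t'| * `|b - a|.
  by rewrite /p opprD addrACA subrr add0r -scalerBl normrZ.
pose S := [set t : R | 0 <= t <= 1 /\ A (p t)].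
have p0 : p 0 = a by rewrite /p scale0r addr0.
have p1 : p 1 = b by rewrite /p scale1r addrC subrK.
have S0 : S 0 by split; rewrite ?lexx ?ler01 // p0.
have ubS : ubound S 1 by move=> t [/andP[]].
have hS : has_sup S by split; [exists 0 | exists 1].
set tau := sup S.
have tau0 : 0 <= tau by apply: ub_le_sup => //; exists 1.
have tau1 : tau <= 1 by apply: ge_sup => //; exists 0.
have D0 : 0 < `|b - a| + 1 by rewrite ltr_wpDl.
exists (p tau); last first.
  rewrite -{1}p0 pB subr0 ger0_norm // -[leRHS]mul1r ler_wpM2r //.
split; apply/closure_normP => e e0.
  have ed : 0 < e / (`|b - a| + 1) by rewrite divr_gt0.
  have [t [t01 At] ht] := sup_adherent ed hS.
  exists (p t) => //; rewrite pB ger0_norm; last first.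
    by rewrite subr_ge0; apply: ub_le_sup => //; exists 1.
  have : tau - t < e / (`|b - a| + 1) by rewrite -/tau in ht; lra.
  rewrite ltr_pdivlMr // => h; apply: le_lt_trans h; rewrite ler_wpM2l ?lerDl //.
  by rewrite subr_ge0; apply: ub_le_sup => //; exists 1.
have [tau_1|tau_1] := eqVneq tau 1.
  by exists b; [split | rewrite tau_1 p1 subrr normr0].
have tau_lt : tau < 1 by rewrite lt_neqAle tau_1.
pose t := Num.min 1 (tau + e / (`|b - a| + 1) / 2).
have ed : 0 < e / (`|b - a| + 1) by rewrite divr_gt0.
have tt : tau < t by rewrite lt_min tau_lt /= ltrDl; lra.
have t1 : t <= 1 by rewrite ge_min lexx.
exists (p t).
  split => // At; have : t <= tau by apply: ub_le_sup; [exists 1 | split => //; apply/andP; split; lra].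
  by rewrite leNgt tt.
rewrite pB distrC gtr0_norm ?subr_gt0 //.
have : t - tau < e / (`|b - a| + 1).
  have : t <= tau + e / (`|b - a| + 1) / 2 by rewrite ge_min lexx orbT.
  by lra.
rewrite ltr_pdivlMr // => h; apply: le_lt_trans h; rewrite ler_wpM2l ?lerDl //.
by rewrite subr_ge0 ltW.
Qed.

(** E is the range of pi, so pi determines L, and constants that depend on L and pi depend on pi
    only. *)
Lemma projE_inj_map L L' F F' : admissible L F -> admissible L' F' ->
  projE L F = projE L' F' -> L = L'.
Proof.
move=> adm adm' e.
have H (x : 'cV[R]_d) : L *m x = L' *m x.
  have h : graph_pt L x = projE L' F' (graph_pt L x).
    by rewrite -e projE_id //; exact: Eset_graph.
  have : Eset L' (graph_pt L x) by rewrite h; exact: Eset_projE.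
  by move=> /EsetP; rewrite /graph_pt col_mxKu => /eq_col_mx[].
apply/matrixP => i j; have /matrixP/(_ i 0) := H (delta_mx j 0).
by rewrite -!colE !mxE.
Qed.

(** The first d coordinates of [strip_pt L s n]. By [cps_pt_near], Y is a bounded perturbation of
    the image in E of this translate of the integer lattice. *)
Definition anchor s n : 'cV[R]_d := int_vec n + usubmx s.

Lemma anchorB s n n' : anchor s n - anchor s n' = int_vec (n - n').
Proof. by rewrite /anchor opprD addrACA subrr addr0 /int_vec map_mxB. Qed.

Section Constants.
Variables (L : 'M[R]_(m, d)) (F : {vspace V}) (c cg : R).
Hypotheses (adm : admissible L F) (c0 : 0 < c) (cg0 : 0 < cg).
Hypothesis hc : forall v, `|projE L F v| <= c * `|v|.
Hypothesis hcg : forall x, `|graph_pt L x| <= cg * `|x|.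

Lemma cps_pt_near s n : `|cps_pt L F s n - graph_pt L (anchor s n)| <= c.
Proof.
have -> : cps_pt L F s n - graph_pt L (anchor s n) =
    projE L F (strip_pt L s n - graph_pt L (anchor s n)).
  by rewrite linearB /= (projE_id adm (Eset_graph _ _)).
apply: (le_trans (hc _)); rewrite -[leRHS]mulr1 ler_wpM2l ?(ltW c0) //.
have -> : strip_pt L s n - graph_pt L (anchor s n) = col_mx 0 (height L (strip_pt L s n)).
  have us : usubmx (strip_pt L s n) = anchor s n.
    by rewrite /strip_pt /lattice_pt linearD /= col_mxKu addrC.
  by rewrite -{1}[strip_pt L s n]vsubmxK /graph_pt us opp_col_mx add_col_mx subrr /height us.
apply: norm_le_coord => // i; rewrite mxE; case: splitP => k _; first by rewrite mxE normr0.
rewrite height_strip_pt; have /andP[h0 h1] := orbit_itv L (height L s) n k.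
by rewrite ger0_norm // ltW.
Qed.

Lemma cps_pt_step s n n' : (forall i, `|(n i 0)%:~R - (n' i 0)%:~R| <= 1 :> R) ->
  `|cps_pt L F s n - cps_pt L F s n'| <= 2 * c + cg.
Proof.
move=> hn; have h1 := cps_pt_near s n; have h2 := cps_pt_near s n'.
have h3 : `|graph_pt L (anchor s n) - graph_pt L (anchor s n')| <= cg.
  rewrite -graph_ptB anchorB; apply: (le_trans (hcg _)).
  rewrite -[leRHS]mulr1 ler_wpM2l ?(ltW cg0) //; apply: norm_le_coord => // i.
  by rewrite !mxE intrB; exact: hn.
have -> : cps_pt L F s n - cps_pt L F s n' =
  (cps_pt L F s n - graph_pt L (anchor s n)) +
  (graph_pt L (anchor s n) - graph_pt L (anchor s n')) -
  (cps_pt L F s n' - graph_pt L (anchor s n')).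
  by rewrite addrA subrK opprB addrA subrK.
apply: (le_trans (ler_normB _ _)); rewrite (_ : 2 * c + cg = c + cg + c); last by ring.
by rewrite lerD // (le_trans (ler_normD _ _)) // lerD.
Qed.

Lemma finite_region_idx s (X : set V) : bounded_set X ->
  exists N : {fset T}, forall n, n \in N <-> X (cps_pt L F s n).
Proof.
move=> /bounded_setP[M M0 hM]; pose B := M + c + `|usubmx s|.
have [S hS] := finite_int_box d B.
exists [fset n in S | `[< X (cps_pt L F s n) >]]%fset => n.
rewrite !inE /=; split=> [/andP[_ /asboolP]//|Xn]; rewrite (asboolT Xn) andbT.
apply: hS => i; have h1 := cps_pt_near s n; have h2 := hM _ Xn.
have h3 : `|graph_pt L (anchor s n)| <= M + c.
  have := ler_normB (cps_pt L F s n) (cps_pt L F s n - graph_pt L (anchor s n)).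
  by rewrite opprB addrC subrK => /le_trans; apply; rewrite lerD.
have h4 : `|anchor s n i 0| <= M + c.
  apply: le_trans h3; have := coord_le_norm (graph_pt L (anchor s n)) (lshift m i).
  by rewrite col_mxEu.
have h5 := coord_le_norm (usubmx s) i.
have -> : (n i 0)%:~R = anchor s n i 0 - usubmx s i 0 by rewrite !mxE addrK.
by apply: (le_trans (ler_normB _ _)); apply: lerD.
Qed.

(** 3c + 2cg is the way from a point of a small cell to the boundary: cg to the cell centre, c to
    the point of Y, 2c + cg along one step to a neighbour outside. The 1 absorbs the closure in the
    definition of the core, and d + m passes from the sup norm to the Euclidean one. *)
Definition kappa_bound : R := (d + m)%:R * (3 * c + 2 * cg + 1).

Section Region.
Variables (s y : V) (A : set V) (N : {fset T}).
Hypotheses (hd : (0 < d)%N) (Ey : Eset L y) (AE : A `<=` Eset L).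
Hypothesis hN : forall n, n \in N <-> A (cps_pt L F s n - y).

Definition cell_center n : 'cV[R]_d := anchor s n - usubmx y.

Lemma cell_center_near n :
  `|cps_pt L F s n - y - graph_pt L (cell_center n)| <= c.
Proof.
have -> : cps_pt L F s n - y - graph_pt L (cell_center n) =
    cps_pt L F s n - graph_pt L (anchor s n).
  by rewrite /cell_center graph_ptB -((EsetP L y).1 Ey) opprB addrA subrK.
exact: cps_pt_near.
Qed.

(** If n is in N and its neighbour g n is not, the segment between their points crosses the boundary
    of A, so the cube of side 1/2 at the centre of n lies in the thickened boundary. The centres
    form a translate of part of the integer lattice, so these cubes are disjoint. *)
Lemma edge_le_volE (S : seq T) (g : T -> T) : uniq S ->
  (forall n, n \in S -> n \in N /\ g n \notin N) ->
  (forall n i, `|((g n) i 0)%:~R - (n i 0)%:~R| <= 1 :> R) ->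
  (((size S)%:R * (2 * (1 / 4)) ^+ d)%:E <= volE L (thicken L kappa_bound (bdE L A)))%E.
Proof.
move=> uS hS hg; have r0 : (0 : R) <= 1 / 4 by lra.
apply: (lebesgue_mx_ge_cubes (c := cell_center) uS r0).
  move=> n n' x _ _ h1 h2; apply/matrixP => i j; rewrite ord1; apply/eqP.
  have := h1 i; have := h2 i; rewrite -[n i 0 == _]subr_eq0.
  have -> : cell_center n i 0 = (n i 0 - n' i 0)%:~R + cell_center n' i 0.
    by rewrite !mxE intrB; ring.
  rewrite !ler_norml => /andP[? ?] /andP[? ?].
  have h3 : `|(n i 0 - n' i 0)%:~R| < 1%:~R :> R by rewrite ltr_norml; apply/andP; split; lra.
  by move: h3; rewrite -intr_norm ltr_int; move: (n i 0 - n' i 0) => z; lia.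
move=> n x /hS[nN gN] hx; split; first exact: Eset_graph.
have An := (hN n).1 nN; have nA : ~ A (cps_pt L F s (g n) - y) by move=> /hN; apply/negP.
have Eb k : Eset L (cps_pt L F s k - y) by apply: EsetB => //; exact: Eset_projE.
have [z bz hz] := segment_meets_bdE AE An (Eb _) nA.
exists z => //; apply: edist_le.
have h1 : `|graph_pt L x - graph_pt L (cell_center n)| <= cg.
  rewrite -graph_ptB; apply: (le_trans (hcg _)); rewrite -[leRHS]mulr1 ler_wpM2l ?(ltW cg0) //.
  apply: norm_le_coord => // i; rewrite [X in `|X|]mxE [X in _ + X]mxE.
  by apply: (le_trans (hx i)); lra.
have h2 := cell_center_near n.
have h3 : `|z - (cps_pt L F s n - y)| <= 2 * c + cg.
  apply: (le_trans hz); rewrite opprB addrA subrK; exact: cps_pt_step.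
have -> : graph_pt L x - z = (graph_pt L x - graph_pt L (cell_center n)) -
   (cps_pt L F s n - y - graph_pt L (cell_center n)) - (z - (cps_pt L F s n - y)).
  by move: (graph_pt L x) (graph_pt L _) (cps_pt L F s n - y) => u1 u2 u3; rewrite (opprB u3) (opprB z) !subrKA.
apply: (le_trans (ler_normB _ _)); apply: (@le_trans _ _ (cg + c + (2 * c + cg))); last by lra.
by apply: lerD => //; apply: (le_trans (ler_normB _ _)); apply: lerD.
Qed.

Lemma perimeter_le_volE : (((perimeter unit_vec N)%:R)%:E <=
  ((2 * d)%:R * 2 ^+ d)%:E * volE L (thicken L kappa_bound (bdE L A)))%E.
Proof.
set vol := volE L _.
have half (g : T -> T) : (forall n i, `|((g n) i 0)%:~R - (n i 0)%:~R| <= 1 :> R) ->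
    (((\sum_(n <- N) (g n \notin N))%:R)%:E <= (2 ^+ d)%:E * vol)%E.
  move=> hg; pose S := [seq n <- N | g n \notin N].
  have -> : (\sum_(n <- N) (g n \notin N))%N = size S.
    by rewrite -sum1_size big_filter [RHS]big_mkcond; apply: eq_bigr => n _; case: (_ \in _).
  have := @edge_le_volE S g; rewrite filter_uniq ?fset_uniq // => /(_ isT).
  have hS n : n \in S -> n \in N /\ g n \notin N by rewrite mem_filter => /andP[].
  move=> /(_ hS hg) h; rewrite -/vol in h.
  have -> : ((size S)%:R)%:E = ((2 ^+ d)%:E * ((size S)%:R * (2 * (1 / 4)) ^+ d)%:E)%E :> \bar R.
    rewrite -EFinM mulrCA -exprMn (_ : 2 * (2 * (1 / 4)) = 1); last by field.
    by rewrite expr1n mulr1.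
  by apply: lee_wpmul2l h; rewrite lee_fin exprn_ge0.
have vol0 : (0 <= vol)%E by exact: lebesgue_mx_ge0.
have edge i : (((edge_bd (unit_vec i) N)%:R)%:E <= (2 * 2 ^+ d)%:E * vol)%E.
  rewrite /edge_bd big_split /= natrD EFinD (_ : 2 * 2 ^+ d = 2 ^+ d + 2 ^+ d :> R); last by ring.
  rewrite EFinD ge0_muleDl ?lee_fin ?exprn_ge0 //; apply: leeD.
    apply: (half (fun n => n + unit_vec i)) => n k; rewrite !mxE intrD addrC addKr.
    by case: (_ && _); rewrite ?normr1 ?normr0.
  apply: (half (fun n => n - unit_vec i)) => n k; rewrite !mxE intrB addrC addKr normrN.
  by case: (_ && _); rewrite ?normr1 ?normr0.
move: vol0 edge; rewrite {half}/vol; case: (volE _ _) => [r| |//] vol0 edge; last first.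
  by rewrite gt0_muley ?leey // lte_fin mulr_gt0 ?exprn_gt0 // ltr0n muln_gt0.
rewrite -EFinM lee_fin /perimeter natr_sum.
apply: (@le_trans _ _ (\sum_(i < d) 2 * 2 ^+ d * r)).
  by apply: ler_sum => i _; have := edge i; rewrite -EFinM lee_fin.
by rewrite sumr_const card_ord -[leLHS]mulr_natl natrM le_eqVlt; apply/orP; left; apply/eqP; ring.
Qed.

(** A point x of the core has an index n whose centre is within 1 in each coordinate. Were n outside
    N, its point would be a point of the complement of A too close to x. So the cubes of side 2 at
    the centres of N cover the core. *)
Lemma core_le_card :
  (volE L (core L kappa_bound A) <= ((2 ^+ d) * (#|` N|)%:R)%:E)%E.
Proof.
pose S (j : nat) : seq ('cV[R]_d * 'cV[R]_d) := if j is 0%N then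
  [seq (cell_center n - const_mx 1, cell_center n + const_mx 1) | n <- N] else [::].
rewrite /volE; apply: (@lebesgue_mx_le_seq R d 1 hd isT _ S) => [x|k]; last first.
  have b0 : 0 <= 2 ^+ d * #|` N|%:R :> R by rewrite mulr_ge0 ?exprn_ge0.
  case: k => [|k]; first by rewrite big_ord0.
  rewrite big_ord_recl [X in _ + X]big1 => [|i _]; last by rewrite big_nil.
  rewrite addr0 big_map (eq_bigr (fun=> 2 ^+ d)) => [|n _]; last first.
    rewrite /box_volume (eq_bigr (fun=> 2)) ?prodr_const ?card_ord // => i _.
    rewrite big_ord1 !mxE max_r; first by ring.
    by rewrite subr_ge0; lra.
  by rewrite big_const_seq count_predT iter_addr_0 -[leLHS]mulr_natr.
(* x is only a limit of points outside the thickening; x' is such a point at distance less than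
   1. *)
move=> [Ax /closure_normP hx]; have [x' [Ex' nx'] xx'] := hx 1 ltr01.
pose n : T := \col_i Num.floor (x i 0 - (usubmx s i 0 - usubmx y i 0)).
have xn i : `|x i 0 - cell_center n i 0| <= 1.
  have := floor_itv (x i 0 - (usubmx s i 0 - usubmx y i 0)); rewrite intrD.
  have -> : cell_center n i 0 = (Num.floor (x i 0 - (usubmx s i 0 - usubmx y i 0)))%:~R +
      (usubmx s i 0 - usubmx y i 0) by rewrite !mxE addrA.
  by move=> /andP[? ?]; rewrite ler_norml; apply/andP; split; lra.
have nN : n \in N.
  apply/hN; apply: contrapT => nA; apply: nx'; split => //.
  exists (cps_pt L F s n - y).
    by apply: subset_closure; split => //; apply: EsetB => //; exact: Eset_projE.
  apply: edist_le.
  have h1 : `|graph_pt L x - graph_pt L (cell_center n)| <= cg.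
    rewrite -graph_ptB; apply: (le_trans (hcg _)); rewrite -[leRHS]mulr1 ler_wpM2l ?(ltW cg0) //.
    by apply: norm_le_coord => // i; rewrite [X in `|X|]mxE [X in _ + X]mxE.
  have h2 := cell_center_near n.
  have -> : x' - (cps_pt L F s n - y) = (graph_pt L x - graph_pt L (cell_center n)) -
     (cps_pt L F s n - y - graph_pt L (cell_center n)) - (graph_pt L x - x').
    move: (graph_pt L x) (graph_pt L (cell_center n)) (cps_pt L F s n - y) => u1 u2 u3.
    by apply/matrixP => i j; rewrite !mxE; ring.
  apply: (le_trans (ler_normB _ _)); apply: (@le_trans _ _ (cg + c + 1)).
    by apply: lerD (ltW xx'); apply: (le_trans (ler_normB _ _)); apply: lerD.
  by have := c0; have := cg0; lra.
exists 0%N, (cell_center n - const_mx 1, cell_center n + const_mx 1); first by apply: map_f.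
move=> i j; rewrite ord1 /=; have := xn i; rewrite ler_norml => /andP[? ?].
have -> : (cell_center n - const_mx 1 : 'cV[R]_d) i 0 = cell_center n i 0 - 1 by rewrite !mxE.
have -> : (cell_center n + const_mx 1 : 'cV[R]_d) i 0 = cell_center n i 0 + 1 by rewrite !mxE.
by apply/andP; split; lra.
Qed.

End Region.
End Constants.

(** Degenerate volumes follow the conventions 1/0 = +oo and 0 times +oo = 0: if vc = 0 < vt the
    right side is +oo, and if vc = vt = 0 then p = 0 forces a <= 0. The added 1 keeps the constant
    positive, so that its product with +oo is +oo. *)
Lemma quotient_le (vt vc : \bar R) (a p b1 b2 n C : R) : (0 <= vt)%E -> (0 <= vc)%E ->
  0 <= C -> 0 < n -> 0 < b1 -> 0 < b2 -> 0 <= p ->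
  a <= C * p / n -> (p%:E <= b1%:E * vt)%E -> (vc <= (b2 * n)%:E)%E ->
  (a%:E <= (C * b1 * b2 + 1)%:E * (vt / vc))%E.
Proof.
move=> vt0 vc0 C0 n0 b10 b20 p0 ha hp hvc.
have K0 : 0 < C * b1 * b2 + 1 by rewrite ltr_wpDl // !mulr_ge0 // ltW.
have vcfin : vc \is a fin_num by rewrite ge0_fin_numE // (le_lt_trans hvc) // ltry.
move: vc vc0 vcfin hvc => [c| |] // c0 _; rewrite lee_fin in c0 *; move=> hc.
case: vt vt0 hp => [t| |//] t0 hp; last first.
  have ic0 : (0 < c%:E^-1)%E.
    rewrite inver; have [_|cn0] := eqVneq c 0; first by rewrite ltry.
    by rewrite lte_fin invr_gt0 lt_neqAle eq_sym cn0.
  by rewrite (gt0_mulye ic0) gt0_muley ?leey.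
rewrite inver; have [c_0|cn0] := eqVneq c 0.
  have [t_0|tn0] := eqVneq t 0.
    rewrite t_0 mul0e mule0 lee_fin; apply: (le_trans ha).
    have -> : p = 0 by apply/eqP; rewrite eq_le p0 andbT; move: hp; rewrite t_0 mule0 lee_fin.
    by rewrite mulr0 mul0r.
  rewrite gt0_muley; last by rewrite lte_fin lt_neqAle eq_sym tn0.
  by rewrite gt0_muley ?leey // lte_fin.
rewrite -!EFinM lee_fin; rewrite -EFinM !lee_fin in hp t0.
have cp : 0 < c by rewrite lt_neqAle eq_sym cn0.
apply: (le_trans ha); rewrite ler_pdivrMr //.
have h1 : C * p <= C * (b1 * t) by rewrite ler_wpM2l.
have h2 : 1 <= b2 * n / c by rewrite ler_pdivlMr // mul1r.
have h3 : C * (b1 * t) <= C * (b1 * t) * (b2 * n / c).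
  by rewrite ler_peMr // !mulr_ge0 // ltW.
apply: (le_trans h1); apply: (le_trans h3).
have -> : C * (b1 * t) * (b2 * n / c) = C * b1 * b2 * (t / c) * n by field; rewrite gt_eqF.
rewrite ler_wpM2r ?(ltW n0) // ler_wpM2r ?lerDl //.
by rewrite divr_ge0 // ltW.
Qed.

End Geometry.

(** * Dilates of convex regions *)

Section Convex.
Context {R : realType} {d m : nat}.
Local Notation V := 'cV[R]_(d + m).
Local Notation T := 'cV[int]_d.
Implicit Types (L : 'M[R]_(m, d)) (F : {vspace V}) (s y v w : V) (n h : T) (A : set V).

Lemma convex_mem A v w (l : R) : convex_set A -> A v -> A w -> 0 <= l <= 1 ->
  A (l *: v + (1 - l) *: w).
Proof.
move=> cA Av Aw hl; have := cA v w (Itv01 (andP hl).1 (andP hl).2).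
rewrite !inE.
by move=> /(_ Av Aw).
Qed.

Lemma nbhs0_ball L A : within (Eset L) (nbhs (0 : V)) A ->
  exists2 r : R, 0 < r & forall v, Eset L v -> `|v| <= r -> A v.
Proof.
move=> /nbhs_ballP[e /= e0 he]; exists (e / 2); first by rewrite divr_gt0.
move=> v Ev hv; apply: he => //; rewrite -ball_normE /ball_ /= sub0r normrN.
by apply: (le_lt_trans hv); lra.
Qed.

(** By convexity A contains, along with v, the ball of E of radius (1 - mu) r about mu v; then
    everything is scaled by t. The case mu = 1 is apart because e gets divided by (1 - mu) t. *)
Lemma scaled_interior L A (r t mu : R) v e : convex_set A -> 0 < r -> 0 < t ->
  (forall v, Eset L v -> `|v| <= r -> A v) -> A v -> 0 <= mu <= 1 ->
  Eset L e -> `|e| <= (1 - mu) * t * r -> [set t *: a | a in A] (mu *: (t *: v) + e).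
Proof.
move=> cA r0 t0 hr Av hmu Ee he; have [mu1|mun] := eqVneq mu 1.
  exists v => //; rewrite mu1 scale1r; move: he; rewrite mu1 subrr !mul0r normr_le0.
  by move=> /eqP ->; rewrite addr0.
have mu0 : 0 < 1 - mu by rewrite subr_gt0 lt_neqAle mun; case/andP: hmu.
have p0 : 0 < (1 - mu) * t by rewrite mulr_gt0.
pose w := ((1 - mu) * t)^-1 *: e.
have Aw : A w.
  apply: hr; first exact: EsetZ.
  by rewrite normrZ gtr0_norm ?invr_gt0 // ler_pdivrMl // mulrC.
exists (mu *: v + (1 - mu) *: w); first exact: convex_mem.
rewrite scalerDr !scalerA [t * mu]mulrC; congr (_ + _).
by rewrite (_ : t * _ / _ = 1) ?scale1r //; field; rewrite !gt_eqF.
Qed.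

Section Dilates.
Variables (L : 'M[R]_(m, d)) (F : {vspace V}) (c cg : R).
Hypotheses (adm : admissible L F) (c0 : 0 < c) (cg0 : 0 < cg).
Hypothesis hc : forall v, `|projE L F v| <= c * `|v|.
Hypothesis hcg : forall x, `|graph_pt L x| <= cg * `|x|.
Variables (A : set V) (r M : R).
Hypotheses (cA : convex_set A) (r0 : 0 < r) (M0 : 0 < M).
Hypothesis hr : forall v, Eset L v -> `|v| <= r -> A v.
Hypothesis hM : forall v, A v -> `|v| <= M.

(** W is the total error in [near_scaled_le]. D bounds how often a cell is hit: at most 2W/r + 1
    values of k, and for each of them at most 5^d indices, those of a cube of radius 2. *)
Let W : R := 4 * c + 3 * cg.
Let D : R := (2 * (W / r) + 1) * (5 ^ d)%:R.

Section OneDilate.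
Variables (s y : V) (t : R) (N : {fset T}).
Hypotheses (Ey : Eset L y) (t0 : 4 <= t) (ct : c + 1 <= t).
Hypothesis hN : forall n, n \in N <-> [set t *: a | a in A] (cps_pt L F s n - y).

Local Notation b := (cell_center s y).
Local Notation a n := (cps_pt L F s n - y).

Let tpos : 0 < t. Proof. by apply: lt_le_trans t0. Qed.

Lemma Eset_a n : Eset L (a n).
Proof. by apply: EsetB => //; exact: Eset_projE. Qed.

Lemma norm_b_le n i : n \in N -> `|b n i 0| <= M * t + c.
Proof.
move=> /hN[al Aal aE].
have h1 := cell_center_near adm c0 hc s Ey n.
have h2 : `|a n| <= M * t.
  by rewrite -aE normrZ gtr0_norm // mulrC ler_wpM2r ?(ltW tpos) // hM.
have := coord_le_norm (graph_pt L (b n)) (lshift m i); rewrite col_mxEu => /le_trans; apply.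
have := ler_normB (a n) (a n - graph_pt L (b n)); rewrite subKr.
by move=> /le_trans; apply; rewrite lerD.
Qed.

(* If [mu b n'] is close to [b n] with [mu] too far below 1, then a whole
   neighbourhood of [a n] lies inside the dilate. *)
Lemma near_scaled_le (g : T -> T) n n' (mu : R) :
  (forall n i, `|((g n) i 0)%:~R - (n i 0)%:~R| <= 1 :> R) ->
  g n \notin N -> n' \in N -> 0 <= mu <= 1 ->
  `|b n - mu *: b n'| <= 2 -> (1 - mu) * t * r < W.
Proof.
move=> hg gN /hN[al Aal aE] hmu hb; rewrite ltNge; apply/negP => hW.
have /andP[mu0 mu1] := hmu.
move: gN => /negP; apply; apply/hN.
pose e := a (g n) - mu *: a n'.
have -> : a (g n) = mu *: (t *: al) + e by rewrite /e aE [RHS]addrC subrK.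
apply: (scaled_interior cA r0 tpos hr Aal hmu).
  by apply: EsetB; [exact: Eset_a | apply: EsetZ; exact: Eset_a].
apply: le_trans hW.
have h1 : `|a (g n) - a n| <= 2 * c + cg.
  by rewrite opprB addrA subrK; apply: (cps_pt_step adm c0 cg0 hc hcg); exact: hg.
have h2 := cell_center_near adm c0 hc s Ey n.
have h3 : `|mu *: (a n' - graph_pt L (b n'))| <= c.
  have h5 := cell_center_near adm c0 hc s Ey n'.
  by rewrite normrZ ger0_norm // -[leRHS]mul1r; apply: ler_pM.
have h4 : `|graph_pt L (b n - mu *: b n')| <= 2 * cg.
  by apply: (le_trans (hcg _)); rewrite mulrC ler_wpM2r ?(ltW cg0).
have -> : e = (a (g n) - a n) + (a n - graph_pt L (b n)) +
   graph_pt L (b n - mu *: b n') - mu *: (a n' - graph_pt L (b n')).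
  rewrite /e (graph_ptB L (b n) (mu *: b n')) graph_ptZ (scalerBr mu (a n')).
  move: (a (g n)) (a n) (mu *: a n') (graph_pt L (b n)) (mu *: graph_pt L (b n')) => u1 u2 u3 u4 u5.
  by apply/matrixP => i j; rewrite !mxE; ring.
rewrite /W (_ : 4 * c + 3 * cg = 2 * c + cg + c + 2 * cg + c); last by ring.
apply: (le_trans (ler_normB _ _)); apply: lerD => //.
apply: (le_trans (ler_normD _ _)); apply: lerD => //.
by apply: (le_trans (ler_normD _ _)); apply: lerD.
Qed.

(* The boundary points of a dilate are counted together with about t/2 of
   their homothetic images [shrink k *: b n]: the integer cells of these images
   are hit boundedly often, and there are only O(t^d) of them. *)
Definition shrink (k : nat) : R := 1 - k%:R / t.

Definition shrunk_cell (nk : T * nat) : T := \col_i Num.floor (shrink nk.2 * b nk.1 i 0).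

Lemma shrink_itv k : (k < Num.truncn (t / 2))%N -> 1 / 2 <= shrink k <= 1.
Proof.
move=> hk; have : k%:R <= t / 2.
  have h0 : 0 <= t / 2 by rewrite divr_ge0 // ltW.
  by rewrite -truncn_ge_nat // ltnW.
rewrite /shrink => h; have h1 : k%:R / t <= 1 / 2 by rewrite ler_pdivrMr //; lra.
by have h2 : 0 <= k%:R / t; [rewrite divr_ge0 // ltW | apply/andP; split; lra].
Qed.

Lemma same_cell_close nk nk' i : shrunk_cell nk = shrunk_cell nk' ->
  `|shrink nk.2 * b nk.1 i 0 - shrink nk'.2 * b nk'.1 i 0| <= 1.
Proof.
move=> /matrixP/(_ i 0); rewrite !mxE.
move: (shrink _ * _) (shrink _ * _) => x x' e.
have := floor_itv x; have := floor_itv x'; rewrite e intrD ler_norml.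
by move=> /andP[? ?] /andP[? ?]; apply/andP; split; lra.
Qed.

Lemma same_cell_index_le (g : T -> T) n k n' k' :
  (forall n i, `|((g n) i 0)%:~R - (n i 0)%:~R| <= 1 :> R) ->
  n \in N -> g n \notin N -> n' \in N -> (k <= k')%N -> (k' < Num.truncn (t / 2))%N ->
  shrunk_cell (n, k) = shrunk_cell (n', k') -> k'%:R - k%:R <= W / r.
Proof.
move=> hg nN gN n'N kk' hk' e.
have /andP[l1 l2] := shrink_itv (leq_ltn_trans kk' hk').
have /andP[l3 l4] := shrink_itv hk'.
have l0 : 0 < shrink k by lra.
have ll : shrink k' <= shrink k.
  by rewrite /shrink lerB // ler_pM2r ?invr_gt0 // ler_nat.
(* Equal cells put the two images within 1 of each other; dividing by [shrink k] >= 1/2 gives the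
   distance 2 required by [near_scaled_le]. *)
pose mu := shrink k' / shrink k.
have hmu : 0 <= mu <= 1 by rewrite divr_ge0 ?ler_pdivrMr ?mul1r ?ll //; lra.
have hb : `|b n - mu *: b n'| <= 2.
  apply: norm_le_coord => // i; rewrite [X in `|X|]mxE [X in _ + X]mxE [X in - X]mxE.
  have := same_cell_close i e; rewrite /=.
  have -> : b n i 0 - mu * b n' i 0 = (shrink k * b n i 0 - shrink k' * b n' i 0) / shrink k.
    by rewrite /mu; field; rewrite gt_eqF.
  move=> h; rewrite normrM [X in _ * X]gtr0_norm ?invr_gt0 // ler_pdivrMr //.
  by apply: (le_trans h); lra.
have := near_scaled_le hg gN n'N hmu hb => h.
have h1 : (k'%:R - k%:R) / t <= 1 - mu.
  have -> : 1 - mu = (shrink k - shrink k') / shrink k by rewrite /mu; field; rewrite gt_eqF.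
  have -> : (k'%:R - k%:R) / t = shrink k - shrink k' by rewrite /shrink; ring.
  by rewrite ler_pdivlMr // ler_piMr // subr_ge0.
rewrite ler_pdivlMr //; apply: le_trans (ltW h); rewrite ler_pM2r //.
by rewrite -ler_pdivrMr.
Qed.

Lemma boundary_count_le (B : seq T) (g : T -> T) : uniq B ->
  (forall n i, `|((g n) i 0)%:~R - (n i 0)%:~R| <= 1 :> R) ->
  (forall n, n \in B -> n \in N /\ g n \notin N) ->
  (size B)%:R * t <= 4 * D * ((2 * M + 3) * t) ^+ d.
Proof.
move=> uB hg hB; set q := Num.truncn (t / 2).
have th0 : 0 <= t / 2 by rewrite divr_ge0 // ltW.
(* Rounding t/2 down loses less than 1, and 1 <= t/4 because t >= 4. *)
have qt : t / 4 <= q%:R.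
  by have /andP[_] := truncn_itv th0; rewrite -/q -(natr1 q); have := t0; lra.
have WR0 : 0 <= W / r by rewrite divr_ge0 ?(ltW r0) // /W addr_ge0 // mulr_ge0 ?(ltW c0) ?(ltW cg0).
have D0 : 0 <= D by rewrite /D mulr_ge0 // addr_ge0 // mulr_ge0.
have MT0 : 0 <= (M + 1) * t by rewrite mulr_ge0 ?(ltW tpos) // addr_ge0 // ltW.
pose P := [seq (n, k) | n <- B, k <- iota 0 q].
have memP nk : nk \in P -> [/\ nk.1 \in B & (nk.2 < q)%N].
  by case: nk => n k /allpairsP[[n' k'] /= [? + [-> ->]]]; rewrite mem_iota.
have uP : uniq P by rewrite allpairs_uniq ?iota_uniq // => -[? ?] [? ?].
set K := Num.truncn ((M + 1) * t).
have cellK nk : nk \in P -> shrunk_cell nk \in (idx_box 0 K : seq T).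
  move=> /memP[nB kq]; have [nN _] := hB _ nB; rewrite mem_idx_box; apply/forallP => i.
  rewrite [(0 : T) i 0]mxE subr0 -abszE lez_nat truncn_ge_nat //.
  have -> : (absz (shrunk_cell nk i 0))%:R = `|(shrunk_cell nk i 0)%:~R| :> R.
    by rewrite -intr_norm -abszE.
  have h1 := norm_b_le i nN; have /andP[h2 h3] := shrink_itv kq.
  have h4 : `|shrink nk.2 * b nk.1 i 0| <= M * t + c.
    have sh0 : 0 <= shrink nk.2 by lra.
    by rewrite normrM (ger0_norm sh0); apply: le_trans h1; rewrite ler_piMl.
  rewrite mxE; have := floor_itv (shrink nk.2 * b nk.1 i 0); rewrite intrD.
  move: h4; rewrite !ler_norml => /andP[? ?] /andP[? ?].
  by apply/andP; split; have := ct; lra.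
(* For equal k, indices with the same cell differ by at most 2 in each coordinate, as [shrink k] >=
   1/2. The values of k themselves lie within W/r of any one of them. *)
have fibre z : z \in (idx_box 0 K : seq T) ->
    (count (fun nk => shrunk_cell nk == z) P)%:R <= D.
  move=> _; rewrite -size_filter; set Pz := [seq _ <- _ | _].
  have memPz nk : nk \in Pz -> [/\ nk.1 \in B, (nk.2 < q)%N & shrunk_cell nk = z].
    by rewrite mem_filter => /andP[/eqP ? /memP[]].
  have uPz : uniq Pz by rewrite filter_uniq.
  have [Pz0|[nk0 nk0P]] : Pz = [::] \/ exists nk, nk \in Pz.
    by case: (Pz) => [|nk s']; [left | right; exists nk; rewrite mem_head].
    by rewrite Pz0.
  have := @size_le_fibres R _ _ snd Pz (undup (map snd Pz)) (5 ^ d)%:R (undup_uniq _).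
  move=> /(_ _ _)/le_trans; apply.
  - by move=> nk nkP; rewrite mem_undup map_f.
  - move=> k _; rewrite -size_filter ler_nat; set Pk := [seq _ <- _ | _].
    have [Pk0|[nk1 nk1P]] : Pk = [::] \/ exists nk, nk \in Pk.
      by case: (Pk) => [|nk s']; [left | right; exists nk; rewrite mem_head].
      by rewrite Pk0.
    rewrite -(size_map fst) -(card_idx_box nk1.1 2).
    have memPk nk : nk \in Pk -> nk.2 = k /\ nk \in Pz by rewrite mem_filter => /andP[/eqP].
    apply: uniq_leq_size.
      rewrite map_inj_in_uniq ?filter_uniq // => -[n2 k2] [n3 k3].
      by move=> /memPk[/= -> _] /memPk[/= -> _] /= ->.
    move=> _ /mapP[nk /memPk[k2 nkP] ->]; have [k1 nk1P'] := memPk _ nk1P.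
    rewrite mem_idx_box; apply/forallP => i.
    have [_ kq e2] := memPz _ nkP; have [_ _ e1] := memPz _ nk1P'.
    have := same_cell_close i (etrans e2 (esym e1)); rewrite k2 k1 -mulrBr.
    have /andP[h2 h3] := shrink_itv kq; rewrite k2 in h2 h3.
    have -> : b nk.1 i 0 - b nk1.1 i 0 = (nk.1 i 0 - nk1.1 i 0)%:~R.
      by rewrite !mxE intrB; ring.
    rewrite normrM gtr0_norm; last by lra.
    move=> h4; have : `|(nk.1 i 0 - nk1.1 i 0)%:~R| <= 2%:~R :> R.
      rewrite -(ler_pM2l (_ : 0 < 1 / 2 :> R)); last by lra.
      apply: (le_trans (ler_wpM2r _ h2)) => //; apply: (le_trans h4); lra.
    by rewrite -intr_norm ler_int.
  rewrite ler_wpM2r // -(size_map (fun k : nat => k%:Z)).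
  rewrite (_ : 2 * (W / r) + 1 = (W / r + W / r) + 1); last by ring.
  apply: (@size_int_window R _ (nk0.2%:R - W / r)).
  - by rewrite map_inj_uniq ?undup_uniq // => ? ? [].
  - by rewrite addr_ge0.
  move=> _ /mapP[k + ->]; rewrite mem_undup => /mapP[nk nkP ->].
  have [nB kq e1] := memPz _ nkP; have [nB0 kq0 e2] := memPz _ nk0P.
  have [nN gN] := hB _ nB; have [nN0 gN0] := hB _ nB0.
  rewrite -[nk.2%:Z%:~R]/(nk.2%:R : R); move: nk nk0 e1 e2 {nkP nk0P} nN gN nN0 gN0 {nB nB0} kq kq0.
  move=> [n1 k1] [n2 k2] /= e1 e2 nN gN nN0 gN0 kq kq0.
  case: (leqP k1 k2) => kk.
    have := same_cell_index_le hg nN gN nN0 kk kq0 (etrans e1 (esym e2)).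
    have : k1%:R <= k2%:R :> R by rewrite ler_nat.
    by move=> ? ?; apply/andP; split; lra.
  have := same_cell_index_le hg nN0 gN0 nN (ltnW kk) kq (etrans e2 (esym e1)).
  have : k2%:R <= k1%:R :> R by rewrite ler_nat ltnW.
  by move=> ? ?; apply/andP; split; lra.
have := @size_le_fibres R _ _ shrunk_cell P (idx_box 0 K) D (fset_uniq _) cellK fibre.
rewrite size_allpairs size_iota natrM.
have -> : (size (idx_box 0 K : seq T)) = ((2 * K).+1 ^ d)%N by rewrite -(card_idx_box (0 : T) K).
rewrite natrX => h.
have hK : (2 * K).+1%:R <= (2 * M + 3) * t.
  have /andP[h1 _] := truncn_itv MT0; rewrite -/K in h1.
  by rewrite -(natr1 (2 * K)) natrM; have := t0; lra.
have h2 : ((2 * K).+1%:R) ^+ d * D <= ((2 * M + 3) * t) ^+ d * D.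
  rewrite ler_wpM2r // lerXn2r ?nnegrE // mulr_ge0 ?(ltW tpos) //.
  by rewrite addr_ge0 // mulr_ge0 // ltW.
have h3 : (size B)%:R * (t / 4) <= (size B)%:R * q%:R by rewrite ler_wpM2l.
by lra.
Qed.

(** The dilate contains the ball of E of radius r t, hence all points of Y - y whose indices lie in
    a cube around the index [n0] with centre nearest the origin up to rounding. *)
Lemma card_dilate_ge : 2 * (c + cg) <= r * t ->
  (r * t / (2 * cg)) ^+ d <= #|` N|%:R.
Proof.
(* A point whose index is within k of [n0] has norm at most c + cg (k + 1), and this is at most r t
   exactly when k <= z. *)
move=> ht; pose z := (r * t - c) / cg - 1.
have rt0 : 0 <= r * t by rewrite mulr_ge0 // ltW.
have z1 : z * cg = r * t - c - cg by rewrite /z; field; rewrite gt_eqF.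
have z0 : 0 <= z.
  by rewrite -(ler_pM2r cg0) mul0r z1; have := c0; have := cg0; lra.
have /andP[k1 k2] := truncn_itv z0; set k := Num.truncn z in k1 k2.
pose n0 : T := \col_i - Num.floor (usubmx s i 0 - usubmx y i 0).
have b0 i : `|b n0 i 0| <= 1.
  have -> : b n0 i 0 = frac_part (usubmx s i 0 - usubmx y i 0).
    by rewrite !mxE mulrNz /frac_part; ring.
  by have /andP[h0 h1] := frac_part_itv (usubmx s i 0 - usubmx y i 0); rewrite ger0_norm // ltW.
have sub n : n \in idx_box n0 k -> n \in N.
  rewrite mem_idx_box => /forallP hn; apply/hN.
  have bn : `|b n| <= k%:R + 1.
    apply: norm_le_coord => [|i]; first by rewrite addr_ge0.
    have -> : b n i 0 = (n i 0 - n0 i 0)%:~R + b n0 i 0 by rewrite !mxE intrB; ring.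
    apply: (le_trans (ler_normD _ _)); apply: lerD => //.
    by rewrite -intr_norm -[k%:R]/(k%:Z%:~R) ler_int.
  have an : `|a n| <= r * t.
    have h1 := cell_center_near adm c0 hc s Ey n.
    have := ler_normD (a n - graph_pt L (b n)) (graph_pt L (b n)); rewrite subrK.
    move=> /le_trans; apply; apply: (@le_trans _ _ (c + cg * (k%:R + 1))).
      by apply: lerD => //; apply: (le_trans (hcg _)); rewrite ler_wpM2l // ltW.
    have : k%:R * cg <= z * cg by rewrite ler_wpM2r // ltW.
    by rewrite z1; lra.
  exists (t^-1 *: a n); last by rewrite scalerA divff ?scale1r // gt_eqF.
  apply: hr; first by apply: EsetZ; exact: Eset_a.
  by rewrite normrZ gtr0_norm ?invr_gt0 // ler_pdivrMl // mulrC.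
have : (#|` idx_box n0 k| <= #|` N|)%N by apply: fsubset_leq_card; apply/fsubsetP.
rewrite -(ler_nat R) card_idx_box natrX; apply: le_trans.
rewrite lerXn2r ?nnegrE ?divr_ge0 ?mulr_ge0 ?(ltW cg0) ?(ltW r0) ?(ltW tpos) //.
rewrite ler_pdivrMr ?mulr_gt0 //.
have h1 : z * cg <= (k%:R + 1) * cg.
  by rewrite ler_wpM2r ?(ltW cg0) // natr1 ltW.
have h2 : 0 <= k%:R * cg by rewrite mulr_ge0 // ltW.
rewrite -(natr1 (2 * k)) natrM; move: h1; rewrite z1.
by have := ht; have := cg0; lra.
Qed.

Lemma perimeter_dilate_le :
  (perimeter unit_vec N)%:R * t <= (2 * d)%:R * (4 * D * ((2 * M + 3) * t) ^+ d).
Proof.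
have half (g : T -> T) : (forall n i, `|((g n) i 0)%:~R - (n i 0)%:~R| <= 1 :> R) ->
    (\sum_(n <- N) (g n \notin N))%:R * t <= 4 * D * ((2 * M + 3) * t) ^+ d.
  move=> hg; pose B := [seq n <- N | g n \notin N].
  have -> : (\sum_(n <- N) (g n \notin N))%N = size B.
    by rewrite -sum1_size big_filter [RHS]big_mkcond; apply: eq_bigr => n _; case: (_ \in _).
  apply: (boundary_count_le (g := g)) => //; first by rewrite filter_uniq ?fset_uniq.
  by move=> n; rewrite mem_filter => /andP[].
set X := 4 * D * _ in half *.
have edge i : (edge_bd (unit_vec i) N)%:R * t <= 2 * X.
  rewrite /edge_bd big_split /= natrD mulrDl (_ : 2 * X = X + X); last by ring.
  apply: lerD.
    apply: (half (fun n => n + unit_vec i)) => n k; rewrite !mxE intrD addrC addKr.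
    by case: (_ && _); rewrite ?normr1 ?normr0.
  apply: (half (fun n => n - unit_vec i)) => n k; rewrite !mxE intrB addrC addKr normrN.
  by case: (_ && _); rewrite ?normr1 ?normr0.
rewrite /perimeter natr_sum mulr_suml (le_trans (ler_sum _ (fun i _ => edge i))) //.
rewrite sumr_const card_ord -[leLHS]mulr_natl natrM mulrCA !mulrA.
exact: lexx.
Qed.

End OneDilate.

(** The bound on t times the perimeter divided by the lower bound on the cardinality; the powers t^d
    cancel. *)
Definition dilate_const : R := (2 * d)%:R * (4 * D) * ((2 * M + 3) * (2 * cg / r)) ^+ d.

Lemma convex_perimeter s y (t : R) (N : {fset T}) : Eset L y ->
  4 <= t -> c + 1 <= t -> 2 * (c + cg) / r <= t ->
  (forall n, n \in N <-> [set t *: a | a in A] (cps_pt L F s n - y)) ->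
  (perimeter unit_vec N)%:R * t <= dilate_const * #|` N|%:R.
Proof.
move=> Ey t0 ct rt hN; have tpos : 0 < t by apply: lt_le_trans t0.
apply: (le_trans (perimeter_dilate_le Ey t0 ct hN)).
have rt' : 2 * (c + cg) <= r * t by rewrite [leRHS]mulrC -ler_pdivrMr.
have hcard := card_dilate_ge Ey t0 hN rt'.
have -> : (2 * d)%:R * (4 * D * ((2 * M + 3) * t) ^+ d) =
    dilate_const * (r * t / (2 * cg)) ^+ d.
  rewrite /dilate_const -[RHS]mulrA -exprMn [LHS]mulrA; congr (_ * _ ^+ _).
  by field; rewrite !gt_eqF.
have WR0 : 0 <= W / r.
  by rewrite divr_ge0 ?(ltW r0) // addr_ge0 // mulr_ge0 ?(ltW c0) ?(ltW cg0).
have D0 : 0 <= D by rewrite /D mulr_ge0 // addr_ge0 // mulr_ge0.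
have E0 : 0 <= 2 * M + 3 by have := M0; lra.
have E1 : 0 <= 2 * cg / r by rewrite divr_ge0 ?(ltW r0) // mulr_ge0 // ltW.
apply: ler_wpM2l hcard; rewrite /dilate_const; apply: mulr_ge0.
  by rewrite mulr_ge0 // mulr_ge0.
by rewrite exprn_ge0 // mulr_ge0.
Qed.

End Dilates.
End Convex.

(** * The distance kappa as a function of the projection *)

Section Kappa.
Context {R : realType} {d m : nat}.
Local Notation V := 'cV[R]_(d + m).

Lemma bounded_setI (A : set V) (M : R) : (forall v, A v -> `|v| <= M) -> bounded_set A.
Proof.
move=> hM; exists M; split; first exact: num_real.
by move=> x Mx v /hM h; apply: (le_trans h); exact: ltW.
Qed.

Lemma graph_pt_bounded (L : 'M[R]_(m, d)) :
  exists2 cg : R, 0 < cg & forall x, `|graph_pt L x| <= cg * `|x|.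
Proof.
have [c c0 hc] := linear_bounded (mulmx L : {linear 'cV[R]_d -> 'cV[R]_m}).
exists (1 + c) => [|x]; first by rewrite addr_gt0.
apply: norm_le_coord => [|i]; first by rewrite mulr_ge0 // addr_ge0 // ltW.
rewrite mxE mulrDl mul1r; case: splitP => k _.
  by apply: (le_trans (coord_le_norm _ _)); rewrite lerDl mulr_ge0 // ltW.
by apply: (le_trans (coord_le_norm _ _)); apply: (le_trans (hc _)); rewrite lerDr.
Qed.

(** kappa is chosen for each endomorphism before L and F are known, with value 1 where no admissible
    pair has this projection. Two pairs with the same projection share L by [projE_inj_map], so the
    bounds found for one hold for the other. *)
Lemma kappa_exists : exists kappa : 'End(V) -> R, (forall f, 0 < kappa f) /\
  forall L F, admissible L F -> exists c cg : R, [/\ 0 < c, 0 < cg,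
    forall v, `|projE L F v| <= c * `|v|, forall x, `|graph_pt L x| <= cg * `|x|
    & (0 < d)%N -> kappa (projE L F) = @kappa_bound R d m c cg].
Proof.
have /choice[kappa hk] : forall f : 'End(V), exists k : R, 0 < k /\
    forall L F, admissible L F -> projE L F = f -> exists c cg : R, [/\ 0 < c, 0 < cg,
    forall v, `|f v| <= c * `|v|, forall x, `|graph_pt L x| <= cg * `|x|
    & (0 < d)%N -> k = @kappa_bound R d m c cg].
  move=> f; have [[[L F] [/= adm fE]]|nf] :=
    pselect (exists LF : 'M[R]_(m, d) * {vspace V}, admissible LF.1 LF.2 /\ projE LF.1 LF.2 = f).
    have [c c0 hc] := linear_bounded f; have [cg cg0 hcg] := graph_pt_bounded L.
    have [d_0|d0] := eqVneq d 0%N.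
      exists 1; split => // L' F' adm' e; exists c, cg; split => //.
        by have -> := projE_inj_map adm' adm (etrans e (esym fE)).
      by rewrite d_0.
    exists (@kappa_bound R d m c cg); split.
      rewrite /kappa_bound mulr_gt0 ?ltr0n ?addn_gt0 ?lt0n ?d0 //.
      by rewrite !addr_gt0 ?mulr_gt0.
    move=> L' F' adm' e; exists c, cg; split => //.
    by have -> := projE_inj_map adm' adm (etrans e (esym fE)).
  by exists 1; split => // L F adm e; case: nf; exists (L, F).
exists kappa; split=> [f|L F adm]; first by have [] := hk f.
by have [_ h] := hk (projE L F); exact: h adm erefl.
Qed.

End Kappa.

(** The order of the quantifiers expresses the dependence of the constants: kappa precedes L and
    sees only the projection; C precedes s, the class and both base points, and in the first formula
    also A, while in the second C and the threshold follow the convex set A. The second bound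
    compares perimeter and cardinality of the index set directly, without passing through
    volumes. *)
Theorem corollary5p10 (R : realType) (d m : nat)
    (hd : (2 <= d)%N) (hm : (1 <= m)%N) :
  exists kappa : 'End('cV[R]_(d + m)) -> R,
    (forall f, 0 < kappa f) /\
    forall eps : R, 0 < eps ->
    almost_all (fun L : 'M[R]_(m, d) =>
      totally_irrational L ->
      forall F : {vspace 'cV[R]_(d + m)}, admissible L F ->
      (exists C : patch_class R d m -> R,
        uniform_on_typeII C /\
        forall s, regular L F s ->
        forall P, is_patch_class L F s P ->
        forall y0 y, cps L F s y0 -> cps L F s y ->
        forall A : set 'cV[R]_(d + m),
          A `<=` Eset L -> bounded_set A -> A 0 ->
          ((`|emp_freq L F s P y A - freq L F s P y0|)%:E <=
            (C P)%:E * (volE L (thicken L (kappa (projE L F)) (bdE L A)) /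
                        volE L (core L (kappa (projE L F)) A)))%E)
      /\
      (forall A : set 'cV[R]_(d + m), convex_bounded_nbhs0 L A ->
        exists (C : patch_class R d m -> R) (t0 : R),
        uniform_on_typeII C /\
        forall s, regular L F s ->
        forall P, is_patch_class L F s P ->
        forall y0 y, cps L F s y0 -> cps L F s y ->
        forall t : R, 0 < t -> t0 <= t ->
          `|emp_freq L F s P y [set t *: a | a in A] - freq L F s P y0|
            <= C P * t^-1)).
Proof.
have d0 : (0 < d)%N by apply: leq_trans hd.
have [kappa [kappa0 hkappa]] := @kappa_exists R d m.
exists kappa; split => // eps _.
apply/eqP; rewrite eq_le lebesgue_mx_ge0 andbT -(almost_all_nonresonant hm hd).
apply: le_lebesgue_mx => L hL /= hnr; apply: hL => _ F adm.
have [C [uC C0 hC]] := class_discrepancy adm hnr.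
have [c [cg [c0 cg0 hc hcg hk]]] := hkappa L F adm.
have Ey s y : regular L F s -> cps L F s y -> Eset L y.
  by move=> reg /(cpsP adm _ reg)[n ->]; exact: Eset_projE.
have region s y A : regular L F s -> cps L F s y -> bounded_set A -> A 0 ->
    exists N : {fset 'cV[int]_d}, [/\ forall n, n \in N <-> A (cps_pt L F s n - y),
      forall n, n \in N <-> [set a + y | a in A] (cps_pt L F s n) & (0 < #|` N|)%N].
  move=> reg cy /bounded_setP[M M0 hM] A0.
  have bX : bounded_set [set v | A (v - y)].
    apply: (@bounded_setI _ _ _ _ (M + `|y|)) => v /hM h.
    have := ler_normD (v - y) y; rewrite subrK => /le_trans; apply.
    by rewrite lerD2r.
  have [N hN] := finite_region_idx adm c0 hc s bX; exists N; split => //.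
    move=> n; split=> [/hN h|[a Aa aE]]; first by exists (cps_pt L F s n - y); rewrite ?subrK.
    by apply/hN; rewrite /= -aE addrK.
  have [n yE] := (cpsP adm _ reg).1 cy; rewrite cardfs_gt0; apply/fset0Pn; exists n.
  by apply/hN; rewrite /= -yE subrr.
split.
  (* 2 d 2^d comes from [perimeter_le_volE], the other 2^d from [core_le_card], and 1 from
     [quotient_le]. *)
  exists (fun P => C P * ((2 * d)%:R * 2 ^+ d) * 2 ^+ d + 1); split.
    by move=> P P' tP tP'; rewrite (uC P P').
  move=> s reg P hP y0 y cy0 cy A AE bA A0.
  have [xi hxi] := hC s reg P hP; have [n0 ->] := (cpsP adm _ reg).1 cy0.
  rewrite (freq_eq adm n0 reg (ltW (C0 P)) hxi).
  have [N [hN hN' N0]] := region s y A reg cy bA A0.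
  rewrite hk //; apply: (@quotient_le R _ _ _ (perimeter unit_vec N)%:R _ _ (#|` N|%:R) (C P)) => //.
  - exact: lebesgue_mx_ge0.
  - exact: lebesgue_mx_ge0.
  - exact: ltW.
  - by rewrite ltr0n.
  - by rewrite mulr_gt0 ?exprn_gt0 // ltr0n muln_gt0.
  - exact: emp_freq_le hN' N0 (hxi N).
  - exact: (perimeter_le_volE adm c0 cg0 hc hcg d0 (Ey s y reg cy) AE hN).
  - exact: (core_le_card adm c0 cg0 hc hcg d0 (Ey s y reg cy) hN).
move=> A [AE cA bA /nbhs0_ball[r r0 hr]]; have [M M0 hM] := bounded_setP bA.
(* t >= 4 leaves at least t/4 homothetic images, t >= c + 1 keeps their cells in a cube of radius (M
   + 1) t, and the last bound makes the ball of radius r t large enough for [card_dilate_ge]. *)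
exists (fun P => C P * @dilate_const R d c cg r M), (Num.max 4 (Num.max (c + 1) (2 * (c + cg) / r))).
split; first by move=> P P' tP tP'; rewrite (uC P P').
move=> s reg P hP y0 y cy0 cy t t0; rewrite !ge_max => /and3P[t4 tc tr].
have [xi hxi] := hC s reg P hP; have [n0 ->] := (cpsP adm _ reg).1 cy0.
rewrite (freq_eq adm n0 reg (ltW (C0 P)) hxi).
have bt : bounded_set [set t *: a | a in A].
  apply: (@bounded_setI _ _ _ _ (t * M)) => _ [a /hM h <-].
  by rewrite normrZ gtr0_norm // ler_wpM2l // ltW.
have At0 : [set t *: a | a in A] 0.
  exists 0; last by rewrite scaler0.
  by apply: hr; [exact: mem0v | rewrite normr0 ltW].
have [N [hN hN' N0]] := region s y _ reg cy bt At0.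
apply: (le_trans (emp_freq_le adm reg hN' N0 (hxi N))).
have NR : 0 < #|` N|%:R :> R by rewrite ltr0n.
have h := convex_perimeter adm c0 cg0 hc hcg cA r0 M0 hr hM (Ey s y reg cy) t4 tc tr hN.
rewrite -ler_pdivlMr // in h; rewrite ler_pdivrMr //.
apply: (le_trans (ler_wpM2l (ltW (C0 P)) h)).
by rewrite !mulrA [leLHS]mulrAC.
Qed.
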